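(* In the nonclassical case $2\ell\notin\mathbf{Z}$, finite projective monodromy of the Lamé equation is not uniquely determined by $\ell$: there exist $\ell\in\mathbf{C}$ with $2\ell\notin\mathbf{Z}$ and two algebraic-form Lamé operators with this same value of $\ell$ (but with possibly different $B$ and $e_1,e_2,e_3$) whose projective monodromy groups are both finite and are not isomorphic to each other.
   Context: For $\ell,B\in\mathbf{C}$ and distinct $e_1,e_2,e_3\in\mathbf{C}$ with $e_1+e_2+e_3=0$, the algebraic-form Lamé operator on $\mathbf{P}^1(\mathbf{C})$ (coordinate $x$) is $$L_{\ell,B} = D^2 + \frac12\sum_{i=1}^3\frac{1}{x-e_i}\,D - \frac{\ell(\ell+1)x+B}{4\prod_{i=1}^3(x-e_i)},\qquad D=\frac{d}{dx}.$$ Projective monodromy group $G(L_{\ell,B})$: choose an ordinary point $P$ and two independent local solutions at $P$. Analytic continuation along loops based at $P$ in $\mathbf{P}^1(\mathbf{C})\setminus\{e_1,e_2,e_3,\infty\}$ gives a representation of the fundamental group in $GL(2,\mathbf{C})$, and $G(L_{\ell,B})$ is the image of this monodromy group in $PGL(2,\mathbf{C})$ (well defined up to isomorphism). *)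

(* Defs.v *)
From HB Require Import structures.
From mathcomp Require Import all_boot all_order all_algebra.
From mathcomp Require Import all_classical all_reals all_analysis.
From mathcomp Require Import complex.
Set Implicit Arguments.
Unset Strict Implicit.
Unset Printing Implicit Defensive.
Import Order.TTheory GRing.Theory Num.Theory.
Import numFieldNormedType.Exports.
Local Open Scope classical_set_scope.
Local Open Scope ring_scope.
Local Open Scope complex_scope.

(* R[i] as a normed module over itself; the topology is the one of its modulus. *)
HB.instance Definition _ (R : realType) := NormedModule.copy R[i] R[i]^o.

Definition lame_op (R : realType) (l B : R[i]) (e : 'I_3 -> R[i])
    (u : R[i] -> R[i]) : R[i] -> R[i] := fun x =>
  derive1 (derive1 u) x
  + 2^-1 * (\sum_i (x - e i)^-1) * derive1 u x
  - (l * (l + 1) * x + B) / (4 * \prod_i (x - e i)) * u x.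

(* Differentiability is over the field R[i], hence complex differentiability:
   near P, u is a holomorphic solution. *)
Definition local_solution (R : realType) (l B : R[i]) (e : 'I_3 -> R[i])
    (P : R[i]) (u : R[i] -> R[i]) : Prop :=
  \forall x \near P,
    [/\ derivable u x 1, derivable (derive1 u) x 1 & lame_op l B e u x = 0].

Definition ordinary_point (R : realType) (e : 'I_3 -> R[i]) (P : R[i]) : Prop :=
  forall i, P <> e i.

(* Two local solutions at P whose germs at P are linearly independent. *)
Definition local_basis (R : realType) (l B : R[i]) (e : 'I_3 -> R[i])
    (P : R[i]) (u : 'I_2 -> R[i] -> R[i]) : Prop :=
  (forall j, local_solution l B e P (u j)) /\
  (forall c : 'I_2 -> R[i],
     (\forall x \near P, \sum_j c j * u j x = 0) -> forall j, c j = 0).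

(* The complement of {e_1, e_2, e_3, oo} in P^1(C) is the complement of
   {e_1, e_2, e_3} in C. *)
Definition loop_at (R : realType) (e : 'I_3 -> R[i]) (P : R[i])
    (g : R -> R[i]) : Prop :=
  [/\ {within `[0, 1], continuous g},
      g 0 = P, g 1 = P &
      forall t, t \in `[0, 1] -> ordinary_point e (g t)].

(* F t represents a germ at g t; germs at nearby points of the path agree.
   The analytic continuation of a solution is again a solution (permanence of
   functional relations), so the germs are taken among local solutions. *)
Definition continuation_along (R : realType) (l B : R[i]) (e : 'I_3 -> R[i])
    (g : R -> R[i]) (F : R -> R[i] -> R[i]) : Prop :=
  forall t, t \in `[0, 1] ->
    local_solution l B e (g t) (F t) /\
    (\forall s \near t, s \in `[0, 1] -> \forall x \near g s, F s x = F t x).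

(* Continuation along g carries the row (u_0, u_1) to (u_0, u_1) M. *)
Definition monodromy_matrix (R : realType) (l B : R[i]) (e : 'I_3 -> R[i])
    (P : R[i]) (u : 'I_2 -> R[i] -> R[i]) (g : R -> R[i])
    (M : 'M[R[i]]_2) : Prop :=
  exists F : 'I_2 -> R -> R[i] -> R[i],
    forall j,
      [/\ continuation_along l B e g (F j),
          \forall x \near P, F j 0 x = u j x &
          \forall x \near P, F j 1 x = \sum_i u i x * M i j].

Definition monodromy_group (R : realType) (l B : R[i]) (e : 'I_3 -> R[i])
    (P : R[i]) (u : 'I_2 -> R[i] -> R[i]) : set 'M[R[i]]_2 :=
  [set M | M \in unitmx /\
     exists g, loop_at e P g /\ monodromy_matrix l B e P u g M].

(* Elements of PGL(2) are represented as the cosets {c M | c <> 0} of the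
   nonzero scalars, for invertible M, and multiplied as cosets. *)
Definition pgl_class (R : realType) (M : 'M[R[i]]_2) : set 'M[R[i]]_2 :=
  [set c *: M | c in [set c : R[i] | c <> 0]].

Definition pgl_mul (R : realType) (X Y : set 'M[R[i]]_2) : set 'M[R[i]]_2 :=
  [set M *m N | M in X & N in Y].

Definition is_projective_monodromy_group (R : realType) (l B : R[i])
    (e : 'I_3 -> R[i]) (G : set (set 'M[R[i]]_2)) : Prop :=
  exists (P : R[i]) (u : 'I_2 -> R[i] -> R[i]),
    [/\ ordinary_point e P, local_basis l B e P u &
        G = [set pgl_class M | M in monodromy_group l B e P u]].

Definition pgl_isomorphic (R : realType) (G H : set (set 'M[R[i]]_2)) : Prop :=
  exists f : set 'M[R[i]]_2 -> set 'M[R[i]]_2,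
    set_bij G H f /\
    (forall X Y, G X -> G Y -> f (pgl_mul X Y) = pgl_mul (f X) (f Y)).

(* Main.v *)
(** Both operators have l = 1/6, and both have algebraic solutions. Let f, W
    be Klein's octahedral forms of degrees 6 and 8. On the curve W(a, b) =
    3, 2 f(a, b)^2 = x, differentiation gives a first-order system s a' =
    W_b, s b' = - W_a, where s^2 is a multiple of x^3 - x; consequently a
    and b solve the Lame equation with e = (0, 1, -1) and B = 0. With the
    icosahedral forms f, H of degrees 12 and 20, the curve f(a, b) = x -
    2/3, H(a, b) = 20 (x - 2/3) - 8 gives in the same way, W being replaced
    by H - 20 f, a Lame equation with B = -2/27.

    Relations between germs persist under analytic continuation, so the
    monodromy matrices preserve f up to sign; they permute the zeros of f in
    P^1, and there are finitely many of them modulo scalars. A loop along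
    which (a, b) becomes (w a, b/w), w^4 = -1, gives an element of order 4
    in the octahedral group. In the icosahedral group there is no element of
    order 4: an eigenvector of such a matrix would be a multiple root of f. *)

(* The choice l = 1/6 and the two curves come from growth rates. The exponents are 0 and 1/2 at each
   e_i, and solutions grow at infinity at most like x^(l/2) = x^(1/12); so a form of degree n that
   is single-valued on a basis of solutions is a polynomial in x of degree at most n/12. In the
   octahedral case this makes W constant and f^2 linear, in the icosahedral case f and H at most
   linear. The icosahedral constants are then dictated by the syzygy T^2 = 1728 f^5 - H^3, whose
   zeros of odd order must be the e_i: the line H = 20 f - 8 is tangent to the curve H^3 = 1728 f^5
   at f = 1, which leaves (f - 1)^2 times a cubic, and x = f + 2/3 makes the roots of that cubic sum
   to zero. Neither group is determined. Finiteness needs only an invariant form with three zeros,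
   and the comparison only one element of order 4 on one side and none on the other. The solutions
   are known only implicitly, so continuation is handled through relations among (x, a, b, a', b')
   that determine the germs. *)
Require Import Defs.
From mathcomp Require Import all_boot all_order all_algebra.
From mathcomp Require Import all_classical all_reals all_analysis.
From mathcomp Require Import complex ring lra.
Set Implicit Arguments.
Unset Strict Implicit.
Unset Printing Implicit Defensive.
Import Order.TTheory GRing.Theory Num.Theory.
Import numFieldNormedType.Exports.
Local Open Scope classical_set_scope.
Local Open Scope ring_scope.
Local Open Scope complex_scope.

(** * Complex differentiation *)

Section Derivation.
Variable K : numFieldType.
Implicit Types (f g : K -> K) (x a b : K).

(** The value is an argument, so derivatives of composite expressions can be assembled by
    unification. The casts to [K^o] view the field as a normed module over itself. *)
Definition has_derivative f x a := is_derive (x : K^o) (1 : K^o) (f : K^o -> K^o) (a : K^o).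

Lemma hdcst x a : has_derivative (fun=> a) x 0.
Proof. exact: is_derive_cst. Qed.

Lemma hdid x : has_derivative (fun y => y) x 1.
Proof. exact: is_derive_id. Qed.

Lemma hdD f g x a b : has_derivative f x a -> has_derivative g x b ->
  has_derivative (fun y => f y + g y) x (a + b).
Proof. by move=> ? ?; exact: is_deriveD. Qed.

Lemma hdN f x a : has_derivative f x a -> has_derivative (fun y => - f y) x (- a).
Proof. by move=> ?; exact: is_deriveN. Qed.

Lemma hdM f g x a b : has_derivative f x a -> has_derivative g x b ->
  has_derivative (fun y => f y * g y) x (f x * b + g x * a).
Proof. by move=> ? ?; exact: is_deriveM. Qed.

Lemma hdX f n x a : has_derivative f x a ->
  has_derivative (fun y => f y ^+ n) x (n%:R * f x ^+ n.-1 * a).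
Proof.
move=> h; have := is_deriveX n h.
by rewrite exprfctE.
Qed.

Lemma hdV f x a : f x != 0 -> has_derivative f x a ->
  has_derivative (fun y => (f y)^-1) x (- (f x) ^- 2 * a).
Proof.
move=> f0 [df <-]; apply: DeriveDef; first exact: derivableV.
exact: deriveV.
Qed.

Lemma hd_ext f x a b : a = b -> has_derivative f x a -> has_derivative f x b.
Proof. by move=> ->. Qed.

Lemma hd_near f g x a : (\forall y \near x, f y = g y) ->
  has_derivative f x a -> has_derivative g x a.
Proof. by move=> fg; apply: near_eq_is_derive. Qed.

Lemma hd_unique f x a b : has_derivative f x a -> has_derivative f x b -> a = b.
Proof. by move=> [_ <-] [_ <-]. Qed.

Lemma hd_comp f g x a b : has_derivative f x a -> has_derivative g (f x) b ->
  has_derivative (fun y => g (f y)) x (b * a).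
Proof.
move=> [df va] [dg vb].
have df' := (derivable1_diffP _ _).1 df.
have dg' := (derivable1_diffP _ _).1 dg.
have dgf : differentiable (g \o f : K^o -> K^o) x by exact: differentiable_comp.
apply: DeriveDef; first exact/derivable1_diffP.
rewrite -[LHS]derive1E derive1E' // diff_comp //.
have /(congr1 (@^~ 1)) /= Ef := diff1E df'.
have /(congr1 (@^~ ('d (f : K^o -> K^o) x 1))) /= Eg := diff1E dg'.
transitivity ('d (g : K^o -> K^o) (f x) ('d (f : K^o -> K^o) x 1)) => //.
by rewrite Eg Ef !derive1E va vb /GRing.scale /= mul1r mulrC.
Qed.

Lemma hd_continuous f x a : has_derivative f x a -> {for x, continuous f}.
Proof. by case=> /derivable1_diffP /differentiable_continuous. Qed.

Lemma hd_derive1 f x a : has_derivative f x a -> derive1 (f : K^o -> K^o) x = a.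
Proof. by move=> [_ <-]; rewrite derive1E. Qed.

Lemma derivable_hd f x : derivable (f : K^o -> K^o) x 1 ->
  has_derivative f x (derive1 (f : K^o -> K^o) x).
Proof. by move=> /derivableP h; rewrite derive1E. Qed.

Lemma growth_rateE f x : (fun h => (f (x + h) - f x) / h) =
  (fun h => h^-1 *: (((f : K^o -> K^o) \o shift x) (h *: (1 : K^o)) - f x)).
Proof.
apply/funext => k /=.
by rewrite /GRing.scale /= mulr1 [x + k]addrC mulrC.
Qed.

Lemma hd_quotient f x a :
  (fun h => (f (x + h) - f x) / h) @ 0^' --> a -> has_derivative f x a.
Proof.
rewrite growth_rateE => h; apply: DeriveDef; first by apply/cvg_ex; exists a.
by apply: cvg_lim h.
Qed.

Lemma hd_quotientP f x a : has_derivative f x a ->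
  (fun h => (f (x + h) - f x) / h) @ 0^' --> a.
Proof. by move=> [df <-]; rewrite growth_rateE; exact: df. Qed.

End Derivation.

(** * Connectedness, and functions of zero derivative in the complex plane *)

Section ComplexPlane.
Variable R : realType.
Local Notation C := R[i].
Implicit Types (x y z c : C) (f g : C -> C).

(** Connectedness as a continuation principle: local constancy makes the set where [P] holds both
    relatively open and relatively closed. It serves for segments in the plane and for the parameter
    of a loop. *)
Lemma locally_constant_unit_interval (P : R -> Prop) :
  (forall t : R, t \in `[0, 1] ->
     \forall s \near t, s \in `[0, 1] -> (P s <-> P t)) ->
  P 0 -> P 1.
Proof.
move=> locP P0.
have in0 : (0 : R) \in `[0, 1] by rewrite in_itv /= lexx ler01.
have in1 : (1 : R) \in `[0, 1] by rewrite in_itv /= lexx ler01.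
have conn : connected [set` `[(0 : R), 1]].
  by apply/connected_intervalP; exact: interval_is_interval.
suff : [set` `[(0 : R), 1]] `&` P = [set` `[(0 : R), 1]].
  by move=> /seteqP[_ /(_ 1 in1)] [].
apply: conn.
- by exists 0.
(* Taking the interior of an implication allows the neighbourhoods in [R] to leave the interval. *)
- exists ([set s | s \in `[0, 1] -> P s]^°); first exact: open_interior.
  apply/seteqP; split=> t [t01 Pt]; split=> //.
    apply: filterS (locP t t01) => s sP s01.
    by apply/(sP s01).
  exact: (interior_subset Pt).
- exists (~` ([set s | s \in `[0, 1] -> ~ P s]^°)).
    by apply: open_closedC; exact: open_interior.
  apply/seteqP; split=> t [t01 Pt]; split=> //.
    by move=> /interior_subset /(_ t01).
  apply: contrapT => nPt; apply: Pt.
  apply: filterS (locP t t01) => s sP s01 Ps.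
  by apply: nPt; apply/(sP s01).
Qed.

Lemma norm_realC (k : R) : `|k%:C| = `|k|%:C.
Proof. by rewrite normc_def /= expr0n addr0 sqrtr_sqr. Qed.

Lemma continuous_realC : continuous (fun k : R => k%:C).
Proof.
move=> k; apply/cvgrPdist_lt => e e0.
have eR : e = (complex.Re e)%:C by rewrite RRe_real // gtr0_real.
have e0' : 0 < complex.Re e by rewrite -ltcR -eR.
near=> t; rewrite -rmorphB norm_realC eR ltcR.
by near: t; apply: cvgr_dist_lt.
Unshelve. all: by end_near. Qed.

(** Radii of balls in [R[i]] are elements of [R[i]]; a positive one is real, so it can be traded for
    an element of [R]. *)
Lemma nbhs_complexP (z : C) (P : set C) :
  nbhs z P <-> exists2 e : R, 0 < e & forall w, `|w - z| < e%:C -> P w.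
Proof.
split=> [/nbhs_ballP[e e0 zP]|[e e0 zP]].
  have eR : e = (complex.Re e)%:C by rewrite RRe_real // gtr0_real.
  exists (complex.Re e); first by rewrite -ltcR -eR.
  by move=> w wz; apply: zP; rewrite /ball /= distrC eR.
apply/nbhs_ballP; exists e%:C; first by rewrite /= ltcR.
by move=> w; rewrite /ball /= distrC => /zP.
Qed.

Lemma continuous_Re : continuous (fun z : C => complex.Re z).
Proof.
move=> z A /nbhs_ballP[e e0 zA]; apply/nbhs_complexP; exists e => // w wz.
apply: zA; rewrite /ball /= distrC -ltcR -raddfB.
exact: le_lt_trans (normc_ge_Re _) wz.
Qed.

Lemma continuous_Im : continuous (fun z : C => complex.Im z).
Proof.
move=> z A /nbhs_ballP[e e0 zA]; apply/nbhs_complexP; exists e => // w wz.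
apply: zA; rewrite /ball /= distrC -ltcR -raddfB -normrN -ReiNIm.
apply: le_lt_trans (normc_ge_Re _) _; apply: le_lt_trans wz.
by rewrite normrM complexiE normCi mulr1.
Qed.

Lemma continuousC (T : topologicalType) (u v : T -> R) (t : T) :
  {for t, continuous u} -> {for t, continuous v} ->
  {for t, continuous (fun s => u s +i* v s)}.
Proof.
move=> cu cv.
have -> : (fun s => u s +i* v s) = (fun s => (u s)%:C + 'i * (v s)%:C).
  by apply/funext => s; rewrite [LHS]complexE.
apply: cvgD; first exact: (cvg_comp _ _ cu (@continuous_realC _)).
apply: cvgM; first exact: cvg_cst.
exact: (cvg_comp _ _ cv (@continuous_realC _)).
Qed.

Section ZeroDerivative.
Variables (f : C -> C) (x : C) (e : R).
Hypothesis f'0 : forall y, `|y - x| < e%:C -> has_derivative f y 0.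

Let path (y : C) (t : R) : C := f (x + t%:C * (y - x)).

Lemma path_norm y t : `|y - x| < e%:C -> 0 <= t <= 1 ->
  `|x + t%:C * (y - x) - x| < e%:C.
Proof.
move=> yx /andP[t0 t1].
rewrite addrC addKr normrM norm_realC (ger0_norm t0).
apply: le_lt_trans yx; apply: ler_piMl => //.
by rewrite -(rmorph1 (real_complex R)) lecR.
Qed.

Lemma path_derivative y (t : R) : `|y - x| < e%:C -> 0 <= t <= 1 ->
  (fun h : R => (path y (t + h) - path y t) / h%:C) @ 0^' --> (0 : C).
Proof.
move=> yx t01.
have dl : has_derivative (fun z => x + z * (y - x)) t%:C (y - x).
  have := hdD (hdcst (t%:C) x) (hdM (hdid t%:C) (hdcst t%:C (y - x))).
  by rewrite mulr0 add0r mulr1 add0r.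
have := hd_quotientP (hd_comp dl (f'0 (path_norm yx t01))).
rewrite mul0r => h.
have real0 : (fun h : R => h%:C) @ 0^' --> (0 : C)^'.
  move=> A /nbhs_complexP[d d0 zA].
  apply/nbhs_ballP; exists d => // k; rewrite /ball /= sub0r normrN => kd k0.
  apply: zA; first by rewrite subr0 norm_realC ltcR.
  by apply: contra_neq k0 => /complexI.
have := cvg_comp _ _ real0 h.
apply: cvg_trans; apply: near_eq_cvg; near=> k.
by rewrite /= /path rmorphD.
Unshelve. all: by end_near. Qed.

(** The mean value theorem needs a real-valued function, so it is applied along the segment from [x]
    to [y] to one part of [f] at a time; [p] is the real or the imaginary part. *)
Lemma part_constant (p : C -> R) y :
  continuous p -> (forall z (r : R), p (z / r%:C) = p z / r) ->
  (forall z w, p (z - w) = p z - p w) ->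
  `|y - x| < e%:C -> p (f y) = p (f x).
Proof.
move=> cp pZ pB yx.
have p0 : p 0 = 0 by have := pB 0 0; rewrite !subrr.
have D (t : R) : 0 <= t <= 1 -> has_derivative (fun s => p (path y s)) t 0.
  move=> t01; apply: hd_quotient.
  have := cvg_comp _ _ (path_derivative yx t01) (cp 0).
  rewrite p0; apply: cvg_trans; apply: near_eq_cvg; near=> k.
  by rewrite /= pZ pB.
have in01 (t : R) : t \in `[0, 1] -> 0 <= t <= 1 by rewrite in_itv.
have [] := @MVT_segment R (fun s => p (path y s)) (fun=> 0) 0 1 ler01.
- by move=> t tab; apply: D; rewrite !ltW ?(itvP tab).
- apply: derivable_within_continuous => t /in01 t01.
  by have [] := D t t01.
move=> c _; rewrite mul0r /path !rmorph0 mul0r addr0 rmorph1 mul1r.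
by move=> /eqP; rewrite subr_eq0 [x + _]addrC subrK => /eqP.
Unshelve. all: by end_near. Qed.

Lemma zero_derivative_constant y : (`|y - x| < e%:C) -> f y = f x.
Proof.
move=> yx; rewrite (complexE (f y)) (complexE (f x)).
rewrite (part_constant continuous_Re) //; last first.
- by move=> *; rewrite raddfB.
- move=> [a b] r.
  have -> : (r%:C)^-1 = (r^-1)%:C by rewrite fmorphV.
  by rewrite /= !mulr0 subr0.
rewrite (part_constant continuous_Im) //.
- move=> [a b] r.
  have -> : (r%:C)^-1 = (r^-1)%:C by rewrite fmorphV.
  by rewrite /= !mulr0 add0r.
- by move=> *; rewrite raddfB.
Qed.

End ZeroDerivative.

Lemma zero_derivative_near f x : (\forall y \near x, has_derivative f y 0) ->
  \forall y \near x, f y = f x.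
Proof.
move=> /nbhs_complexP[e e0 f'0]; apply/nbhs_complexP; exists e => // y yx.
exact: zero_derivative_constant f'0 _ yx.
Qed.

End ComplexPlane.

(** * Local solutions *)

Section SealedDerivative.
Variable R : realType.
Local Notation C := R[i].
Implicit Types (x a : C) (u : C -> C).

(* [derive1] behind an opaque constant: [ring] and [field] compare atoms up to
   conversion and would otherwise unfold the limits. *)
Fact sealed_derive1 : {D : (C -> C) -> C -> C | D = fun u => derive1 u}.
Proof. by exists (fun u => derive1 u). Qed.

Definition deriv u : C -> C := sval sealed_derive1 u.

Lemma derivE u : deriv u = derive1 u.
Proof. by rewrite /deriv; case: sealed_derive1 => D /= ->. Qed.

Lemma derivable_deriv u x : derivable u x 1 -> has_derivative u x (deriv u x).
Proof. by rewrite derivE; exact: derivable_hd. Qed.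

Lemma hd_deriv u x a : has_derivative u x a -> deriv u x = a.
Proof. by rewrite derivE; exact: hd_derive1. Qed.

Lemma hd_derivable u x a : has_derivative u x a -> derivable u x 1.
Proof. by case. Qed.

End SealedDerivative.

Section LameSolutions.
Variables (R : realType) (l B : R[i]) (e : 'I_3 -> R[i]).
Local Notation C := R[i].
Implicit Types (x y : C) (u v z : C -> C).

Definition lame_p x : C := 2^-1 * (\sum_i (x - e i)^-1).
Definition lame_q x : C := (l * (l + 1) * x + B) / (4 * \prod_i (x - e i)).

(** The equation is solved for the second derivative, so that [u] and [deriv u] form a first-order
    system. *)
Definition solves u x :=
  has_derivative u x (deriv u x) /\
  has_derivative (deriv u) x (lame_q x * u x - lame_p x * deriv u x).

Lemma local_solutionP x u :
  local_solution l B e x u <-> \forall y \near x, solves u y.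
Proof.
split; apply: filterS => y.
  rewrite /lame_op -!derivE -/(lame_p y) -/(lame_q y) => -[du ddu eq0].
  split; first exact: derivable_deriv.
  apply: hd_ext (derivable_deriv ddu).
  by move: eq0 => /eqP; rewrite subr_eq0 => /eqP <-; rewrite addrK.
move=> [du ddu]; rewrite /lame_op -!derivE -/(lame_p y) -/(lame_q y).
split; [exact: hd_derivable du|exact: hd_derivable ddu|].
by rewrite (hd_deriv ddu) subrK subrr.
Qed.

(** Formulas for the derivatives must hold on a neighbourhood: only then may [d] replace [deriv u]
    under a second differentiation. *)
Lemma local_solution_intro x u (d dd : C -> C) :
  (\forall y \near x, has_derivative u y (d y)) ->
  (\forall y \near x, has_derivative d y (dd y)) ->
  (\forall y \near x, dd y + lame_p y * d y = lame_q y * u y) ->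
  local_solution l B e x u.
Proof.
move=> hu hd heq; apply/local_solutionP.
have hu' : \forall y \near x, deriv u y = d y.
  by apply: filterS hu => y /hd_deriv.
near=> y.
have uy : has_derivative u y (d y) by near: y.
have dy : has_derivative d y (dd y) by near: y.
have eqy : dd y + lame_p y * d y = lame_q y * u y by near: y.
have u'y : \forall w \near y, deriv u w = d w by near: y; exact: nbhs_interior.
have u'y' : deriv u y = d y := nbhs_singleton u'y.
split; first by rewrite u'y'.
apply: (@hd_near _ d); first by apply: filterS u'y => w ->.
by rewrite u'y' -eqy addrK.
Unshelve. all: by end_near. Qed.

Lemma local_solution_near x u : local_solution l B e x u ->
  \forall y \near x, local_solution l B e y u.
Proof. exact: nbhs_interior. Qed.

Lemma local_solution_lin x (a b : C) u v :
  local_solution l B e x u -> local_solution l B e x v ->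
  local_solution l B e x (fun y => a * u y + b * v y).
Proof.
move=> /local_solutionP su /local_solutionP sv.
have suv : \forall y \near x, solves u y /\ solves v y.
  by apply: filterS2 su sv.
apply: (@local_solution_intro _ _ (fun y => a * deriv u y + b * deriv v y)
  (fun y => a * (lame_q y * u y - lame_p y * deriv u y) +
            b * (lame_q y * v y - lame_p y * deriv v y))).
- apply: filterS suv => y [[du _] [dv _]].
  have H1 := hdM (hdcst y a) du.
  have H2 := hdM (hdcst y b) dv.
  have H := hdD H1 H2.
  apply: hd_ext H.
  ring.
- apply: filterS suv => y [[_ du] [_ dv]].
  have H1 := hdM (hdcst y a) du.
  have H2 := hdM (hdcst y b) dv.
  have H := hdD H1 H2.
  apply: hd_ext H.
  ring.
- by near=> y; ring.
Unshelve. all: by end_near. Qed.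

Definition wronskian u v x : C := u x * deriv v x - v x * deriv u x.

(** Abel's identity. *)
Lemma hd_wronskian u v x : solves u x -> solves v x ->
  has_derivative (wronskian u v) x (- lame_p x * wronskian u v x).
Proof.
move=> [du ddu] [dv ddv].
apply: hd_ext (hdD (hdM du ddv) (hdN (hdM dv ddu))).
rewrite /wronskian; ring.
Qed.

(** By Abel's identity the quotients of W(z,u) and W(z,v) by W(u,v) have zero derivative, and they
    vanish at [x]. Hence W(z,u) and W(z,v) vanish near [x], and z W(u,v) = u W(z,v) - v W(z,u). *)
Lemma solution_unique x u v z : local_solution l B e x u ->
  local_solution l B e x v -> wronskian u v x != 0 ->
  local_solution l B e x z -> z x = 0 -> deriv z x = 0 ->
  \forall y \near x, z y = 0.
Proof.
move=> /local_solutionP su /local_solutionP sv w0 /local_solutionP sz zx z'x.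
have cw : {for x, continuous (wronskian u v)}.
  apply: hd_continuous (hd_wronskian (nbhs_singleton su) (nbhs_singleton sv)).
have wn : \forall y \near x, wronskian u v y != 0 by exact: cvgr_neq0 cw w0.
have ratio0 f : (\forall y \near x, solves f y) ->
    \forall y \near x, wronskian z f y = 0.
  move=> sf.
  have : \forall y \near x, has_derivative (fun y => wronskian z f y / wronskian u v y) y 0.
    near=> y.
    have wy : wronskian u v y != 0 by near: y.
    have dzf : has_derivative (wronskian z f) y (- lame_p y * wronskian z f y).
      by apply: hd_wronskian; near: y.
    have duv : has_derivative (wronskian u v) y (- lame_p y * wronskian u v y).
      by apply: hd_wronskian; near: y.
    apply: hd_ext (hdM dzf (hdV wy duv)).
    by field.
  have zf0 : wronskian z f x = 0 by rewrite /wronskian zx z'x mul0r mulr0 subrr.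
  move=> /zero_derivative_near; apply: filterS2 wn => y wy.
  rewrite zf0 mul0r => /eqP.
  by rewrite mulf_eq0 invr_eq0 (negPf wy) orbF => /eqP.
near=> y.
have wy : wronskian u v y != 0 by near: y.
have zu : wronskian z u y = 0 by near: y; exact: ratio0.
have zv : wronskian z v y = 0 by near: y; exact: ratio0.
apply/eqP; rewrite -(mulrI_eq0 _ (mulfI wy)); apply/eqP.
transitivity (u y * wronskian z v y - v y * wronskian z u y).
  by rewrite /wronskian; ring.
by rewrite zu zv !mulr0 subrr.
Unshelve. all: by end_near. Qed.

End LameSolutions.

(** * Branches of algebraic functions *)

Section PointwiseContinuity.
Variables (K : numFieldType) (T : topologicalType) (x : T).
Implicit Types (f g : T -> K).

Lemma cntc (a : K) : {for x, continuous (fun=> a)}.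
Proof. exact: cst_continuous. Qed.

Lemma cntD f g : {for x, continuous f} -> {for x, continuous g} ->
  {for x, continuous (fun y => f y + g y)}.
Proof. by move=> ? ?; apply: (@continuousD K K^o). Qed.

Lemma cntN f : {for x, continuous f} -> {for x, continuous (fun y => - f y)}.
Proof. by move=> ?; apply: (@continuousN K K^o). Qed.

Lemma cntM f g : {for x, continuous f} -> {for x, continuous g} ->
  {for x, continuous (fun y => f y * g y)}.
Proof. by move=> ? ?; apply: continuousM. Qed.

Lemma cntV f : f x != 0 -> {for x, continuous f} ->
  {for x, continuous (fun y => (f y)^-1)}.
Proof. by move=> ? ?; apply: continuousV. Qed.

Lemma cntX f n : {for x, continuous f} -> {for x, continuous (fun y => f y ^+ n)}.
Proof.
move=> cf; elim: n => [|n IHn]; first exact: cntc.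
by rewrite (_ : (fun y => _) = fun y => f y * f y ^+ n);
  [exact: cntM|apply/funext => y; rewrite exprS].
Qed.

End PointwiseContinuity.

Section RationalInverse.
Variable K : numClosedFieldType.
Implicit Types (A B : {poly K}) (w z : K).

Lemma near_dist_lt (x e : K) : 0 < e -> \forall y \near x, `|x - y| < e.
Proof. by move=> e0; apply/nbhs_ballP; exists e. Qed.

Lemma continuous_horner_num A : continuous (fun w : K => A.[w] : K).
Proof.
elim/poly_ind: A => [|A c IH] w.
  rewrite (_ : (fun w : K => _) = fun=> 0); first exact: cntc.
  by apply/funext => z; rewrite horner0.
rewrite (_ : (fun w : K => _) = fun z => A.[z] * z + c).
  apply: (@cntD K K w (fun z : K => A.[z] * z) (fun=> c)); last exact: cntc.
  by apply: (@cntM K K w (fun z : K => A.[z]) (fun z => z)); [exact: IH|exact: cvg_id].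
by apply/funext => z; rewrite hornerMXaddC.
Qed.

(** The difference quotient of a polynomial extends continuously across the diagonal, with the
    derivative as its value there. *)
Lemma divided_difference A : exists D : K -> K -> K,
  [/\ forall w z, A.[w] - A.[z] = (w - z) * D w z,
      forall w, D w w = A^`().[w] &
      continuous (fun p : K * K => D p.1 p.2)].
Proof.
elim/poly_ind: A => [|A c [D [DE Dd Dc]]].
  exists (fun _ _ => 0); split=> [w z|w|p]; first by rewrite !horner0 subrr mulr0.
    by rewrite deriv0 horner0.
  exact: cntc.
exists (fun w z => D w z * w + A.[z]); split=> [w z|w|p].
- by rewrite !hornerMXaddC mulrDr mulrA -DE; ring.
- by rewrite derivMXaddC hornerD hornerMX Dd addrC.
- apply: (@cntD K (K * K)%type p (fun p => D p.1 p.2 * p.1) (fun p => A.[p.2])).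
    by apply: (@cntM K (K * K)%type p (fun p => D p.1 p.2)); [exact: Dc|exact: cvg_fst].
  apply: (@continuous_comp _ _ _ (fun p : K * K => p.2) (fun w : K => A.[w] : K)).
    exact: cvg_snd.
  exact: continuous_horner_num.
Qed.

Variables (A B : {poly K}) (w0 : K).
Hypotheses (monicA : A \is monic) (sBA : (size B < size A)%N).
Hypothesis B0 : B.[w0] != 0.
Hypothesis crit : B.[w0] * A^`().[w0] - A.[w0] * B^`().[w0] != 0.
Let phi0 := A.[w0] / B.[w0].

Lemma monic_pencil phi : A - phi *: B \is monic.
Proof.
have sB : (size (- (phi *: B)) < size A)%N.
  by rewrite size_polyN; apply: leq_ltn_trans (size_scale_leq _ _) sBA.
by rewrite monicE lead_coefDl // -monicE.
Qed.

Lemma size_pencil phi : size (A - phi *: B) = size A.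
Proof.
by rewrite size_polyDl // size_polyN; apply: leq_ltn_trans (size_scale_leq _ _) sBA.
Qed.

(* The product of the distances from [w0] to the roots of [A - phi B] is
   |phi - phi0| |B.[w0]|, so some root is close to [w0]. *)
Lemma pencil_root_near (eps : K) : 0 < eps ->
  \forall phi \near phi0, exists2 w, `|w - w0| < eps & A.[w] = phi * B.[w].
Proof.
move=> eps0; set n := (size A).-1.
have nB : 0 < `|B.[w0]| by rewrite normr_gt0.
have eta0 : 0 < eps ^+ n / `|B.[w0]| by rewrite divr_gt0 // exprn_gt0.
near=> phi.
have phi_lt : `|phi0 - phi| * `|B.[w0]| < eps ^+ n.
  by rewrite -ltr_pdivlMr //; near: phi; exact: near_dist_lt.
have [rs rsE] := closed_field_poly_normal (A - phi *: B).
rewrite (eqP (monic_pencil phi)) scale1r in rsE.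
have szrs : size rs = n.
  by have := size_prod_XsubC rs id; rewrite -rsE size_pencil /n => ->.
have valE : `|\prod_(r <- rs) (w0 - r)| = `|phi0 - phi| * `|B.[w0]|.
  have -> : \prod_(r <- rs) (w0 - r) = (A - phi *: B).[w0].
    by rewrite rsE horner_prod; apply: eq_bigr => r _; rewrite hornerXsubC.
  by rewrite hornerD hornerN hornerZ -normrM mulrBl divfK.
apply: contrapT => noroot.
have far r : r \in rs -> eps <= `|w0 - r|.
  move=> rrs; have /real_leVge : eps \is Num.real by rewrite gtr0_real.
  move=> /(_ `|w0 - r| (normr_real _)) /orP[//|le_eps].
  have [eqe|neqe] := eqVneq `|w0 - r| eps; first by rewrite eqe.
  exfalso; apply: noroot; exists r; first by rewrite distrC lt_neqAle neqe.
  have /rootP : root (A - phi *: B) r by rewrite rsE root_prod_XsubC.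
  by rewrite hornerD hornerN hornerZ => /eqP; rewrite subr_eq0 => /eqP.
have : eps ^+ n <= `|\prod_(r <- rs) (w0 - r)|.
  rewrite -szrs; elim: (rs) far => [|r s IHs] fars.
    by rewrite big_nil normr1 expr0.
  rewrite big_cons normrM exprS; apply: ler_pM.
  - exact: ltW.
  - by rewrite exprn_ge0 // ltW.
  - by apply: fars; rewrite mem_head.
  - by apply: IHs => t ts; apply: fars; rewrite in_cons ts orbT.
by rewrite valE => /(lt_le_trans phi_lt); rewrite ltxx.
Unshelve. all: by end_near. Qed.

(** A holomorphic inverse of A/B near [w0], which [crit] makes a noncritical point. The divided
    difference [G] of A - phi B is bounded away from 0 near the base point. The identity [keyE] then
    yields uniqueness in a fibre, a Lipschitz bound for [W], and the limit of its difference
    quotient. *)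
Lemma rational_inverse : exists2 W : K -> K, W phi0 = w0 &
  (\forall phi \near phi0,
     A.[W phi] = phi * B.[W phi] /\ exists a, has_derivative W phi a) /\
  (\forall p \near (phi0, w0), A.[p.2] = p.1 * B.[p.2] -> p.2 = W p.1).
Proof.
have [DA [DAE DAd DAc]] := divided_difference A.
have [DB [DBE DBd DBc]] := divided_difference B.
pose G (p : K * (K * K)) := DA p.2.1 p.2.2 - p.1 * DB p.2.1 p.2.2.
have Gc : continuous G.
  move=> p; apply: (@cntD K (K * (K * K))%type p (fun p => DA p.2.1 p.2.2)).
    by apply: (continuous_comp (g := fun p : K * K => DA p.1 p.2)); [exact: cvg_snd|exact: DAc].
  apply: (@cntN K (K * (K * K))%type); apply: (@cntM K (K * (K * K))%type p (fun p => p.1)); first exact: cvg_fst.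
  by apply: (continuous_comp (g := fun p : K * K => DB p.1 p.2)); [exact: cvg_snd|exact: DBc].
have G0 : G (phi0, (w0, w0)) != 0.
  rewrite /G /= DAd DBd; apply: contra_neq crit => h.
  transitivity (B.[w0] * (A^`().[w0] - phi0 * B^`().[w0])); last by rewrite h mulr0.
  by rewrite /phi0; field.
pose m := `|G (phi0, (w0, w0))| / 2.
have m0 : 0 < m by rewrite divr_gt0 // normr_gt0.
have : \forall p \near (phi0, (w0, w0)), m < `|G p|.
  near=> p; have Gp : `|G (phi0, (w0, w0)) - G p| < m.
    by near: p; apply: cvgr_dist_lt m0; exact: Gc.
  have := ler_normD (G (phi0, (w0, w0)) - G p) (G p); rewrite subrK => h.
  have : m + m < m + `|G p|.
    apply: le_lt_trans (_ : _ <= `|G (phi0, (w0, w0)) - G p| + `|G p|) _.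
      by rewrite -splitr.
    by rewrite ltrD2r.
  by rewrite ltrD2l.
move=> /nbhs_ballP[eps /= eps0 Gm].
have {}Gm phi w z : `|phi - phi0| < eps -> `|w - w0| < eps -> `|z - w0| < eps ->
    m < `|G (phi, (w, z))|.
  by move=> *; apply: Gm; split; [|split]; rewrite /ball /= distrC.
have keyE phi phi1 w w1 : A.[w] = phi * B.[w] -> A.[w1] = phi1 * B.[w1] ->
    (w - w1) * G (phi, (w, w1)) = (phi - phi1) * B.[w1].
  move=> h h1; rewrite /G /= mulrBr -DAE mulrCA -DBE h h1; ring.
have uniq phi w z : `|phi - phi0| < eps -> `|w - w0| < eps -> `|z - w0| < eps ->
    A.[w] = phi * B.[w] -> A.[z] = phi * B.[z] -> w = z.
  move=> hphi hw hz Aw Az; have := keyE _ _ _ _ Aw Az.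
  rewrite subrr mul0r => /eqP; rewrite mulf_eq0 subr_eq0 => /orP[/eqP//|/eqP G00].
  by have := Gm _ _ _ hphi hw hz; rewrite G00 normr0 => /(lt_trans m0); rewrite ltxx.
pose P phi := [set w | `|w - w0| < eps /\ A.[w] = phi * B.[w]].
(* By [uniq] the choice is forced wherever [P phi] is inhabited, which holds near [phi0]; elsewhere
   [w0] is a default. *)
pose W phi := xget w0 (P phi).
have WP : \forall phi \near phi0, P phi (W phi).
  apply: filterS (pencil_root_near eps0) => phi [w w1 w2].
  by apply: xgetI; split; [exact: w1|exact: w2].
have eps_near : \forall phi \near phi0, `|phi - phi0| < eps.
  near=> phi; rewrite distrC; near: phi; exact: near_dist_lt.
exists W.
  have [W1 W2] := nbhs_singleton WP.
  apply: (uniq phi0) => //; rewrite ?subrr ?normr0 //.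
  by rewrite /phi0 divfK.
split.
  have good := filterI WP eps_near.
  near=> phi1.
  have g1 : \forall phi \near phi1, P phi (W phi) /\ `|phi - phi0| < eps.
    by near: phi1; apply: nbhs_interior; exact: good.
  have [[W1 A1] p1] := nbhs_singleton g1.
  split=> //; set w1 := W phi1 in W1 A1 *.
  have Wc : W @ nbhs (phi1 : K) --> (w1 : K).
    apply/(@cvgrPdist_le K K^o K (nbhs (phi1 : K)) _ W w1) => d d0.
    near=> phi.
    have [[W2 A2] p2] : P phi (W phi) /\ `|phi - phi0| < eps by near: phi.
    have mG := Gm _ _ _ p2 W2 W1.
    rewrite distrC -(ler_pM2r (lt_trans m0 mG)) -normrM (keyE _ _ _ _ A2 A1).
    apply: (@le_trans _ _ (d * m)); last by rewrite ler_pM2l // ltW.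
    rewrite normrM.
    (* The summand 1 keeps the divisor positive even if [B] vanishes at [w1]. *)
    have b0 : 0 < `|B.[w1]| + 1 by rewrite ltr_wpDl.
    apply: (@le_trans _ _ (`|phi - phi1| * (`|B.[w1]| + 1))).
      by rewrite ler_wpM2l // lerDl.
    rewrite -ler_pdivlMr // distrC ltW //.
    near: phi; apply: near_dist_lt.
    by rewrite divr_gt0 // mulr_gt0.
  exists (B.[w1] / G (phi1, (w1, w1))); apply: hd_quotient.
  have shiftc : (fun h : K => phi1 + h) @ (0 : K)^' --> (phi1 : K).
    have : {for (0 : K), continuous (fun h : K => phi1 + h)}.
      by apply: (@cntD K K 0 (fun=> phi1)); [exact: cntc|exact: cvg_id].
    rewrite /prop_for /continuous_at addr0; apply: cvg_trans.
    by apply: cvg_app; exact: nbhs_dnbhs.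
  have G1 : G (phi1, (w1, w1)) != 0.
    by rewrite -normr_gt0; apply: lt_trans m0 (Gm _ _ _ p1 W1 W1).
  pose F phi := (phi, (W phi, w1)) : K * (K * K).
  have Fc : {for phi1, continuous F}.
    have idc : (fun x : K => x) @ nbhs (phi1 : K) --> (phi1 : K) by exact: cvg_id.
    have cc : (fun=> w1) @ nbhs (phi1 : K) --> (w1 : K) by exact: cvg_cst.
    exact: cvg_pair idc (cvg_pair Wc cc).
  have GFc : {for phi1, continuous (fun phi => B.[w1] / G (F phi))}.
    apply: (@cntM K K phi1 (fun=> B.[w1])); first exact: cntc.
    apply: (@cntV K K phi1 (fun phi => G (F phi))) => //.
    by apply: (@continuous_comp _ _ _ F G) => //; exact: Gc.
  have := cvg_comp _ _ shiftc GFc.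
  apply: cvg_trans; apply: near_eq_cvg; near=> h.
  have h0 : h != 0 by near: h; exact: nbhs_dnbhs_neq.
  have [[W2 A2] p2] : P (phi1 + h) (W (phi1 + h)) /\ `|phi1 + h - phi0| < eps.
    by near: h; exact: shiftc g1.
  have G2 : G (phi1 + h, (W (phi1 + h), w1)) != 0.
    by rewrite -normr_gt0; apply: lt_trans m0 (Gm _ _ _ p2 W2 W1).
  apply/eqP; rewrite eqr_div // (keyE _ _ _ _ A2 A1) addrAC subrr add0r.
  by rewrite mulrC.
have eps_w : \forall w \near w0, `|w - w0| < eps.
  by near=> w; rewrite distrC; near: w; exact: near_dist_lt.
exists ([set phi | P phi (W phi) /\ `|phi - phi0| < eps], [set w | `|w - w0| < eps]).
  by split; [exact: filterI WP eps_near|exact: eps_w].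
by move=> [phi w] [/= [[W1 A1] p1] w1] Ap; apply: (uniq phi).
Unshelve. all: by end_near. Qed.

End RationalInverse.

(** * Persistence of relations under continuation *)

Section Persistence.
Variables (R : realType) (l B : R[i]) (e : 'I_3 -> R[i]).
Local Notation C := R[i].
Implicit Types (x y c : C) (u v F G : C -> C).

Lemma ordinary_near x : ordinary_point e x -> \forall y \near x, ordinary_point e y.
Proof.
move=> ox.
suff : \forall y \near x, forall i, y <> e i by [].
apply: (@filter_forall _ _ (fun i y => y <> e i) (nbhs x)) => i.
have dx : 0 < `|x - e i| by rewrite normr_gt0 subr_eq0; apply/eqP/ox.
near=> y; have xy : `|x - y| < `|x - e i| by near: y; exact: near_dist_lt.
by move=> yE; move: xy; rewrite yE ltxx.
Unshelve. all: by end_near. Qed.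

Lemma near_notin (s : seq C) x : \forall y \near x, y \in s -> y = x.
Proof.
elim: s => [|a s IHs]; first by near=> y.
have [eax|nax] := eqVneq a x.
  near=> y; have h : y \in s -> y = x by near: y.
  by rewrite in_cons eax => /orP[/eqP|/h].
have dx : 0 < `|x - a| by rewrite normr_gt0 subr_eq0 eq_sym.
near=> y.
have h : y \in s -> y = x by near: y.
have xy : `|x - y| < `|x - a| by near: y; exact: near_dist_lt.
by rewrite in_cons => /orP[/eqP ya|/h //]; move: xy; rewrite ya ltxx.
Unshelve. all: by end_near. Qed.

Lemma near_exists_neq (P : set C) (a c : C) : (\forall y \near a, P y) ->
  exists2 y, P y & y != c.
Proof.
move=> /[dup] Pa /nbhs_complexP[d d0 aP].
have [eac|nac] := eqVneq a c; last by exists a => //; exact: nbhs_singleton Pa.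
have d2 : 0 < d / 2 by rewrite divr_gt0.
exists (a + (d / 2)%:C).
  apply: aP; rewrite addrC addKr norm_realC ltcR gtr0_norm //.
  by rewrite ltr_pdivrMr // mulr_natr mulr2n ltrDl.
by rewrite -subr_eq0 eac addrC addKr (fmorph_eq0 (real_complex R)) gt_eqF.
Qed.

Variables (I : Type) (rho : I -> C -> C -> C -> C -> C -> C) (bad : seq C).

(** The relations involve first derivatives because a solution germ is determined by its value and
    its derivative at one point. *)
Definition holds_at u v x := forall i, rho i x (u x) (v x) (deriv u x) (deriv v x) = 0.

Hypothesis rho_continuous : forall i (f1 f2 f3 f4 : C -> C) x,
  {for x, continuous f1} -> {for x, continuous f2} ->
  {for x, continuous f3} -> {for x, continuous f4} ->
  {for x, continuous (fun y => rho i y (f1 y) (f2 y) (f3 y) (f4 y))}.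

(** Outside the finite list [bad], every jet satisfying the relations extends to solutions that
    satisfy them nearby. This replaces the identity theorem for analytic functions and makes the
    relations an open condition. *)
Hypothesis rho_branch : forall x a1 a2 d1 d2,
  ordinary_point e x -> x \notin bad -> (forall i, rho i x a1 a2 d1 d2 = 0) ->
  exists u v, [/\ local_solution l B e x u /\ local_solution l B e x v,
    u x = a1 /\ v x = a2, deriv u x = d1 /\ deriv v x = d2,
    wronskian u v x != 0 & \forall y \near x, holds_at u v y].

Lemma deriv_near u v x : (\forall y \near x, u y = v y) -> deriv u x = deriv v x.
Proof. by move=> uv; rewrite !derivE !derive1E; exact: near_eq_derive. Qed.

Lemma holds_at_near u1 v1 u2 v2 x : (\forall y \near x, u1 y = u2 y) ->
  (\forall y \near x, v1 y = v2 y) -> holds_at u1 v1 x -> holds_at u2 v2 x.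
Proof.
move=> hu hv h i; have := h i.
by rewrite (deriv_near hu) (deriv_near hv) (nbhs_singleton hu) (nbhs_singleton hv).
Qed.

Lemma near_holds_at u1 v1 u2 v2 x : (\forall y \near x, u1 y = u2 y) ->
  (\forall y \near x, v1 y = v2 y) -> (\forall y \near x, holds_at u1 v1 y) ->
  \forall y \near x, holds_at u2 v2 y.
Proof.
move=> /nbhs_interior hu /nbhs_interior hv h; near=> y.
apply: (@holds_at_near u1 v1); near: y => //.
Unshelve. all: by end_near. Qed.

Lemma solution_continuous u x : local_solution l B e x u ->
  {for x, continuous u} /\ {for x, continuous (deriv u)}.
Proof.
move=> /local_solutionP /nbhs_singleton[du ddu].
by split; [exact: hd_continuous du|exact: hd_continuous ddu].
Qed.

Lemma solution_eq u v F G x : local_solution l B e x u -> local_solution l B e x v ->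
  wronskian u v x != 0 -> local_solution l B e x F -> local_solution l B e x G ->
  F x = G x -> deriv F x = deriv G x -> \forall y \near x, F y = G y.
Proof.
move=> su sv w0 sF sG FG dFG.
have sD := local_solution_lin 1 (-1) sF sG.
have : \forall y \near x, 1 * F y + -1 * G y = 0.
  apply: solution_unique su sv w0 sD _ _; first by rewrite FG mul1r mulN1r subrr.
  have /local_solutionP /nbhs_singleton[dF _] := sF.
  have /local_solutionP /nbhs_singleton[dG _] := sG.
  rewrite (hd_deriv (hdD (hdM (hdcst x 1) dF) (hdM (hdcst x (-1)) dG))) dFG.
  by rewrite !mulr0 !addr0 mul1r mulN1r subrr.
by apply: filterS => y; rewrite mul1r mulN1r => /eqP; rewrite subr_eq0 => /eqP.
Qed.

(** The pair given by [rho_branch] has the same initial data as [u], [v], hence the same germs. *)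
Lemma holds_at_open u v x : local_solution l B e x u -> local_solution l B e x v ->
  ordinary_point e x -> x \notin bad -> holds_at u v x ->
  \forall y \near x, holds_at u v y.
Proof.
move=> su sv ox xb h.
have [u0 [v0 [[su0 sv0] [u0x v0x] [du0x dv0x] w0 h0]]] := rho_branch ox xb h.
apply: near_holds_at h0.
  exact: (solution_eq su0 sv0 w0 su0 su u0x du0x).
exact: (solution_eq su0 sv0 w0 sv0 sv v0x dv0x).
Qed.

Lemma holds_at_closed u v x : local_solution l B e x u -> local_solution l B e x v ->
  ~ holds_at u v x -> \forall y \near x, ~ holds_at u v y.
Proof.
move=> /solution_continuous[cu cdu] /solution_continuous[cv cdv].
move=> /existsNP[i /eqP nz].
have H := @rho_continuous i _ _ _ _ x cu cv cdu cdv.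
have : \forall y \near x, rho i y (u y) (v y) (deriv u y) (deriv v y) != 0.
  exact: cvgr_neq0 H nz.
by apply: filterS => y /eqP nzy /(_ i).
Qed.

Definition regular_at u v x :=
  [/\ local_solution l B e x u, local_solution l B e x v & ordinary_point e x].

Let line y1 y2 (t : R) : C := y1 + t%:C * (y2 - y1).

Lemma continuous_line y1 y2 : continuous (line y1 y2).
Proof.
move=> t; apply: (@cntD _ R t (fun=> y1)); first exact: cntc.
apply: (@cntM _ R t (fun t => t%:C)); [exact: continuous_realC|exact: cntc].
Qed.

Lemma holds_at_segment u v y1 y2 :
  (forall t : R, t \in `[0, 1] -> regular_at u v (line y1 y2 t) /\ line y1 y2 t \notin bad) ->
  holds_at u v y1 -> holds_at u v y2.
Proof.
move=> reg h1.
have -> : y2 = line y1 y2 1 by rewrite /line mul1r addrC subrK.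
apply: (@locally_constant_unit_interval R (fun t => holds_at u v (line y1 y2 t))).
  move=> t t01; have [[su sv ot] tb] := reg t t01.
  have [h|nh] := pselect (holds_at u v (line y1 y2 t)).
    have H : \forall s \near t, holds_at u v (line y1 y2 s).
      exact: continuous_line (holds_at_open su sv ot tb h).
    by near=> s => _; split=> // _; near: s.
  have H : \forall s \near t, ~ holds_at u v (line y1 y2 s).
    exact: continuous_line (holds_at_closed su sv nh).
  by near=> s => _; split=> // hs; suff : ~ holds_at u v (line y1 y2 s) by []; near: s.
by rewrite /line mul0r addr0.
Unshelve. all: by end_near. Qed.

(** Only the centre can be bad, and a disc minus its centre is connected by at most two segments.
    The centre itself is then reached by continuity of the relations. *)
Lemma holds_at_ball u v c (r : R) :
  (forall y, `|y - c| < r%:C -> regular_at u v y /\ (y \in bad -> y = c)) ->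
  forall y1 y2, `|y1 - c| < r%:C -> `|y2 - c| < r%:C -> y1 != c ->
    holds_at u v y1 -> holds_at u v y2.
Proof.
move=> reg y1 y2 y1r y2r y1c h1.
have conv z1 z2 (t : R) : `|z1 - c| < r%:C -> `|z2 - c| < r%:C -> t \in `[0, 1] ->
    `|line z1 z2 t - c| < r%:C.
  rewrite in_itv /= => z1r z2r /andP[t0 t1].
  have -> : line z1 z2 t - c = (1 - t)%:C * (z1 - c) + t%:C * (z2 - c).
    by rewrite rmorphB rmorph1 /line; ring.
  apply: le_lt_trans (ler_normD _ _) _; rewrite !normrM !norm_realC.
  rewrite (ger0_norm t0) (ger0_norm (_ : 0 <= 1 - t)) ?subr_ge0 //.
  have -> : r%:C = (1 - t)%:C * r%:C + t%:C * r%:C by rewrite rmorphB rmorph1; ring.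
  have [->|tn0] := eqVneq t 0.
    by rewrite subr0 rmorph1 rmorph0 !mul1r !mul0r !addr0.
  apply: ler_ltD.
    by apply: ler_wpM2l; [rewrite lecR subr_ge0|exact: ltW].
  by rewrite ltr_pM2l // ltcR lt_neqAle eq_sym tn0.
have seg z1 z2 : `|z1 - c| < r%:C -> `|z2 - c| < r%:C ->
    (forall t : R, t \in `[0, 1] -> line z1 z2 t != c) ->
    holds_at u v z1 -> holds_at u v z2.
  move=> z1r z2r ne; apply: holds_at_segment => t t01.
  have [regt badt] := reg _ (conv _ _ _ z1r z2r t01).
  split=> //; apply: contra (ne _ t01) => /badt ->; exact: eqxx.
have main z : `|z - c| < r%:C -> z != c -> holds_at u v z.
  move=> zr zc.
  have [[t t01 tc]|ne] := pselect (exists2 t : R, t \in `[0, 1] & line y1 z t = c); last first.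
    apply: (seg y1) => // t t01; apply/eqP => tc; apply: ne; by exists t.
  (* Here [z - c] is a negative multiple of [y1 - c], so the point obtained from [y1] by a quarter
     turn about [c] is joined to both [y1] and [z] by segments that avoid [c]. *)
  pose w := c + 'i%C * (y1 - c).
  have wr : `|w - c| < r%:C by rewrite /w addrC addKr normrM ?complexiE normCi mul1r.
  have d0 : y1 - c != 0 by rewrite subr_eq0.
  have im0 (a b : R) : (a +i* b) = 0 -> a = 0 /\ b = 0 by case.
  have hw : holds_at u v w.
    apply: (seg y1) => // s s01; rewrite -subr_eq0.
    have -> : line y1 w s - c = ((1 - s) +i* s) * (y1 - c).
      rewrite /line /w [(1 - s) +i* s]complexE /= rmorphB rmorph1; ring.
    rewrite mulf_neq0 //; apply/eqP => /im0[s1 s0].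
    by move: s1; rewrite s0 subr0 => /eqP; rewrite oner_eq0.
  have t0 : t != 0.
    by apply: contraNneq y1c => t0; move: tc; rewrite /line t0 mul0r addr0 => ->.
  have tC0 : t%:C != 0 by rewrite (fmorph_eq0 (real_complex R)).
  have zE : z - c = - ((1 - t) / t)%:C * (y1 - c).
    rewrite rmorphM rmorphB rmorph1 fmorphV -tc /line.
    by field.
  apply: (seg w) => // s s01; rewrite -subr_eq0.
  have -> : line w z s - c = ((- s * ((1 - t) / t)) +i* (1 - s)) * (y1 - c).
    have -> : line w z s - c = (1 - s)%:C * ('i%C * (y1 - c)) + s%:C * (z - c).
      by rewrite /line /w rmorphB rmorph1; ring.
    rewrite zE [_ +i* (1 - s)]complexE /= !rmorphM rmorphN; ring.
  rewrite mulf_neq0 //; apply/eqP => /im0[s1 s0].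
  have s1' : s = 1 by move/eqP: s0; rewrite subr_eq0 => /eqP.
  move: s1; rewrite s1' mulN1r => /eqP; rewrite oppr_eq0 mulf_eq0 invr_eq0 (negPf t0) orbF.
  rewrite subr_eq0 => /eqP t1; move: zc; rewrite -tc /line -t1 mul1r addrC subrK.
  by rewrite eqxx.
have [->|y2c] := eqVneq y2 c; last exact: main.
have [[su sv _] _] : regular_at u v c /\ (c \in bad -> c = c).
  by apply: reg; rewrite subrr normr0; apply: le_lt_trans y1r.
have cr : \forall y \near c, `|y - c| < r%:C.
  near=> y; rewrite distrC; near: y; apply: near_dist_lt.
  by apply: le_lt_trans y1r.
apply: contrapT => nh.
have [y [yr ny] yc] := near_exists_neq c (filterI cr (holds_at_closed su sv nh)).
by apply: ny; exact: main.
Unshelve. all: by end_near. Qed.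

Lemma regular_ball u v c : regular_at u v c -> exists2 r : R, 0 < r &
  forall y, `|y - c| < r%:C -> regular_at u v y /\ (y \in bad -> y = c).
Proof.
move=> [su sv oc].
have : \forall y \near c, regular_at u v y /\ (y \in bad -> y = c).
  near=> y; split; last by near: y; exact: near_notin.
  split; near: y; [exact: local_solution_near|exact: local_solution_near|].
  exact: ordinary_near.
by move=> /nbhs_complexP.
Unshelve. all: by end_near. Qed.

(** Validity near [g t] is locally constant in [t]: for [s] close to [t] the germs at [g s] are
    those of [F1 t], [F2 t], and [holds_at_ball] carries the relations between [g t] and [g s] in
    either direction, even if [g t] is bad. *)
Lemma relation_persists P (g : R -> C) (F1 F2 : R -> C -> C) :
  loop_at e P g -> continuation_along l B e g F1 -> continuation_along l B e g F2 ->
  (\forall x \near P, holds_at (F1 0) (F2 0) x) ->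
  \forall x \near P, holds_at (F1 1) (F2 1) x.
Proof.
move=> [gc g0 g1 go] c1 c2 h0.
suff : \forall x \near g 1, holds_at (F1 1) (F2 1) x by rewrite g1.
rewrite -g0 in h0.
apply: (@locally_constant_unit_interval R
  (fun t => \forall x \near g t, holds_at (F1 t) (F2 t) x)) h0 => t t01.
have [s1 n1] := c1 t t01; have [s2 n2] := c2 t t01.
have [r r0 ball_r] := regular_ball (And3 s1 s2 (go t t01)).
have gt : \forall s \near t, s \in `[0, 1] -> `|g s - g t| < r%:C.
  have gct : g @ within [set` `[(0 : R), 1]] (nbhs t) --> g t.
    by have /subspace_continuousP := gc; apply; rewrite /= in_itv in t01 *.
  have gr : \forall z \near g t, `|z - g t| < r%:C.
    near=> z; rewrite distrC; near: z; apply: near_dist_lt.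
    by rewrite ltcR.
  have H : \forall s \near t, s \in [set` `[(0 : R), 1]] -> `|g s - g t| < r%:C.
    by have := gct _ gr; apply: (filterS (F := nbhs t)) => s h /set_mem; exact: h.
  by apply: filterS H => s h s01; apply: h; rewrite inE.
near=> s => s01.
have gs : `|g s - g t| < r%:C by move: s01; near: s.
have e1 : \forall x \near g s, F1 s x = F1 t x by move: s01; near: s.
have e2 : \forall x \near g s, F2 s x = F2 t x by move: s01; near: s.
have near_r z : `|z - g t| < r%:C -> \forall x \near z, `|x - g t| < r%:C.
  move=> zr; have d0 : 0 < r%:C - `|z - g t| by rewrite subr_gt0.
  near=> x; have : `|z - x| < r%:C - `|z - g t| by near: x; exact: near_dist_lt.
  rewrite distrC ltrBrDr; apply: le_lt_trans.
  by have := ler_normD (x - z) (z - g t); rewrite addrA subrK.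
have spread z : `|z - g t| < r%:C -> (\forall x \near z, holds_at (F1 t) (F2 t) x) ->
    forall y, `|y - g t| < r%:C -> holds_at (F1 t) (F2 t) y.
  move=> zr hz y yr.
  have [y1 [y1r hy1] y1c] := near_exists_neq (g t) (filterI (near_r z zr) hz).
  exact: (holds_at_ball ball_r y1r yr y1c).
have tt : `|g t - g t| < r%:C by rewrite subrr normr0 ltcR.
split=> h.
  have h' := near_holds_at e1 e2 h.
  by apply: filterS (near_r _ tt) => y; exact: spread gs h' y.
apply: (@near_holds_at (F1 t) (F2 t)).
- by apply: filterS e1.
- by apply: filterS e2.
- by apply: filterS (near_r _ gs) => y; exact: spread tt h y.
Unshelve. all: by end_near. Qed.

End Persistence.

(** * Local branches of a curve given by two homogeneous equations *)

Section AlgebraicBranch.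

Lemma hd_horner (K : numFieldType) (A : {poly K}) (x : K) :
  has_derivative (fun y : K => A.[y] : K) x A^`().[x].
Proof.
elim/poly_ind: A => [|A c IH].
  rewrite deriv0 horner0 (_ : (fun y : K => _) = fun=> 0); first exact: hdcst.
  by apply/funext => y; rewrite horner0.
rewrite (_ : (fun y : K => _) = fun y => A.[y] * y + c); last first.
  by apply/funext => y; rewrite hornerMXaddC.
apply: hd_ext (hdD (hdM IH (hdid x)) (hdcst x c)).
by rewrite derivMXaddC hornerD hornerMX mulr1 addr0 [x * _]mulrC.
Qed.

Variable R : realType.
Local Notation C := R[i].

Definition holomorphic_at (f : C -> C) (x : C) := exists a, has_derivative f x a.

Lemma holomorphic_continuous f x : holomorphic_at f x -> {for x, continuous f}.
Proof. by move=> [a /hd_continuous]. Qed.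

Lemma holomorphic_comp f g x : holomorphic_at f x -> holomorphic_at g (f x) ->
  holomorphic_at (fun y => g (f y)) x.
Proof. by move=> [a fa] [b gb]; exists (b * a); exact: hd_comp. Qed.

Lemma holomorphicM f g x : holomorphic_at f x -> holomorphic_at g x ->
  holomorphic_at (fun y => f y * g y) x.
Proof. by move=> [a fa] [b gb]; exists (f x * b + g x * a); exact: hdM. Qed.

Lemma holomorphicV f x : f x != 0 -> holomorphic_at f x ->
  holomorphic_at (fun y => (f y)^-1) x.
Proof. by move=> f0 [a fa]; exists (- (f x) ^- 2 * a); exact: hdV. Qed.

Lemma holomorphic_horner (A : {poly C}) x : holomorphic_at (fun y : C => A.[y] : C) x.
Proof. by exists A^`().[x]; exact: hd_horner. Qed.

Variables (A B N D : {poly C}) (phi alpha : C -> C) (E : C -> C -> C -> Prop).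
Variables (x0 a1 a2 : C).
Let w0 := a1 / a2.
Hypotheses (monicA : A \is monic) (sBA : (size B < size A)%N).
Hypothesis B0 : B.[w0] != 0.
Hypothesis crit : B.[w0] * A^`().[w0] - A.[w0] * B^`().[w0] != 0.
Hypotheses (a20 : a2 != 0) (D0 : D.[w0] != 0).
Hypothesis phi_hol : \forall y \near x0, holomorphic_at phi y.
Hypothesis alpha_hol : \forall y \near x0, holomorphic_at alpha y.
(** In the coordinates w = a/b and s = b the curve is a tower: [w] lies in a fibre of A/B, and then
    [s] is a fourth root. *)
Hypothesis E_param : \forall y \near x0, forall w s : C, s != 0 -> D.[w] != 0 ->
  (E y (w * s) s <-> A.[w] = phi y * B.[w] /\ s ^+ 4 = alpha y * N.[w] / D.[w]).
Hypothesis E0 : E x0 a1 a2.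

(** Each storey of the tower is a case of [rational_inverse]. Its uniqueness clause becomes the last
    clause here: nearby points of the curve lie on the constructed branch. *)
Lemma algebraic_branch : exists U1 U2 : C -> C,
  [/\ U1 x0 = a1, U2 x0 = a2,
   \forall y \near x0,
     [/\ holomorphic_at U1 y, holomorphic_at U2 y & E y (U1 y) (U2 y)] &
   \forall p \near (x0, (a1, a2)), E p.1 p.2.1 p.2.2 -> p.2 = (U1 p.1, U2 p.1)].
Proof.
have a1E : a1 = w0 * a2 by rewrite /w0 divfK.
have [phiE psiE] : A.[w0] = phi x0 * B.[w0] /\ a2 ^+ 4 = alpha x0 * N.[w0] / D.[w0].
  by apply/(nbhs_singleton E_param) => //; rewrite -a1E.
have [W W0 [Wgood Wuniq]] := rational_inverse monicA sBA B0 crit.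
have phi0E : A.[w0] / B.[w0] = phi x0 by rewrite phiE mulfK.
rewrite {}phi0E in W0 Wgood Wuniq.
have [S S0 [Sgood Suniq]] : exists2 S : C -> C, S (a2 ^+ 4) = a2 &
  (\forall z \near a2 ^+ 4, S z ^+ 4 = z /\ holomorphic_at S z) /\
  (\forall p \near (a2 ^+ 4, a2), p.2 ^+ 4 = p.1 -> p.2 = S p.1).
  (* The fourth root near [a2 ^+ 4] is the inverse of the rational function X^4 / 1. *)
  have [||||S] := @rational_inverse _ ('X^4 : {poly C}) 1 a2.
  - exact: monicXn.
  - by rewrite size_polyXn size_poly1.
  - by rewrite hornerC oner_neq0.
  - rewrite -[1]/(1%:P) derivXn derivC hornerC horner0 mulr0 subr0 mul1r.
    by rewrite hornerMn hornerXn -mulr_natr mulf_neq0 ?expf_neq0 // pnatr_eq0.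
  have powE (z : C) : ('X^4 : {poly C}).[z] = z ^+ 4 by rewrite hornerXn.
  have oneE (z : C) : (1 : {poly C}).[z] = 1 by rewrite -[1]/(1%:P) hornerC.
  rewrite powE oneE divr1 => S0 [S1 S2]; exists S => //; split.
    by near=> z; have [] : ('X^4 : {poly C}).[S z] = z * (1 : {poly C}).[S z] /\
      exists a, has_derivative S z a; [near: z|rewrite powE oneE mulr1].
  near=> p => pE.
  suff : ('X^4 : {poly C}).[p.2] = p.1 * (1 : {poly C}).[p.2] -> p.2 = S p.1.
    by rewrite powE oneE mulr1; exact.
  by near: p.
pose w y := W (phi y).
pose psi y := alpha y * N.[w y] / D.[w y].
have phic : {for x0, continuous phi} := holomorphic_continuous (nbhs_singleton phi_hol).
have w_x0 : w x0 = w0 by rewrite /w W0.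
have psi_x0 : psi x0 = a2 ^+ 4 by rewrite /psi w_x0.
have w_good : \forall y \near x0, A.[w y] = phi y * B.[w y] /\ holomorphic_at w y.
  near=> y.
  have [Wy hWy] : A.[W (phi y)] = phi y * B.[W (phi y)] /\ exists a, has_derivative W (phi y) a.
    by near: y; exact: phic Wgood.
  by split=> //; apply: holomorphic_comp hWy; near: y.
have wc : {for x0, continuous w} := holomorphic_continuous (nbhs_singleton w_good).2.
have Dw : \forall y \near x0, D.[w y] != 0.
  have Dc := continuous_comp wc (@continuous_horner_num C D (w x0)).
  by apply: cvgr_neq0 Dc _; rewrite /= w_x0.
have psi_hol : \forall y \near x0, holomorphic_at psi y.
  near=> y; have hw : holomorphic_at w y by near: y; apply: filterS w_good => z [].
  apply: holomorphicM; last apply: holomorphicV.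
  - apply: holomorphicM; first by near: y.
    by apply: holomorphic_comp hw (holomorphic_horner N _).
  - by near: y.
  - by apply: holomorphic_comp hw (holomorphic_horner D _).
have psic : {for x0, continuous psi} := holomorphic_continuous (nbhs_singleton psi_hol).
rewrite -psi_x0 in Sgood Suniq.
pose U2 y := S (psi y).
have U2_x0 : U2 x0 = a2 by rewrite /U2 psi_x0.
have U2_good : \forall y \near x0, U2 y ^+ 4 = psi y /\ holomorphic_at U2 y.
  near=> y.
  have [Sy hSy] : S (psi y) ^+ 4 = psi y /\ holomorphic_at S (psi y).
    by near: y; exact: psic Sgood.
  by split=> //; apply: holomorphic_comp hSy; near: y.
have U2c : {for x0, continuous U2} := holomorphic_continuous (nbhs_singleton U2_good).2.
have U2n : \forall y \near x0, U2 y != 0 by apply: cvgr_neq0 U2c _; rewrite U2_x0.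
exists (fun y => w y * U2 y), U2; split=> //.
- by rewrite w_x0 U2_x0.
- near=> y.
  have [wy hw] : A.[w y] = phi y * B.[w y] /\ holomorphic_at w y by near: y.
  have [Uy hU] : U2 y ^+ 4 = psi y /\ holomorphic_at U2 y by near: y.
  split=> //; first exact: holomorphicM.
  have Ey : forall w s : C, s != 0 -> D.[w] != 0 ->
    (E y (w * s) s <-> A.[w] = phi y * B.[w] /\ s ^+ 4 = alpha y * N.[w] / D.[w]).
    by near: y.
  by apply/Ey => //; near: y.
- pose p0 : C * (C * C) := (x0, (a1, a2)).
  pose q (p : C * (C * C)) : C := p.2.1 / p.2.2.
  have c1 : {for p0, continuous (fun p : C * (C * C) => p.1 : C)} by exact: cvg_fst.
  have c2 : {for p0, continuous (fun p : C * (C * C) => p.2)} by exact: cvg_snd.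
  have c21 : {for p0, continuous (fun p : C * (C * C) => p.2.1 : C)}.
    exact: (cvg_comp _ _ c2 cvg_fst).
  have c22 : {for p0, continuous (fun p : C * (C * C) => p.2.2 : C)}.
    exact: (cvg_comp _ _ c2 cvg_snd).
  have cq : {for p0, continuous q} by exact: cntM c21 (cntV _ c22).
  have cphi : {for p0, continuous (fun p : C * (C * C) => phi p.1)}.
    exact: (cvg_comp _ _ c1 phic).
  have cpsi : {for p0, continuous (fun p : C * (C * C) => psi p.1)}.
    exact: (cvg_comp _ _ c1 psic).
  have Wu : \forall p \near p0, A.[q p] = phi p.1 * B.[q p] -> q p = W (phi p.1).
    exact: (cvg_pair cphi cq Wuniq).
  have Su : \forall p \near p0, p.2.2 ^+ 4 = psi p.1 -> p.2.2 = S (psi p.1).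
    exact: (cvg_pair cpsi c22 Suniq).
  near=> p => Ep.
  have p2 : p.2.2 != 0 by near: p; exact: cvgr_neq0 c22 a20.
  have Dq : D.[q p] != 0.
    near: p; have cD := cvg_comp _ _ cq (@continuous_horner_num C D w0).
    exact: cvgr_neq0 cD D0.
  have Ey : forall w s : C, s != 0 -> D.[w] != 0 ->
    (E p.1 (w * s) s <-> A.[w] = phi p.1 * B.[w] /\ s ^+ 4 = alpha p.1 * N.[w] / D.[w]).
    by near: p; exact: (c1 _ E_param).
  have [qA qs] : A.[q p] = phi p.1 * B.[q p] /\ p.2.2 ^+ 4 = alpha p.1 * N.[q p] / D.[q p].
    by apply/Ey => //; rewrite /q divfK.
  have qW : q p = W (phi p.1).
    suff : A.[q p] = phi p.1 * B.[q p] -> q p = W (phi p.1) by apply.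
    by near: p.
  have s2 : p.2.2 = U2 p.1.
    suff : p.2.2 ^+ 4 = psi p.1 -> p.2.2 = S (psi p.1).
      by apply; rewrite /psi /w -qW.
    by near: p.
  by rewrite [LHS]surjective_pairing -s2 -[X in (X, _)](divfK p2) -/(q p) qW.
Unshelve. all: by end_near. Qed.

End AlgebraicBranch.

(** * Matrices preserving a binary form *)

Section BinaryForms.
Variable R : realType.
Local Notation C := R[i].
Implicit Types (M N : 'M[C]_2) (p : {poly C}) (a b c d k x w : C).

Lemma poly_eq0_horner p : (forall x, p.[x] = 0) -> p = 0.
Proof.
move=> p0; apply: contraTeq isT => pn0.
pose rs : seq C := [seq n%:R | n <- iota 0 (size p)].
have : (size rs < size p)%N.
  apply: max_poly_roots => //; first by apply/allP => x _; apply/rootP.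
  by rewrite map_inj_uniq ?iota_uniq // => m n /eqP; rewrite eqr_nat => /eqP.
by rewrite size_map size_iota ltnn.
Qed.

Lemma ord2P (i : 'I_2) : i = 0 \/ i = 1.
Proof. by case: i => [[|[|//]] ?]; [left|right]; exact: val_inj. Qed.

Lemma det22E M : \det M = M 0 0 * M 1 1 - M 0 1 * M 1 0.
Proof.
have e0 : lift (0 : 'I_2) 0 = 1 by exact: val_inj.
have e1 : lift (1 : 'I_2) 0 = 0 by exact: val_inj.
rewrite (expand_det_row _ 0) big_ord_recl big_ord1 /cofactor !det_mx11 !mxE e0 e1.
by rewrite expr0 mul1r expr1 mulN1r mulrN.
Qed.

(** Matrices act on rows from the right, as continuation acts on the row of basis solutions. *)
Definition rowl M a b := a * M 0 0 + b * M 1 0.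
Definition rowr M a b := a * M 0 1 + b * M 1 1.

Lemma row_neq0 M a b : M \in unitmx -> (a, b) != 0 -> (rowl M a b, rowr M a b) != 0.
Proof.
rewrite unitmxE unitfE det22E => dM; apply: contraNneq => -[la ra].
have ea : a * (M 0 0 * M 1 1 - M 0 1 * M 1 0) = 0.
  transitivity (rowl M a b * M 1 1 - rowr M a b * M 1 0); first by rewrite /rowl /rowr; ring.
  by rewrite la ra !mul0r subrr.
have eb : b * (M 0 0 * M 1 1 - M 0 1 * M 1 0) = 0.
  transitivity (rowr M a b * M 0 0 - rowl M a b * M 0 1); first by rewrite /rowl /rowr; ring.
  by rewrite la ra !mul0r subrr.
apply/eqP; congr (_, _); apply/eqP.
  by move/eqP: ea; rewrite mulf_eq0 (negPf dM) orbF.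
by move/eqP: eb; rewrite mulf_eq0 (negPf dM) orbF.
Qed.

(** A point of the projective line, with [None] at infinity. *)
Definition slope a b : option C := if b == 0 then None else Some (a / b).

Lemma slope_eq a b c d : (a, b) != 0 -> (c, d) != 0 -> slope a b = slope c d ->
  exists2 k, k != 0 & c = k * a /\ d = k * b.
Proof.
rewrite /slope => ab cd; have [b0|b0] := eqVneq b 0; have [d0|d0] := eqVneq d 0 => // h.
  have a0 : a != 0 by apply/eqP => a0; move: ab; rewrite a0 b0 eqxx.
  have c0 : c != 0 by apply/eqP => c0; move: cd; rewrite c0 d0 eqxx.
  exists (c / a); first by rewrite mulf_neq0 ?invr_eq0.
  by rewrite divfK // b0 d0 mulr0.
case: h => h; exists (d / b); first by rewrite mulf_neq0 ?invr_eq0.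
split; last by rewrite divfK.
by apply: (mulIf (invr_neq0 d0)); rewrite -h; field; rewrite b0 d0.
Qed.

Lemma pgl_class_scale M k : k != 0 -> pgl_class (k *: M) = pgl_class M.
Proof.
move=> k0; apply/seteqP; split=> _ [c /eqP c0 <-].
  by exists (c * k); [apply/eqP; rewrite mulf_neq0|rewrite scalerA].
exists (c / k); first by apply/eqP; rewrite mulf_neq0 ?invr_eq0.
by rewrite scalerA divfK.
Qed.

Lemma pgl_class_eq M N : pgl_class M = pgl_class N -> exists2 k, k != 0 & M = k *: N.
Proof.
move=> /seteqP[/(_ M) h _]; have [|k /eqP k0 <-] := h; last by exists k.
by exists 1; [apply/eqP; exact: oner_neq0|rewrite scale1r].
Qed.

Section Form.
Variables (form : C -> C -> C) (pform : {poly C} -> {poly C} -> {poly C}) (n : nat).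
Hypothesis hornerF : forall p q w, (pform p q).[w] = form p.[w] q.[w].
Hypothesis homF : forall k a b, form (k * a) (k * b) = k ^+ n * form a b.

Definition preserves M := forall a b, form (rowl M a b) (rowr M a b) = form a b.

(** The polynomial identity covers [b != 0] by homogeneity. For [b = 0] one lets the second
    coordinate vary: the difference is a polynomial in it that vanishes off 0. *)
Lemma preserves_poly M :
  pform ('X * (M 0 0)%:P + (M 1 0)%:P) ('X * (M 0 1)%:P + (M 1 1)%:P) = pform 'X 1 ->
  preserves M.
Proof.
move=> pE; have E1 w : form (rowl M w 1) (rowr M w 1) = form w 1.
  have := congr1 (fun p : {poly C} => p.[w]) pE.
  rewrite /= !hornerF -[1 : {poly C}]/(1%:P) !(hornerD, hornerM, hornerC, hornerX).
  by rewrite /rowl /rowr !mul1r.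
have En0 a b : b != 0 -> form (rowl M a b) (rowr M a b) = form a b.
  move=> b0; have aE : a = b * (a / b) by rewrite mulrC divfK.
  have -> : rowl M a b = b * rowl M (a / b) 1 by rewrite {1}aE /rowl; ring.
  have -> : rowr M a b = b * rowr M (a / b) 1 by rewrite {1}aE /rowr; ring.
  by rewrite homF E1 -homF mulr1 -aE.
move=> a b; have [->|/En0 //] := eqVneq b 0.
pose q := pform (a%:P * (M 0 0)%:P + 'X * (M 1 0)%:P) (a%:P * (M 0 1)%:P + 'X * (M 1 1)%:P)
  - pform a%:P 'X.
have qE x : q.[x] = form (rowl M a x) (rowr M a x) - form a x.
  by rewrite /q hornerD hornerN !hornerF !(hornerD, hornerM, hornerC, hornerX).
(* The factor X absorbs the value 0, where nothing is known yet. *)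
have /poly_eq0_horner : forall x, ('X * q).[x] = 0.
  move=> x; rewrite hornerM hornerX qE.
  by have [->|/En0 ->] := eqVneq x 0; rewrite ?mul0r // subrr mulr0.
move=> /eqP; rewrite mulf_eq0 polyX_eq0 /= => /eqP q0.
by apply/eqP; rewrite -subr_eq0 -qE q0 horner0.
Qed.

Variable r : C.
Hypotheses (r0 : r != 0) (formr : form r 1 = 0) (form10 : form 1 0 = 0) (form01 : form 0 1 = 0).
Hypothesis pform_neq0 : pform 'X 1 != 0.

Lemma form_slopes : exists rs : seq C,
  forall a b, form a b = 0 -> slope a b \in None :: [seq Some x | x <- rs].
Proof.
have [rs rsE] := closed_field_poly_normal (pform 'X 1); exists rs => a b.
rewrite /slope; case: eqP => [_ _|/eqP b0 ab0]; first by rewrite mem_head.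
rewrite in_cons /= mem_map; last by move=> ? ? [].
suff : root (pform 'X 1) (a / b).
  by rewrite rsE rootZ ?lead_coef_eq0 // root_prod_XsubC.
apply/rootP; rewrite hornerF -[1 : {poly C}]/(1%:P) hornerX hornerC.
have : form (b * (a / b)) (b * 1) = 0 by rewrite mulrC divfK // mulr1.
by rewrite homF => /eqP; rewrite mulf_eq0 (negPf (expf_neq0 n b0)) /= => /eqP.
Qed.

(** A projectivity is determined by the images of three points. The points infinity, 0 and [r] are
    zeros of the form, so a preserving matrix sends them to zeros, of which there are finitely
    many. *)
Lemma finite_pgl_classes (S : set 'M[C]_2) :
  (forall M, S M -> M \in unitmx /\ preserves M) ->
  finite_set [set pgl_class M | M in S].
Proof.
move=> SP; have [rs rsP] := form_slopes.
pose L := None :: [seq Some x | x <- rs].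
pose code M := (slope (rowl M 1 0) (rowr M 1 0), slope (rowl M 0 1) (rowr M 0 1),
                slope (rowl M r 1) (rowr M r 1)).
have codeL M : S M -> code M \in allpairs pair (allpairs pair L L) L.
  move=> /SP[_ pM]; apply/allpairsP; exists (code M).
  split=> //; last by apply: rsP; rewrite pM.
  by apply: allpairs_f; apply: rsP; rewrite pM.
have code_class M N : S M -> S N -> code M = code N -> pgl_class M = pgl_class N.
  move=> /SP[uM _] /SP[uN _] [e1 e2 e3].
  have n10 : (1, 0) != 0 :> C * C by apply/eqP => -[/eqP]; rewrite oner_eq0.
  have n01 : (0, 1) != 0 :> C * C by apply/eqP => -[/eqP]; rewrite oner_eq0.
  have nr1 : (r, 1) != 0 :> C * C by apply/eqP => -[_ /eqP]; rewrite oner_eq0.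
  (* The rows of [N] are [k1] and [k2] times those of [M]; the third point forces both factors to
     equal [k3]. *)
  have [k1 k10 [l1 r1]] := slope_eq (row_neq0 uM n10) (row_neq0 uN n10) e1.
  have [k2 k20 [l2 r2]] := slope_eq (row_neq0 uM n01) (row_neq0 uN n01) e2.
  have [k3 k30 [l3 r3]] := slope_eq (row_neq0 uM nr1) (row_neq0 uN nr1) e3.
  rewrite /rowl /rowr !mul1r !mul0r ?addr0 ?add0r in l1 r1 l2 r2 l3 r3.
  have dM : M 0 0 * M 1 1 - M 0 1 * M 1 0 != 0 by rewrite -det22E -unitfE -unitmxE.
  rewrite l1 l2 in l3; rewrite r1 r2 in r3.
  have lE : r * (k1 - k3) * M 0 0 + (k2 - k3) * M 1 0 = 0.
    transitivity (r * (k1 * M 0 0) + k2 * M 1 0 - k3 * (r * M 0 0 + M 1 0)); first by ring.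
    by rewrite l3 subrr.
  have rE : r * (k1 - k3) * M 0 1 + (k2 - k3) * M 1 1 = 0.
    transitivity (r * (k1 * M 0 1) + k2 * M 1 1 - k3 * (r * M 0 1 + M 1 1)); first by ring.
    by rewrite r3 subrr.
  have k13 : k1 = k3.
    apply/eqP; rewrite -subr_eq0; apply/eqP/(mulfI r0)/(mulIf dM); rewrite mulr0 mul0r.
    transitivity ((r * (k1 - k3) * M 0 0 + (k2 - k3) * M 1 0) * M 1 1 -
                  (r * (k1 - k3) * M 0 1 + (k2 - k3) * M 1 1) * M 1 0); first by ring.
    by rewrite lE rE !mul0r subrr.
  have k23 : k2 = k3.
    apply/eqP; rewrite -subr_eq0; apply/eqP/(mulIf dM); rewrite mul0r.
    transitivity ((r * (k1 - k3) * M 0 1 + (k2 - k3) * M 1 1) * M 0 0 -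
                  (r * (k1 - k3) * M 0 0 + (k2 - k3) * M 1 0) * M 0 1); first by ring.
    by rewrite lE rE !mul0r subrr.
  rewrite -(pgl_class_scale M k30); congr (pgl_class _).
  apply/matrixP => i j; rewrite mxE.
  by have [->|->] := ord2P i; have [->|->] := ord2P j;
    rewrite ?l1 ?r1 ?l2 ?r2 ?k13 ?k23.
have fin : finite_set [set code M | M in S].
  apply: (@sub_finite_set _ _ [set` allpairs pair (allpairs pair L L) L]); last exact: finite_seq.
  by move=> _ [M SM <-] /=; exact: codeL.
(* A matrix of [S] is chosen for each code that occurs; the identity is the default for the other
   codes. *)
pose rep t := pgl_class (xget 1%:M [set M | S M /\ code M = t]).
apply: (@sub_finite_set _ _ [set rep t | t in [set code M | M in S]]); last exact: finite_image.
move=> _ [M SM <-]; exists (code M); first by exists M.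
have [SX cX] : [set N | S N /\ code N = code M] (xget 1%:M [set N | S N /\ code N = code M]).
  by apply: (@xgetI _ _ _ M); split.
exact: code_class.
Qed.

End Form.
End BinaryForms.

(** * The icosahedral operator *)

Section IcosahedralForms.
Variable T : comNzRingType.
Implicit Types x y : T.

(* Klein's invariants: [icoH] is the Hessian and [icoT] the Jacobian covariant
   of [ico], up to constant factors; digits are partial derivatives. *)

Definition ico x y := x * y * (x ^+ 10 + 11 * (x ^+ 5 * y ^+ 5) - y ^+ 10).
Definition ico1 x y := 11 * (x ^+ 10 * y) + 66 * (x ^+ 5 * y ^+ 6) - y ^+ 11.
Definition ico2 x y := x ^+ 11 + 66 * (x ^+ 6 * y ^+ 5) - 11 * (x * y ^+ 10).
Definition ico11 x y := 110 * (x ^+ 9 * y) + 330 * (x ^+ 4 * y ^+ 6).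
Definition ico12 x y := 11 * x ^+ 10 + 396 * (x ^+ 5 * y ^+ 5) - 11 * y ^+ 10.
Definition ico22 x y := 330 * (x ^+ 6 * y ^+ 4) - 110 * (x * y ^+ 9).

Definition icoH x y := - (x ^+ 20 + y ^+ 20) + 228 * (x ^+ 15 * y ^+ 5 - x ^+ 5 * y ^+ 15)
  - 494 * (x ^+ 10 * y ^+ 10).
Definition icoH1 x y := - (20 * x ^+ 19)
  + 228 * (15 * (x ^+ 14 * y ^+ 5) - 5 * (x ^+ 4 * y ^+ 15)) - 494 * 10 * (x ^+ 9 * y ^+ 10).
Definition icoH2 x y := - (20 * y ^+ 19)
  + 228 * (5 * (x ^+ 15 * y ^+ 4) - 15 * (x ^+ 5 * y ^+ 14)) - 494 * 10 * (x ^+ 10 * y ^+ 9).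
Definition icoH11 x y := - (380 * x ^+ 18)
  + 228 * (210 * (x ^+ 13 * y ^+ 5) - 20 * (x ^+ 3 * y ^+ 15)) - 494 * 90 * (x ^+ 8 * y ^+ 10).
Definition icoH12 x y := 228 * (75 * (x ^+ 14 * y ^+ 4) - 75 * (x ^+ 4 * y ^+ 14))
  - 494 * 100 * (x ^+ 9 * y ^+ 9).
Definition icoH22 x y := - (380 * y ^+ 18)
  + 228 * (20 * (x ^+ 15 * y ^+ 3) - 210 * (x ^+ 5 * y ^+ 13)) - 494 * 90 * (x ^+ 10 * y ^+ 8).

Definition icoT x y := x ^+ 30 + y ^+ 30 + 522 * (x ^+ 25 * y ^+ 5 - x ^+ 5 * y ^+ 25)
  - 2001 * 5 * (x ^+ 20 * y ^+ 10 + x ^+ 10 * y ^+ 20).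

Lemma ico_hom k x y : ico (k * x) (k * y) = k ^+ 12 * ico x y.
Proof. rewrite /ico; ring. Qed.
Lemma icoH_hom k x y : icoH (k * x) (k * y) = k ^+ 20 * icoH x y.
Proof. rewrite /icoH; ring. Qed.
Lemma icoT_hom k x y : icoT (k * x) (k * y) = k ^+ 30 * icoT x y.
Proof. rewrite /icoT; ring. Qed.

Lemma ico_euler x y : x * ico1 x y + y * ico2 x y = 12 * ico x y.
Proof. rewrite /ico /ico1 /ico2; ring. Qed.
Lemma icoH_euler x y : x * icoH1 x y + y * icoH2 x y = 20 * icoH x y.
Proof. rewrite /icoH /icoH1 /icoH2; ring. Qed.

Lemma ico_jacobian x y :
  ico1 x y * icoH2 x y - ico2 x y * icoH1 x y = 20 * icoT x y.
Proof. rewrite /ico1 /ico2 /icoH1 /icoH2 /icoT; ring. Qed.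

(** Klein's syzygy. On the curve it turns [icoT ^+ 2] into a polynomial in x. *)
Lemma ico_syzygy x y : icoT x y ^+ 2 = 1728 * ico x y ^+ 5 - icoH x y ^+ 3.
Proof. rewrite /ico /icoH /icoT; ring. Qed.

(** Euler's relations 11 f_1 = x f_11 + y f_12 and 11 f_2 = x f_12 + y f_22 reduce the left side to
    -x/11 times the Hessian determinant, which is 121 [icoH]. *)
Lemma ico_hessian_x x y : ico12 x y * ico2 x y - ico22 x y * ico1 x y = - 11 * x * icoH x y.
Proof. rewrite /ico1 /ico2 /ico12 /ico22 /icoH; ring. Qed.
Lemma ico_hessian_y x y : ico12 x y * ico1 x y - ico11 x y * ico2 x y = - 11 * y * icoH x y.
Proof. rewrite /ico1 /ico2 /ico12 /ico11 /icoH; ring. Qed.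
(** As before, with 19 for 11: the Hessian of [icoH] is an invariant of degree 36, hence a multiple
    of [ico ^+ 3]. *)
Lemma icoH_hessian_x x y :
  icoH12 x y * icoH2 x y - icoH22 x y * icoH1 x y = 912 * 100 * x * ico x y ^+ 3.
Proof. rewrite /icoH1 /icoH2 /icoH12 /icoH22 /ico; ring. Qed.
Lemma icoH_hessian_y x y :
  icoH12 x y * icoH1 x y - icoH11 x y * icoH2 x y = 912 * 100 * y * ico x y ^+ 3.
Proof. rewrite /icoH1 /icoH2 /icoH12 /icoH11 /ico; ring. Qed.

(** The cross term that arises when the expression of the two Hessian identities is formed for the
    combination [icoH - 20 * ico]. *)
Definition ico_mixed_x x y := icoH12 x y * ico2 x y + ico12 x y * icoH2 x y
  - icoH22 x y * ico1 x y - ico22 x y * icoH1 x y.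
Definition ico_mixed_y x y := icoH12 x y * ico1 x y + ico12 x y * icoH1 x y
  - icoH11 x y * ico2 x y - ico11 x y * icoH2 x y.

(** This identity and its companions express products of [icoT] with partial derivatives through the
    mixed terms, which removes the first power of [icoT] from the second-order equation. *)
Lemma ico_mixed_x_ico x y : 3 * ico_mixed_x x y * ico x y =
  - 40 * ico2 x y * icoT x y + 40 * x * icoH x y ^+ 2.
Proof.
rewrite /ico_mixed_x /icoH12 /ico2 /ico12 /icoH2 /icoH22 /ico1 /ico22 /icoH1 /ico /icoT /icoH.
ring.
Qed.
Lemma ico_mixed_x_icoH x y : 5 * ico_mixed_x x y * icoH x y =
  - 40 * icoH2 x y * icoT x y + 1152 * 100 * x * ico x y ^+ 4.
Proof.
rewrite /ico_mixed_x /icoH12 /ico2 /ico12 /icoH2 /icoH22 /ico1 /ico22 /icoH1 /ico /icoT /icoH.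
ring.
Qed.
Lemma ico_mixed_y_ico x y : 3 * ico_mixed_y x y * ico x y =
  40 * ico1 x y * icoT x y + 40 * y * icoH x y ^+ 2.
Proof.
rewrite /ico_mixed_y /icoH12 /ico1 /ico12 /icoH1 /icoH11 /ico2 /ico11 /icoH2 /ico /icoT /icoH.
ring.
Qed.
Lemma ico_mixed_y_icoH x y : 5 * ico_mixed_y x y * icoH x y =
  40 * icoH1 x y * icoT x y + 1152 * 100 * y * ico x y ^+ 4.
Proof.
rewrite /ico_mixed_y /icoH12 /ico1 /ico12 /icoH1 /icoH11 /ico2 /ico11 /icoH2 /ico /icoT /icoH.
ring.
Qed.

End IcosahedralForms.

(** * From a first-order system with a square root to a Lamé solution *)

Section FirstOrderSystem.
Variables (R : realType) (l B : R[i]) (e : 'I_3 -> R[i]).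
Local Notation C := R[i].
Implicit Types x y : C.

Definition lame_prod x : C := (x - e 0) * (x - e 1) * (x - e (inord 2)).
Definition lame_dprod x : C := (x - e 1) * (x - e (inord 2)) +
  (x - e 0) * (x - e (inord 2)) + (x - e 0) * (x - e 1).

Lemma ord3_sum (V : nmodType) (F : 'I_3 -> V) : \sum_i F i = F 0 + F 1 + F (inord 2).
Proof.
rewrite !big_ord_recr big_ord0 /= add0r; congr (F _ + F _ + F _); apply: val_inj => //=.
by rewrite inordK.
Qed.

Lemma ord3_prod (F : 'I_3 -> C) : \prod_i F i = F 0 * F 1 * F (inord 2).
Proof.
rewrite !big_ord_recr big_ord0 /= mul1r; congr (F _ * F _ * F _); apply: val_inj => //=.
by rewrite inordK.
Qed.

Lemma ordinary_neq0 x i : ordinary_point e x -> x - e i != 0.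
Proof. by move=> /(_ i) /eqP; rewrite subr_eq0. Qed.

Lemma lame_prod_neq0 x : ordinary_point e x -> lame_prod x != 0.
Proof. by move=> ox; rewrite /lame_prod !mulf_neq0 // ordinary_neq0. Qed.

Lemma lame_pE x : ordinary_point e x -> lame_p e x = lame_dprod x / (2 * lame_prod x).
Proof.
move=> ox; rewrite /lame_p ord3_sum /lame_dprod /lame_prod.
have := ordinary_neq0 0 ox; have := ordinary_neq0 1 ox; have := ordinary_neq0 (inord 2) ox.
move: (x - e 0) (x - e 1) (x - e (inord 2)) => a b c c0 b0 a0.
by field; rewrite c0 b0 a0.
Qed.

Lemma lame_qE x : lame_q l B e x = (l * (l + 1) * x + B) / (4 * lame_prod x).
Proof. by rewrite /lame_q ord3_prod. Qed.

Lemma hd_lame_prod x : has_derivative lame_prod x (lame_dprod x).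
Proof.
have d i : has_derivative (fun x => x - e i) x 1.
  by have := hdD (hdid x) (hdcst x (- e i)); rewrite addr0.
apply: hd_ext (hdM (hdM (d 0) (d 1)) (d (inord 2))).
rewrite /lame_dprod; move: (x - e 0) (x - e 1) (x - e (inord 2)) => a b c; ring.
Qed.

(** The square root [s] need only be holomorphic: its derivative is eliminated by 2 s s' = G'. *)
Lemma local_solution_first_order x0 (u n s G n' G' : C -> C) :
  (\forall y \near x0, has_derivative u y (n y / s y)) ->
  (\forall y \near x0, has_derivative n y (n' y)) ->
  (\forall y \near x0, holomorphic_at s y) ->
  (\forall y \near x0, has_derivative G y (G' y)) ->
  (\forall y \near x0, s y ^+ 2 = G y) ->
  (\forall y \near x0, s y != 0) ->
  (\forall y \near x0, n' y / s y - n y * G' y / (2 * G y * s y)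
     + lame_p e y * (n y / s y) = lame_q l B e y * u y) ->
  local_solution l B e x0 u.
Proof.
move=> hu hn hs hG sG s0 heq.
apply: (local_solution_intro hu _ heq); near=> y.
have [s' hs'] : holomorphic_at s y by near: y.
have hn' : has_derivative n y (n' y) by near: y.
have hG' : has_derivative G y (G' y) by near: y.
have sGy : \forall z \near y, s z ^+ 2 = G z by near: y; exact: nbhs_interior.
have sy0 : s y != 0 by near: y.
have G'E : 2 * s y * s' = G' y.
  have := hd_near sGy (hdX 2 hs').
  by move=> /hd_unique /(_ hG'); rewrite expr1.
apply: hd_ext (hdM hn' (hdV sy0 hs')).
rewrite -(nbhs_singleton sGy) -G'E.
by field.
Unshelve. all: by end_near. Qed.

End FirstOrderSystem.

(** Differentiation by recursion on the syntax; [hd_tac] leaves the comparison with the announced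
    value. *)
Ltac hd_step := match goal with
  | |- has_derivative (fun _ => ?c) _ _ => eapply hdcst
  | |- has_derivative (fun y => @Algebra.add _ (@?f y) (@?g y)) _ _ => eapply (@hdD _ f g)
  | |- has_derivative (fun y => @Algebra.opp _ (@?f y)) _ _ => eapply (@hdN _ f)
  | |- has_derivative (fun y => @GRing.mul _ (@?f y) (@?g y)) _ _ => eapply (@hdM _ f g)
  | |- has_derivative (fun y => @GRing.exp _ (@?f y) ?n) _ _ => eapply (@hdX _ f n)
  | H : has_derivative ?f _ _ |- has_derivative ?f _ _ => eexact H
  | H : has_derivative ?f _ _ |- has_derivative (fun y => ?f y) _ _ => eexact H
  end.
Ltac hd_tac := eapply hd_ext; last (repeat hd_step); cbn [predn].

Section IcosahedralCurve.
Variables (R : realType) (e : 'I_3 -> R[i]).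
Local Notation C := R[i].
Implicit Types (x y : C) (U V : C -> C).

Section FormDerivatives.
Variables (U V : C -> C) (x a b : C).
Hypotheses (hU : has_derivative U x a) (hV : has_derivative V x b).

Lemma hd_ico : has_derivative (fun y => ico (U y) (V y)) x
  (ico1 (U x) (V x) * a + ico2 (U x) (V x) * b).
Proof. rewrite /ico; hd_tac; rewrite /ico1 /ico2; ring. Qed.

Lemma hd_icoH : has_derivative (fun y => icoH (U y) (V y)) x
  (icoH1 (U x) (V x) * a + icoH2 (U x) (V x) * b).
Proof. rewrite /icoH; hd_tac; rewrite /icoH1 /icoH2; ring. Qed.

Lemma hd_icoQ1 : has_derivative (fun y => icoH1 (U y) (V y) - 20 * ico1 (U y) (V y)) x
  ((icoH11 (U x) (V x) - 20 * ico11 (U x) (V x)) * a +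
   (icoH12 (U x) (V x) - 20 * ico12 (U x) (V x)) * b).
Proof. rewrite /icoH1 /ico1; hd_tac; rewrite /icoH11 /ico11 /icoH12 /ico12; ring. Qed.

Lemma hd_icoQ2 : has_derivative (fun y => icoH2 (U y) (V y) - 20 * ico2 (U y) (V y)) x
  ((icoH12 (U x) (V x) - 20 * ico12 (U x) (V x)) * a +
   (icoH22 (U x) (V x) - 20 * ico22 (U x) (V x)) * b).
Proof. rewrite /icoH2 /ico2; hd_tac; rewrite /icoH22 /ico22 /icoH12 /ico12; ring. Qed.

Lemma holomorphic_icoT : holomorphic_at (fun y => 20 * icoT (U y) (V y)) x.
Proof. by rewrite /icoT /holomorphic_at; eexists; repeat hd_step. Qed.

End FormDerivatives.
End IcosahedralCurve.

(** * The Lamé equation as an identity between icosahedral covariants *)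

Section IcosahedralOde.
Variable F : numFieldType.
Implicit Types x y : F.

Lemma ico_square x y : icoH x y = 20 * ico x y - 8 ->
  (20 * icoT x y) ^+ 2 = 256 * 100 * (ico x y - 1) ^+ 2 *
    (27 * ico x y ^+ 3 + 54 * ico x y ^+ 2 - 44 * ico x y + 8).
Proof. by move=> hH; rewrite exprMn ico_syzygy hH; ring. Qed.

(** The second-order equation along a' = Q_2 / (20 T), b' = - Q_1 / (20 T), where Q = H - 20 f. The
    mixed term has coefficient -20 (f - 1) + (5/2) H - 30 f, which vanishes on the line H = 20 f -
    8. The factor 7/36 is l (l + 1), and f + 2/3 is x. *)
Lemma ico_ode_x x y : icoH x y = 20 * ico x y - 8 ->
  ((icoH12 x y - 20 * ico12 x y) * (icoH2 x y - 20 * ico2 x y)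
   - (icoH22 x y - 20 * ico22 x y) * (icoH1 x y - 20 * ico1 x y)) * (ico x y - 1)
  - (icoH2 x y - 20 * ico2 x y) * (20 * icoT x y) =
  1728 * 100 * x * (7 / 36 * (ico x y + 2 / 3) - 2 / 27) * (ico x y - 1) ^+ 3.
Proof.
move=> hH; have m1 := ico_mixed_x_ico x y; have m2 := ico_mixed_x_icoH x y.
transitivity ((912 * 100 * x * ico x y ^+ 3 + 400 * (- 11 * x * icoH x y)
    - 20 * ico_mixed_x x y) * (ico x y - 1)
    - (20 * (icoH2 x y * icoT x y) - 400 * (ico2 x y * icoT x y))).
  by rewrite -icoH_hessian_x -ico_hessian_x /ico_mixed_x; ring.
have -> : icoH2 x y * icoT x y =
    (1152 * 100 * x * ico x y ^+ 4 - 5 * ico_mixed_x x y * icoH x y) / 40.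
  by rewrite m2; field.
have -> : ico2 x y * icoT x y =
    (40 * x * icoH x y ^+ 2 - 3 * ico_mixed_x x y * ico x y) / 40.
  by rewrite m1; field.
by rewrite hH; field.
Qed.

Lemma ico_ode_y x y : icoH x y = 20 * ico x y - 8 ->
  ((icoH12 x y - 20 * ico12 x y) * (icoH1 x y - 20 * ico1 x y)
   - (icoH11 x y - 20 * ico11 x y) * (icoH2 x y - 20 * ico2 x y)) * (ico x y - 1)
  - (- (icoH1 x y - 20 * ico1 x y)) * (20 * icoT x y) =
  1728 * 100 * y * (7 / 36 * (ico x y + 2 / 3) - 2 / 27) * (ico x y - 1) ^+ 3.
Proof.
move=> hH; have m1 := ico_mixed_y_ico x y; have m2 := ico_mixed_y_icoH x y.
transitivity ((912 * 100 * y * ico x y ^+ 3 + 400 * (- 11 * y * icoH x y)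
    - 20 * ico_mixed_y x y) * (ico x y - 1)
    + (20 * (icoH1 x y * icoT x y) - 400 * (ico1 x y * icoT x y))).
  by rewrite -icoH_hessian_y -ico_hessian_y /ico_mixed_y; ring.
have -> : icoH1 x y * icoT x y =
    (5 * ico_mixed_y x y * icoH x y - 1152 * 100 * y * ico x y ^+ 4) / 40.
  by rewrite m2; field.
have -> : ico1 x y * icoT x y =
    (3 * ico_mixed_y x y * ico x y - 40 * y * icoH x y ^+ 2) / 40.
  by rewrite m1; field.
by rewrite hH; field.
Qed.

(* The equation of [local_solution_first_order] for [s^2 = G = c (Y-1)^2 P],
   once its left-hand side has been multiplied out. *)
Lemma first_order_equation (A n s Y P P1 u x : F) :
  s != 0 -> Y - 1 != 0 -> P != 0 ->
  s ^+ 2 = 256 * 100 * 27 * (Y - 1) ^+ 2 * P ->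
  A * (Y - 1) - n * s = 1728 * 100 * u * (7 / 36 * x - 2 / 27) * (Y - 1) ^+ 3 ->
  A / s / s - n * (256 * 100 * 27 * (2 * (Y - 1) * P + (Y - 1) ^+ 2 * P1)) /
     (2 * (256 * 100 * 27 * (Y - 1) ^+ 2 * P) * s) + P1 / (2 * P) * (n / s) =
  (6^-1 * (6^-1 + 1) * x + - (2 / 27)) / (4 * P) * u.
Proof.
move=> s0 Y0 P0 sE key.
have AE : A = (n * s + 1728 * 100 * u * (7 / 36 * x - 2 / 27) * (Y - 1) ^+ 3) / (Y - 1).
  by rewrite -key; field.
transitivity ((A * (Y - 1) - n * s) / ((Y - 1) * s ^+ 2)).
  by field; rewrite s0 Y0 P0.
rewrite key sE; field; by rewrite P0 Y0.
Qed.

Lemma linear_quotient (h k q r s : F) :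
  h * (q / s) + k * (- r / s) = (h * q - k * r) / s.
Proof. by rewrite mulrBl !mulrA mulrN !mulNr. Qed.

Lemma linear_quotient_opp (h k q r s : F) :
  - (h * (q / s) + k * (- r / s)) = (k * r - h * q) / s.
Proof. by rewrite linear_quotient -mulNr opprB. Qed.

End IcosahedralOde.

(** * The first-order system on the icosahedral curve *)

Section IcosahedralSystem.
Variables (R : realType) (e : 'I_3 -> R[i]).
Local Notation C := R[i].
Implicit Types (x y a b c d : C) (U V : C -> C).

Definition ico_B : C := - (2 / 27).

(* The cubic factor of [icoT ^ 2] on the curve [on_ico_curve] below. *)
Hypothesis cubic_e : forall x, 27 * lame_prod e x =
  27 * (x - 2 / 3) ^+ 3 + 54 * (x - 2 / 3) ^+ 2 - 44 * (x - 2 / 3) + 8.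

(** The last two clauses are the first-order system; they let the relations fix the derivatives as
    well as the point of the curve. *)
Definition ico_rel (i : nat) x a b c d : C :=
  match i with
  | 0 => ico a b - (x - 2 / 3)
  | 1 => icoH a b - (20 * (x - 2 / 3) - 8)
  | 2 => 20 * icoT a b * c - (icoH2 a b - 20 * ico2 a b)
  | _ => 20 * icoT a b * d + (icoH1 a b - 20 * ico1 a b)
  end.

Definition on_ico_curve x a b := ico a b = x - 2 / 3 /\ icoH a b = 20 * (x - 2 / 3) - 8.

Lemma ico_curve_square x a b : on_ico_curve x a b ->
  (20 * icoT a b) ^+ 2 = 256 * 100 * 27 * (x - 2 / 3 - 1) ^+ 2 * lame_prod e x.
Proof.
move=> [f1 f2]; rewrite ico_square; last by rewrite f2 f1.
have -> : 256 * 100 * 27 * (x - 2 / 3 - 1) ^+ 2 * lame_prod e x =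
  256 * 100 * (x - 2 / 3 - 1) ^+ 2 * (27 * lame_prod e x).
  by move: (lame_prod e x) => z; ring.
by rewrite f1 cubic_e.
Qed.

Lemma ico_curve_T x a b : on_ico_curve x a b -> ordinary_point e x ->
  x - 2 / 3 - 1 != 0 -> 20 * icoT a b != 0.
Proof.
move=> on ox x1; apply/eqP => T0.
have /eqP := ico_curve_square on; rewrite T0 expr0n /= eq_sym; apply/negP.
have nz n : n.+1%:R != 0 :> C by rewrite pnatr_eq0.
apply: mulf_neq0; last exact: lame_prod_neq0.
by apply: mulf_neq0; [exact: mulf_neq0 (mulf_neq0 (nz 255) (nz 99)) (nz 26)|exact: expf_neq0].
Qed.

Lemma ico_system x0 U V :
  (\forall y \near x0,
     [/\ holomorphic_at U y, holomorphic_at V y & on_ico_curve y (U y) (V y)]) ->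
  ordinary_point e x0 -> x0 - 2 / 3 - 1 != 0 ->
  [/\ local_solution 6^-1 ico_B e x0 U, local_solution 6^-1 ico_B e x0 V,
      wronskian U V x0 != 0 &
      \forall y \near x0, holds_at ico_rel U V y].
Proof.
move=> near_on ox0 x01.
have near_x1 : \forall y \near x0, y - 2 / 3 - 1 != 0.
  have c : {for x0, continuous (fun y : C => y - 2 / 3 - 1)}.
    by apply: hd_continuous; do ! hd_step; exact: hdid.
  exact: cvgr_neq0 c x01.
have near_T : \forall y \near x0, 20 * icoT (U y) (V y) != 0.
  near=> y; have [_ _ on] : [/\ holomorphic_at U y, holomorphic_at V y &
    on_ico_curve y (U y) (V y)] by near: y.
  by apply: (ico_curve_T on); near: y => //; exact: ordinary_near.
(* Cramer's rule for the two differentiated equations, whose determinant is the Jacobian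
   [20 * icoT]. *)
pose kU y := (icoH2 (U y) (V y) - 20 * ico2 (U y) (V y)) / (20 * icoT (U y) (V y)).
pose kV y := - (icoH1 (U y) (V y) - 20 * ico1 (U y) (V y)) / (20 * icoT (U y) (V y)).
have near_hd : \forall y \near x0, has_derivative U y (kU y) /\ has_derivative V y (kV y).
  near=> y.
  have [[a hU] [b hV] _] : [/\ holomorphic_at U y, holomorphic_at V y &
    on_ico_curve y (U y) (V y)] by near: y.
  have on : \forall z \near y, [/\ holomorphic_at U z, holomorphic_at V z &
    on_ico_curve z (U z) (V z)] by near: y; exact: nbhs_interior.
  have T0 : 20 * icoT (U y) (V y) != 0 by near: y.
  have lin1 : ico1 (U y) (V y) * a + ico2 (U y) (V y) * b = 1.
    apply: hd_unique (hd_ico hU hV) _; apply: (@hd_near _ (fun z => z - 2 / 3)).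
      by apply: filterS on => z [_ _ [-> _]].
    by hd_tac; [|exact: hdid]; ring.
  have lin2 : icoH1 (U y) (V y) * a + icoH2 (U y) (V y) * b = 20.
    apply: hd_unique (hd_icoH hU hV) _; apply: (@hd_near _ (fun z => 20 * (z - 2 / 3) - 8)).
      by apply: filterS on => z [_ _ [_ ->]].
    by hd_tac; [|exact: hdid]; ring.
  have aE : a = kU y.
    apply: (mulIf T0); rewrite /kU divfK // -ico_jacobian.
    transitivity (icoH2 (U y) (V y) * (ico1 (U y) (V y) * a + ico2 (U y) (V y) * b)
      - ico2 (U y) (V y) * (icoH1 (U y) (V y) * a + icoH2 (U y) (V y) * b)); first by ring.
    by rewrite lin1 lin2; ring.
  have bE : b = kV y.
    apply: (mulIf T0); rewrite /kV divfK // -ico_jacobian.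
    transitivity (ico1 (U y) (V y) * (icoH1 (U y) (V y) * a + icoH2 (U y) (V y) * b)
      - icoH1 (U y) (V y) * (ico1 (U y) (V y) * a + ico2 (U y) (V y) * b)); first by ring.
    by rewrite lin1 lin2; ring.
  by rewrite -aE -bE.
have near_rel : \forall y \near x0, holds_at ico_rel U V y.
  near=> y.
  have [hU hV] : has_derivative U y (kU y) /\ has_derivative V y (kV y) by near: y.
  have T0 : 20 * icoT (U y) (V y) != 0 by near: y.
  have [_ _ [f1 f2]] : [/\ holomorphic_at U y, holomorphic_at V y &
    on_ico_curve y (U y) (V y)] by near: y.
  case=> [|[|[|i]]] /=; rewrite ?f1 ?f2 ?subrr // ?(hd_deriv hU) ?(hd_deriv hV).
    by rewrite /kU mulrC divfK // subrr.
  by rewrite /kV mulrC divfK // addNr.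
have near_G : \forall y \near x0, has_derivative
    (fun y => 256 * 100 * 27 * (y - 2 / 3 - 1) ^+ 2 * lame_prod e y) y
    (256 * 100 * 27 * (2 * (y - 2 / 3 - 1) * lame_prod e y +
       (y - 2 / 3 - 1) ^+ 2 * lame_dprod e y)).
  near=> y; have := hd_lame_prod e y.
  move: (lame_prod e) (lame_dprod e y) => P P1 hP.
  by hd_tac; [|exact: hdid]; move: (P y) => Py; ring.
split=> //.
- apply: (local_solution_first_order (s := fun y => 20 * icoT (U y) (V y)) _
    (n := fun y => icoH2 (U y) (V y) - 20 * ico2 (U y) (V y)) _ _ near_G) => //.
  + by apply: filterS near_hd => y [].
  + by apply: filterS near_hd => y [hU hV]; exact: hd_icoQ2 hU hV.
  + by apply: filterS near_hd => y [hU hV]; exact: holomorphic_icoT hU hV.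
  + by apply: filterS near_on => y [_ _ /ico_curve_square].
  + near=> y.
    have T0 : 20 * icoT (U y) (V y) != 0 by near: y.
    have y1 : y - 2 / 3 - 1 != 0 by near: y.
    have oy : ordinary_point e y by near: y; exact: ordinary_near.
    have [_ _ on] : [/\ holomorphic_at U y, holomorphic_at V y &
      on_ico_curve y (U y) (V y)] by near: y.
    have [f1 f2] := on.
    have f3 : icoH (U y) (V y) = 20 * ico (U y) (V y) - 8 by rewrite f2 f1.
    have key := ico_ode_x f3; rewrite f1 subrK in key.
    rewrite lame_pE // lame_qE /kU /kV linear_quotient.
    have := first_order_equation (lame_dprod e y) T0 y1 (lame_prod_neq0 oy)
      (ico_curve_square on) key.
    rewrite /ico_B.
    move: (20 * icoT _ _) (icoH12 _ _ - _) (icoH22 _ _ - _) (icoH1 _ _ - _) (icoH2 _ _ - _) (lame_prod e y) (lame_dprod e y) => s h12 h22 h1 h2 P P1.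
    exact.
- apply: (local_solution_first_order (s := fun y => 20 * icoT (U y) (V y)) _
    (n := fun y => - (icoH1 (U y) (V y) - 20 * ico1 (U y) (V y))) _ _ near_G) => //.
  + by apply: filterS near_hd => y [].
  + by apply: filterS near_hd => y [hU hV]; exact: hdN (hd_icoQ1 hU hV).
  + by apply: filterS near_hd => y [hU hV]; exact: holomorphic_icoT hU hV.
  + by apply: filterS near_on => y [_ _ /ico_curve_square].
  + near=> y.
    have T0 : 20 * icoT (U y) (V y) != 0 by near: y.
    have y1 : y - 2 / 3 - 1 != 0 by near: y.
    have oy : ordinary_point e y by near: y; exact: ordinary_near.
    have [_ _ on] : [/\ holomorphic_at U y, holomorphic_at V y &
      on_ico_curve y (U y) (V y)] by near: y.
    have [f1 f2] := on.
    have f3 : icoH (U y) (V y) = 20 * ico (U y) (V y) - 8 by rewrite f2 f1.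
    have key := ico_ode_y f3; rewrite f1 subrK in key.
    rewrite lame_pE // lame_qE /kU /kV linear_quotient_opp.
    have := first_order_equation (lame_dprod e y) T0 y1 (lame_prod_neq0 oy)
      (ico_curve_square on) key.
    rewrite /ico_B.
    move: (20 * icoT _ _) (icoH12 _ _ - _) (icoH11 _ _ - _) (icoH1 _ _ - _) (icoH2 _ _ - _) (lame_prod e y) (lame_dprod e y) => s h12 h11 h1 h2 P P1.
    exact.
- have [hU hV] := nbhs_singleton near_hd.
  have T0 := nbhs_singleton near_T.
  have [_ _ [f1 f2]] := nbhs_singleton near_on.
  rewrite /wronskian (hd_deriv hU) (hd_deriv hV).
  (* Euler's relations turn the numerator into -(20 H - 240 f), which is -160 (f - 1) on the
     line. *)
  have -> : U x0 * kV x0 - V x0 * kU x0 =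
    - (160 * (x0 - 2 / 3 - 1)) / (20 * icoT (U x0) (V x0)).
    transitivity (- ((U x0 * icoH1 (U x0) (V x0) + V x0 * icoH2 (U x0) (V x0))
      - 20 * (U x0 * ico1 (U x0) (V x0) + V x0 * ico2 (U x0) (V x0)))
      / (20 * icoT (U x0) (V x0))); last first.
      by rewrite icoH_euler ico_euler f1 f2; congr (- _ / _); ring.
    rewrite /kU /kV; move: (20 * icoT _ _) (icoH1 _ _) (icoH2 _ _) (ico1 _ _) (ico2 _ _) => s h1 h2 i1 i2.
    ring.
  apply: mulf_neq0; last by rewrite invr_eq0.
  by rewrite oppr_eq0; apply: mulf_neq0 x01; rewrite (pnatr_eq0 _ 160).
Unshelve. all: by end_near. Qed.

End IcosahedralSystem.

(** * Degrees and leading coefficients of the dehomogenized forms *)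

Section PolynomialSize.
Variable F : fieldType.
Implicit Types p q : {poly F}.

Lemma size_add_leq p q n : (size p <= n)%N -> (size q <= n)%N -> (size (p + q)%R <= n)%N.
Proof. by move=> pn qn; rewrite (leq_trans (size_polyD _ _)) // geq_max pn qn. Qed.

Lemma size_opp_leq p n : (size p <= n)%N -> (size (- p)%R <= n)%N.
Proof. by rewrite size_polyN. Qed.

Lemma size_natmul_leq p m n : (size p <= n)%N -> (size (m%:R * p)%R <= n)%N.
Proof.
by rewrite mulr_natl -scaler_nat; apply: leq_trans (size_scale_leq _ _).
Qed.

Lemma size_Xn_leq m n : (m < n)%N -> (size ('X^m : {poly F})%R <= n)%N.
Proof. by rewrite size_polyXn. Qed.

Lemma size_1_leq n : (size (1 : {poly F})%R <= n.+1)%N.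
Proof. by rewrite size_poly1. Qed.

Lemma monic_Xn_add p n : (size p <= n)%N -> ('X^n + p) \is monic.
Proof.
move=> pn; rewrite monicE lead_coefDl ?lead_coefXn // size_polyXn ltnS //.
Qed.

Lemma size_Xn_add p n : (size p <= n)%N -> size ('X^n + p) = n.+1.
Proof. by move=> pn; rewrite size_polyDl size_polyXn. Qed.

End PolynomialSize.

Ltac size_tac := repeat first
  [ apply: size_add_leq | apply: size_opp_leq | apply: size_natmul_leq
  | exact: size_1_leq | exact: size_Xn_leq ].

Section IcosahedralPolynomials.
Variable F : fieldType.
Implicit Types (p q : {poly F}) (w y s : F).

Lemma horner_nat n w : (n%:R : {poly F}).[w] = n%:R.
Proof. by rewrite hornerMn -[1 : {poly F}]/(1%:P) hornerC. Qed.

Lemma horner_ico p q w : (ico p q).[w] = ico p.[w] q.[w].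
Proof.
by rewrite /ico !(horner_exp, horner_nat, hornerD, hornerN, hornerM).
Qed.

Lemma horner_icoH p q w : (icoH p q).[w] = icoH p.[w] q.[w].
Proof.
by rewrite /icoH !(horner_exp, horner_nat, hornerD, hornerN, hornerM).
Qed.

(** The sign is there because [icoH] has leading coefficient -1, while [rational_inverse] asks for a
    monic numerator. *)
Lemma icoH_polyE : - icoH 'X 1 = 'X^20 + (1 - 228 * 'X^15 + 228 * 'X^5 + 494 * 'X^10)
  :> {poly F}.
Proof. by rewrite /icoH !expr1n; ring. Qed.

Lemma ico_polyE : ico 'X 1 = 'X^11 + (11 * 'X^6 - 'X^1) :> {poly F}.
Proof. by rewrite /ico !expr1n; ring. Qed.

Lemma monic_icoH_poly : (- icoH 'X 1) ^+ 3 \is @monic F.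
Proof. by apply: monic_exp; rewrite icoH_polyE; apply: monic_Xn_add; size_tac. Qed.

Lemma size_ico_poly : size (ico 'X 1 : {poly F}) = 12.
Proof. by rewrite ico_polyE size_Xn_add //; size_tac. Qed.

Lemma size_ico_lt : (size ((ico 'X 1 : {poly F}) ^+ 5)%R < size ((- icoH 'X 1 : {poly F}) ^+ 3)%R)%N.
Proof.
have sH : size (- icoH 'X 1 : {poly F}) = 21 by rewrite icoH_polyE size_Xn_add //; size_tac.
have H0 : (- icoH 'X 1 : {poly F}) != 0 by rewrite -size_poly_eq0 sH.
rewrite (@leq_ltn_trans (11 * 5).+1) //.
  by apply: leq_trans (size_poly_exp_leq _ _) _; rewrite size_ico_poly.
by have := size_exp (- icoH 'X 1 : {poly F}) 3; rewrite sH => /(congr1 succn);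
  rewrite prednK ?lt0n ?size_poly_eq0 ?expf_neq0 // => ->.
Qed.

(** Up to powers of [ico] and [icoH], the left side at y = 1 is the numerator of the derivative of
    H^3 / f^5. Away from the zeros of f and H, the critical points are thus the zeros of T. *)
Lemma ico_wronskian w y : 5 * icoH w y * ico1 w y - 3 * ico w y * icoH1 w y = 5 * y * icoT w y.
Proof. rewrite /icoH /ico1 /ico /icoH1 /icoT; ring. Qed.

(** The quotient h^3 / f^5 has degree zero and eliminates [s]; since gcd(12, 20) = 4, what remains
    is s^4 = (s^12)^2 / s^20. *)
Lemma ico_tower (f h Y c s : F) : Y != 0 -> c != 0 -> s != 0 -> f != 0 ->
  (s ^+ 12 * f = Y /\ s ^+ 20 * h = c) <->
  ((- h) ^+ 3 = - (c ^+ 3) / Y ^+ 5 * f ^+ 5 /\ s ^+ 4 = Y ^+ 2 / c * h / f ^+ 2).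
Proof.
move=> Y0 c0 s0 f0; split=> -[h1 h2].
  have h0 : h != 0 by apply: contraNneq c0 => h0; rewrite -h2 h0 mulr0.
  by split; rewrite -h1 -h2; field; rewrite ?s0 ?f0 ?h0.
have h3 : h ^+ 3 = c ^+ 3 / Y ^+ 5 * f ^+ 5.
  by apply: oppr_inj; transitivity ((- h) ^+ 3); [ring|rewrite h1; field].
split.
  transitivity ((s ^+ 4) ^+ 3 * f); first by ring.
  rewrite h2; transitivity (Y ^+ 6 / c ^+ 3 * h ^+ 3 / f ^+ 5).
    by field; rewrite f0 c0.
  by rewrite h3; field; rewrite f0 c0 Y0.
transitivity ((s ^+ 4) ^+ 5 * h); first by ring.
rewrite h2; transitivity (Y ^+ 10 / c ^+ 5 * h ^+ 3 * h ^+ 3 / f ^+ 10).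
  by field; rewrite f0 c0.
by rewrite h3; field; rewrite f0 c0 Y0.
Qed.

End IcosahedralPolynomials.

(** * Local branches of the icosahedral curve *)

Section IcosahedralBranch.
Variables (R : realType) (e : 'I_3 -> R[i]).
Local Notation C := R[i].
Implicit Types (x y a b w s : C).

Hypothesis cubic_e : forall x, 27 * lame_prod e x =
  27 * (x - 2 / 3) ^+ 3 + 54 * (x - 2 / 3) ^+ 2 - 44 * (x - 2 / 3) + 8.

(* The points at which [ico], [icoH] or the square factor of [icoT ^ 2] vanishes
   on the curve. *)
Definition ico_bad : seq C := [:: 2 / 3; 2 / 3 + 2 / 5; 2 / 3 + 1].

Lemma ico_badP x : x \notin ico_bad ->
  [/\ x - 2 / 3 != 0, 20 * (x - 2 / 3) - 8 != 0 & x - 2 / 3 - 1 != 0].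
Proof.
rewrite !inE !negb_or => /and3P[x1 x2 x3]; split.
- by rewrite subr_eq0.
- apply: contraNneq x2 => h; apply/eqP.
  transitivity (2 / 3 + (20 * (x - 2 / 3) - 8 + 8) / 20); first by field.
  by rewrite h; field.
- by rewrite -addrA -opprD subr_eq0.
Qed.

(** The tower of [ico_tower] is fed to [algebraic_branch]; noncriticality of H^3 / f^5 amounts to T
    != 0, which holds over ordinary points outside [ico_bad]. *)
Lemma ico_branch x0 a1 a2 : on_ico_curve x0 a1 a2 -> ordinary_point e x0 ->
  x0 \notin ico_bad -> exists U V : C -> C,
  [/\ U x0 = a1, V x0 = a2 & \forall y \near x0,
     [/\ holomorphic_at U y, holomorphic_at V y & on_ico_curve y (U y) (V y)]].
Proof.
move=> on ox /ico_badP[x1 x2 x3].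
have T0 := ico_curve_T cubic_e on ox x3.
have a20 : a2 != 0.
  apply: contraNneq x1 => a20; have [<- _] := on.
  by rewrite a20 /ico mulr0 mul0r.
pose w0 := a1 / a2.
have a1E : a1 = a2 * w0 by rewrite mulrC divfK.
have a2E : a2 = a2 * 1 by rewrite mulr1.
have [f0 h0] : ico w0 1 != 0 /\ icoH w0 1 != 0.
  have [on1 on2] := on; rewrite a1E {2}a2E ico_hom in on1; rewrite a1E {2}a2E icoH_hom in on2.
  split.
    by apply: contraNneq x1 => h; rewrite -on1 h mulr0.
  by apply: contraNneq x2 => h; rewrite -on2 h mulr0.
have t0 : icoT w0 1 != 0.
  apply: contraNneq T0 => h; by rewrite a1E {2}a2E icoT_hom h !mulr0.
have evf w : (ico 'X 1 : {poly C}).[w] = ico w 1.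
  by rewrite horner_ico hornerX -[1 : {poly C}]/(1%:P) hornerC.
have evh w : (icoH 'X 1 : {poly C}).[w] = icoH w 1.
  by rewrite horner_icoH hornerX -[1 : {poly C}]/(1%:P) hornerC.
have evB w : ((ico 'X 1 : {poly C}) ^+ 5).[w] = ico w 1 ^+ 5 by rewrite horner_exp evf.
have evD w : ((ico 'X 1 : {poly C}) ^+ 2).[w] = ico w 1 ^+ 2 by rewrite horner_exp evf.
have evA w : ((- icoH 'X 1 : {poly C}) ^+ 3).[w] = (- icoH w 1) ^+ 3.
  by rewrite horner_exp hornerN evh.
(* The formal derivative is identified by computing the analytic one in two ways. *)
have dA : ((- icoH 'X 1 : {poly C}) ^+ 3)^`().[w0] = - 3 * icoH w0 1 ^+ 2 * icoH1 w0 1.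
  have h1 := hd_horner ((- icoH 'X 1 : {poly C}) ^+ 3) w0.
  have h2 : has_derivative (fun w => (- icoH w 1) ^+ 3) w0
      (- 3 * icoH w0 1 ^+ 2 * icoH1 w0 1).
    have := hd_icoH (hdid w0) (hdcst w0 1); rewrite mulr0 addr0 mulr1.
    by move: (icoH1 w0 1) => h' hh; hd_tac; ring.
  apply: hd_unique h1 _; apply: hd_near h2.
  by near=> w; rewrite evA.
have dB : ((ico 'X 1 : {poly C}) ^+ 5)^`().[w0] = 5 * ico w0 1 ^+ 4 * ico1 w0 1.
  have h1 := hd_horner ((ico 'X 1 : {poly C}) ^+ 5) w0.
  have h2 : has_derivative (fun w => ico w 1 ^+ 5) w0 (5 * ico w0 1 ^+ 4 * ico1 w0 1).
    have := hd_ico (hdid w0) (hdcst w0 1); rewrite mulr0 addr0 mulr1.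
    by move: (ico1 w0 1) => h' hh; hd_tac; ring.
  apply: hd_unique h1 _; apply: hd_near h2.
  by near=> w; rewrite evB.
have near_x1 : \forall y \near x0, y - 2 / 3 != 0.
  have c : {for x0, continuous (fun y : C => y - 2 / 3)}.
    by apply: hd_continuous; do ! hd_step; exact: hdid.
  exact: cvgr_neq0 c x1.
have near_x2 : \forall y \near x0, 20 * (y - 2 / 3) - 8 != 0.
  have c : {for x0, continuous (fun y : C => 20 * (y - 2 / 3) - 8)}.
    by apply: hd_continuous; do ! hd_step; exact: hdid.
  exact: cvgr_neq0 c x2.
have [||||||||U [V [U0 V0 near_on _]]] := @algebraic_branch R
  ((- icoH 'X 1) ^+ 3) ((ico 'X 1) ^+ 5) (icoH 'X 1) ((ico 'X 1) ^+ 2)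
  (fun y => - ((20 * (y - 2 / 3) - 8) ^+ 3) / (y - 2 / 3) ^+ 5)
  (fun y => (y - 2 / 3) ^+ 2 / (20 * (y - 2 / 3) - 8))
  (@on_ico_curve R) x0 a1 a2 (monic_icoH_poly _) (size_ico_lt _) => //.
- by rewrite evB expf_neq0.
- rewrite evB evA dA dB.
  have -> : ico w0 1 ^+ 5 * (- 3 * icoH w0 1 ^+ 2 * icoH1 w0 1) -
    (- icoH w0 1) ^+ 3 * (5 * ico w0 1 ^+ 4 * ico1 w0 1) =
    ico w0 1 ^+ 4 * icoH w0 1 ^+ 2 * (5 * icoH w0 1 * ico1 w0 1 - 3 * ico w0 1 * icoH1 w0 1).
    by move: (ico w0 1) (icoH w0 1) (ico1 w0 1) (icoH1 w0 1) => f h f1 h1; ring.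
  rewrite ico_wronskian mulr1.
  have nz : (5 : C) != 0 by rewrite (pnatr_eq0 _ 5).
  apply: mulf_neq0 (mulf_neq0 nz t0).
  by apply: mulf_neq0; exact: expf_neq0.
- by rewrite evD expf_neq0.
- near=> y; have y1 : y - 2 / 3 != 0 by near: y.
  apply: holomorphicM; first by eexists; do ! hd_step; exact: hdid.
  apply: holomorphicV; first by rewrite expf_neq0.
  by eexists; do ! hd_step; exact: hdid.
- near=> y; have y2 : 20 * (y - 2 / 3) - 8 != 0 by near: y.
  apply: holomorphicM; first by eexists; do ! hd_step; exact: hdid.
  by apply: holomorphicV => //; eexists; do ! hd_step; exact: hdid.
- near=> y => w s s0; rewrite evD => fw.
  have y1 : y - 2 / 3 != 0 by near: y.
  have y2 : 20 * (y - 2 / 3) - 8 != 0 by near: y.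
  have fw0 : ico w 1 != 0 by apply: contraNneq fw => ->; rewrite expr0n.
  rewrite /on_ico_curve [w * s]mulrC -{2 4}[s]mulr1 ico_hom icoH_hom evA evB evh.
  exact: ico_tower.
by exists U, V; split.
Unshelve. all: by end_near. Qed.
End IcosahedralBranch.

(** * Forms preserved by monodromy matrices *)

Section MonodromyInvariance.
Variables (R : realType) (l B : R[i]) (e : 'I_3 -> R[i]).
Local Notation C := R[i].
Implicit Types (x : C) (M : 'M[C]_2).

Lemma ord2_sum (V : nmodType) (F : 'I_2 -> V) : \sum_i F i = F 0 + F 1.
Proof.
by rewrite !big_ord_recr big_ord0 /= add0r; congr (F _ + F _); apply: val_inj.
Qed.

(** A nonzero [p] is a power of X - u(P)/v(P) times a factor that does not vanish near u(P)/v(P).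
    Vanishing along u/v would then make u/v constant near [P], against independence. *)
Lemma ratio_vanish (u v : C -> C) (P : C) (p : {poly C}) :
  {for P, continuous u} -> {for P, continuous v} -> v P != 0 ->
  (forall a b : C, (\forall x \near P, a * u x + b * v x = 0) -> a = 0) ->
  (\forall x \near P, p.[u x / v x] = 0) -> p = 0.
Proof.
move=> cu cv vP indep pw; apply/eqP; apply: contraT => pn0.
have [m [q]] := multiplicity_XsubC p (u P / v P).
rewrite pn0 /= => qw pE.
have cw : {for P, continuous (fun x => u x / v x)} by exact: cntM cu (cntV vP cv).
have cq : {for P, continuous (fun x => q.[u x / v x])}.
  exact: (cvg_comp _ _ cw (@continuous_horner_num C q _)).
have near_q : \forall x \near P, q.[u x / v x] != 0 by exact: cvgr_neq0 cq qw.
have near_v : \forall x \near P, v x != 0 by exact: cvgr_neq0 cv vP.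
have : \forall x \near P, 1 * u x + - (u P / v P) * v x = 0.
  near=> x.
  have qx : q.[u x / v x] != 0 by near: x.
  have vx : v x != 0 by near: x.
  have : p.[u x / v x] = 0 by near: x.
  rewrite pE hornerM horner_exp hornerXsubC => /eqP.
  rewrite mulf_eq0 (negPf qx) expf_eq0 /= => /andP[_].
  by rewrite subr_eq0 => /eqP <-; rewrite mul1r mulNr divfK // subrr.
by move=> /indep/eqP; rewrite oner_eq0.
Unshelve. all: by end_near. Qed.

(** Near [P] the ratio u/v is not constant, so by [ratio_vanish] an identity along the solutions is
    an identity of polynomials. *)
Lemma preserves_near (form : C -> C -> C) (pform : {poly C} -> {poly C} -> {poly C})
    (n : nat) (u v : C -> C) (P : C) M :
  (forall p q w, (pform p q).[w] = form p.[w] q.[w]) ->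
  (forall k a b, form (k * a) (k * b) = k ^+ n * form a b) ->
  {for P, continuous u} -> {for P, continuous v} -> v P != 0 ->
  (forall a b : C, (\forall x \near P, a * u x + b * v x = 0) -> a = 0) ->
  (\forall x \near P, form (rowl M (u x) (v x)) (rowr M (u x) (v x)) = form (u x) (v x)) ->
  preserves form M.
Proof.
move=> hornerF homF cu cv vP indep inv.
apply: (preserves_poly hornerF homF); apply/eqP; rewrite -subr_eq0; apply/eqP.
apply: (ratio_vanish cu cv vP indep).
have near_v : \forall x \near P, v x != 0 by exact: cvgr_neq0 cv vP.
near=> x.
have vx : v x != 0 by near: x.
have invx : form (rowl M (u x) (v x)) (rowr M (u x) (v x)) = form (u x) (v x) by near: x.
rewrite hornerD hornerN !hornerF -[1 : {poly C}]/(1%:P).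
rewrite !(hornerD, hornerM, hornerC, hornerX).
apply: (mulfI (expf_neq0 n vx)); rewrite mulr0 mulrBr -!homF mulr1.
apply/eqP; rewrite subr_eq0; apply/eqP.
have -> : v x * (u x / v x) = u x by rewrite mulrC divfK.
rewrite -[in RHS]invx; congr (form _ _); rewrite /rowl /rowr; field; exact: vx.
Unshelve. all: by end_near. Qed.

Section Persistent.
Variables (I : Type) (rho : I -> C -> C -> C -> C -> C -> C) (bad : seq C).

Hypothesis rho_continuous : forall i (f1 f2 f3 f4 : C -> C) x,
  {for x, continuous f1} -> {for x, continuous f2} ->
  {for x, continuous f3} -> {for x, continuous f4} ->
  {for x, continuous (fun y => rho i y (f1 y) (f2 y) (f3 y) (f4 y))}.

Hypothesis rho_branch : forall x a1 a2 d1 d2,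
  ordinary_point e x -> x \notin bad -> (forall i, rho i x a1 a2 d1 d2 = 0) ->
  exists u v, [/\ local_solution l B e x u /\ local_solution l B e x v,
    u x = a1 /\ v x = a2, deriv u x = d1 /\ deriv v x = d2,
    wronskian u v x != 0 & \forall y \near x, holds_at rho u v y].

Lemma monodromy_holds (P : C) (u : 'I_2 -> C -> C) M :
  (\forall x \near P, holds_at rho (u 0) (u 1) x) ->
  monodromy_group l B e P u M ->
  \forall x \near P, holds_at rho (fun y => rowl M (u 0 y) (u 1 y))
                                  (fun y => rowr M (u 0 y) (u 1 y)) x.
Proof.
move=> hu [_ [g [loop_g [F Fj]]]].
have [c0 s0 t0] := Fj 0; have [c1 s1 t1] := Fj 1.
have start : \forall x \near P, holds_at rho (F 0 0) (F 1 0) x.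
  apply: near_holds_at hu.
    by apply: filterS s0 => x ->.
  by apply: filterS s1 => x ->.
have fin := relation_persists rho_continuous rho_branch loop_g c0 c1 start.
apply: near_holds_at fin.
  by apply: filterS t0 => x ->; rewrite ord2_sum.
by apply: filterS t1 => x ->; rewrite ord2_sum.
Qed.

End Persistent.

Lemma wronskian_independent (P : C) (u v : C -> C) (a b : C) :
  local_solution l B e P u -> local_solution l B e P v -> wronskian u v P != 0 ->
  (\forall x \near P, a * u x + b * v x = 0) -> a = 0 /\ b = 0.
Proof.
move=> /local_solutionP/nbhs_singleton[du _] /local_solutionP/nbhs_singleton[dv _] w0 h.
have h0 := nbhs_singleton h.
have h1 : a * deriv u P + b * deriv v P = 0.
  have d1 := hdD (hdM (hdcst P a) du) (hdM (hdcst P b) dv).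
  have d2 : has_derivative (fun x => a * u x + b * v x) P 0.
    by apply: (@hd_near _ (fun=> 0)); [apply: filterS h => x ->|exact: hdcst].
  by have := hd_unique d1 d2; rewrite !mulr0 !addr0.
split; apply/eqP; [have : a * wronskian u v P = 0|have : b * wronskian u v P = 0].
- transitivity ((a * u P + b * v P) * deriv v P - v P * (a * deriv u P + b * deriv v P)).
    by rewrite /wronskian; ring.
  by rewrite h0 h1 mul0r mulr0 subrr.
- by move=> /eqP; rewrite mulf_eq0 (negPf w0) orbF.
- transitivity (u P * (a * deriv u P + b * deriv v P) - (a * u P + b * v P) * deriv u P).
    by rewrite /wronskian; ring.
  by rewrite h0 h1 mul0r mulr0 subrr.
- by move=> /eqP; rewrite mulf_eq0 (negPf w0) orbF.
Qed.

Definition basis2 (u v : C -> C) (j : 'I_2) : C -> C := if j == 0 then u else v.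

Lemma local_basis2 (P : C) (u v : C -> C) :
  local_solution l B e P u -> local_solution l B e P v -> wronskian u v P != 0 ->
  local_basis l B e P (basis2 u v).
Proof.
move=> su sv w0; split; first by move=> j; rewrite /basis2; case: ifP.
move=> c hc.
have [] := @wronskian_independent P u v (c 0) (c 1) su sv w0.
  by apply: filterS hc => x; rewrite ord2_sum.
by move=> c0 c1 j; have [->|->] := ord2P j.
Qed.

End MonodromyInvariance.

Ltac cnt_step := match goal with
  | H : {for ?x, continuous ?f} |- {for ?x, continuous ?f} => exact H
  | H : {for ?x, continuous ?f} |- {for ?x, continuous (fun y => ?f y)} => exact H
  | |- {for _, continuous (fun _ => ?c)} => refine (@cntc _ _ _ _)
  | |- {for _, continuous (fun y => @Algebra.add _ (@?f y) (@?g y))} => refine (@cntD _ _ _ f g _ _)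
  | |- {for _, continuous (fun y => @Algebra.opp _ (@?f y))} => refine (@cntN _ _ _ f _)
  | |- {for _, continuous (fun y => @GRing.mul _ (@?f y) (@?g y))} => refine (@cntM _ _ _ f g _ _)
  | |- {for _, continuous (fun y => @GRing.exp _ (@?f y) ?n)} => refine (@cntX _ _ _ f n _)
  | |- {for _, continuous (fun y => y)} => exact: cvg_id
  end.

Lemma cube_quotient (F : fieldType) (k c m : F) : k != 0 -> c != 0 ->
  m ^+ 3 = - (c ^+ 3) / - (k * c ^+ 3) * (k * m ^+ 3).
Proof.
move=> k0 c0; have kc0 : k * c ^+ 3 != 0 by rewrite mulf_neq0 ?expf_neq0.
rewrite invrN mulrNN; transitivity (k * c ^+ 3 / (k * c ^+ 3) * m ^+ 3).
  by rewrite divff // mul1r.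
by rewrite [k * _]mulrC; ring.
Qed.

Lemma lame_prod_ordinary (R : realType) (e : 'I_3 -> R[i]) (x : R[i]) :
  lame_prod e x != 0 -> ordinary_point e x.
Proof.
move=> P0 i xe; move/eqP: P0; apply.
rewrite -[lame_prod e x](ord3_prod (fun i => x - e i)) (bigD1 i) //= xe subrr.
by rewrite mul0r.
Qed.

(** * Relations and base point for the icosahedral continuation *)

Section IcosahedralMonodromy.
Variables (R : realType) (e : 'I_3 -> R[i]).
Local Notation C := R[i].
Implicit Types (x y a b : C) (M : 'M[C]_2).

Hypothesis cubic_e : forall x, 27 * lame_prod e x =
  27 * (x - 2 / 3) ^+ 3 + 54 * (x - 2 / 3) ^+ 2 - 44 * (x - 2 / 3) + 8.

Lemma ico_rel_continuous i (f1 f2 f3 f4 : C -> C) x :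
  {for x, continuous f1} -> {for x, continuous f2} ->
  {for x, continuous f3} -> {for x, continuous f4} ->
  {for x, continuous (fun y => ico_rel i y (f1 y) (f2 y) (f3 y) (f4 y))}.
Proof.
move=> c1 c2 c3 c4; case: i => [|[|[|i]]]; rewrite /ico_rel.
- by rewrite /ico; repeat cnt_step.
- by rewrite /icoH; repeat cnt_step.
- by rewrite /icoT /icoH2 /ico2; repeat cnt_step.
- by rewrite /icoT /icoH1 /ico1; repeat cnt_step.
Qed.

Lemma ico_rel_curve x a b c d : (forall i, ico_rel i x a b c d = 0) -> on_ico_curve x a b.
Proof.
move=> h; split; apply/eqP; rewrite -subr_eq0; apply/eqP; [exact: (h 0%N)|exact: (h 1%N)].
Qed.

Lemma ico_rel_branch x a1 a2 d1 d2 :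
  ordinary_point e x -> x \notin @ico_bad R -> (forall i, ico_rel i x a1 a2 d1 d2 = 0) ->
  exists u v, [/\ local_solution 6^-1 (ico_B R) e x u /\ local_solution 6^-1 (ico_B R) e x v,
    u x = a1 /\ v x = a2, deriv u x = d1 /\ deriv v x = d2,
    wronskian u v x != 0 & \forall y \near x, holds_at (@ico_rel R) u v y].
Proof.
move=> ox xb rel; have on := ico_rel_curve rel.
have [_ _ x1] := ico_badP xb; have T0 := ico_curve_T cubic_e on ox x1.
have [U [V [Ux Vx near_on]]] := ico_branch cubic_e on ox xb.
have [sU sV w0 near_rel] := ico_system cubic_e near_on ox x1.
exists U, V; split=> //.
have h := nbhs_singleton near_rel.
have := h 2%N; have := h 3%N; have := rel 2%N; have := rel 3%N; rewrite /= Ux Vx.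
move=> /eqP; rewrite addr_eq0 => /eqP r3 /eqP; rewrite subr_eq0 => /eqP r2.
move=> /eqP; rewrite addr_eq0 => /eqP h3 /eqP; rewrite subr_eq0 => /eqP h2.
by split; apply: (mulfI T0); [rewrite h2 r2|rewrite h3 r3].
Qed.

(** Multiplied by the square root [20 * icoT], the Wronskian depends on x alone. Comparing it before
    and after continuation gives the determinant of the monodromy matrix up to sign. *)
Lemma ico_rel_wronskian x a b c d : (forall i, ico_rel i x a b c d = 0) ->
  (a * d - b * c) * (20 * icoT a b) = - (160 * (x - 2 / 3 - 1)).
Proof.
move=> rel; have [f1 f2] := ico_rel_curve rel.
have := rel 2%N; have := rel 3%N; rewrite /=.
move=> /eqP; rewrite addr_eq0 => /eqP r3 /eqP; rewrite subr_eq0 => /eqP r2.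
transitivity (a * (20 * icoT a b * d) - b * (20 * icoT a b * c)); first by ring.
rewrite r3 r2; transitivity (- ((a * icoH1 a b + b * icoH2 a b)
   - 20 * (a * ico1 a b + b * ico2 a b))); first by ring.
by rewrite icoH_euler ico_euler f1 f2; ring.
Qed.

(** The point is sought on the line a = b, where f, H, T are 11 s^12, -496 s^20 and -20008 s^30.
    Eliminating [s] leaves one polynomial equation in Y = x - 2/3, and T != 0 then keeps the point
    off the singularities and the zero of Y - 1. *)
Lemma ico_basepoint : exists P s, [/\ s != 0, on_ico_curve P s s,
  ordinary_point e P & P \notin @ico_bad R].
Proof.
pose k : C := 11 ^+ 5 / 496 ^+ 3.
have n496 : (496 : C) != 0 by rewrite (pnatr_eq0 _ 496).
have n11 : (11 : C) != 0 by rewrite (pnatr_eq0 _ 11).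
have k0 : k != 0 by rewrite /k; apply: mulf_neq0; [exact: expf_neq0|rewrite invr_eq0 expf_neq0].
pose g : {poly C} := 'X^5 + k *: (20 * 'X^1 - 8 * 1) ^+ 3.
have sg : size g != 1.
  rewrite /g size_Xn_add //; apply: leq_trans (size_scale_leq _ _) _.
  apply: leq_trans (size_poly_exp_leq _ _) _.
  have : (size (20 * 'X^1 - 8 * 1 : {poly C})%R <= 2)%N by size_tac.
  by case: (size _) => [|[|[|n]]].
have /closed_rootP[Y /rootP] := sg.
rewrite /g hornerD hornerXn hornerZ horner_exp hornerD hornerN !hornerM !horner_nat hornerXn.
rewrite -[1 : {poly C}]/(1%:P) hornerC expr1 mulr1 => /eqP; rewrite addr_eq0 => /eqP YE.
have Y0 : Y != 0.
  apply/eqP => Y0; move: YE; rewrite Y0 mulr0 sub0r expr0n /= => /esym/eqP.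
  rewrite oppr_eq0 mulf_eq0 (negPf k0) /= expf_eq0 /= oppr_eq0.
  by rewrite (pnatr_eq0 _ 8).
have c0 : 20 * Y - 8 != 0.
  by apply: contraNneq Y0 => c0; move/eqP: YE; rewrite c0 expr0n mulr0 oppr0 expf_eq0.
have f11 : ico 1 1 = 11 :> C by rewrite /ico; ring.
have h11 : icoH 1 1 = - 496 :> C by rewrite /icoH; ring.
have t11 : icoT 1 1 = - (2501 * 8) :> C by rewrite /icoT; ring.
pose z : C := Y ^+ 2 / (20 * Y - 8) * (- 496) / 11 ^+ 2.
have z0 : z != 0.
  rewrite /z; apply: mulf_neq0; last by rewrite invr_eq0 expf_neq0.
  apply: mulf_neq0; last by rewrite oppr_eq0.
  by apply: mulf_neq0; [exact: expf_neq0|rewrite invr_eq0].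
pose s := sqrtC (sqrtC z).
have s4 : s ^+ 4 = z by rewrite (exprM s 2 2) sqrtCK sqrtCK.
have s0 : s != 0 by apply: contraNneq z0 => s0; rewrite -s4 s0 expr0n.
exists (Y + 2 / 3), s.
have on : on_ico_curve (Y + 2 / 3) s s.
  rewrite /on_ico_curve addrK -{1 2 3 4}[s]mulr1 ico_hom icoH_hom f11 h11.
  apply: (ico_tower (- 496) Y0 c0 s0 n11).2; split; last exact: s4.
  have YkE : Y ^+ 5 = - (k * (20 * Y - 8) ^+ 3) := YE.
  have kE : k * 496 ^+ 3 = 11 ^+ 5.
    by rewrite /k (divfK (expf_neq0 3 n496)).
  rewrite opprK YkE -kE.
  exact: cube_quotient.
have T0 : icoT s s != 0.
  rewrite -{1 2}[s]mulr1 icoT_hom t11; apply: mulf_neq0; first exact: expf_neq0.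
  by rewrite oppr_eq0; apply: mulf_neq0; [rewrite (pnatr_eq0 _ 2501)|rewrite (pnatr_eq0 _ 8)].
have : (20 * icoT s s) ^+ 2 != 0.
  by apply: expf_neq0; apply: mulf_neq0 T0; rewrite (pnatr_eq0 _ 20).
rewrite (ico_curve_square cubic_e on) addrK mulf_eq0 negb_or => /andP[].
rewrite mulf_eq0 negb_or => /andP[_ Y1] P0.
split; [exact: s0|exact: on| |].
  exact: lame_prod_ordinary P0.
have n20 : (20 : C) != 0 by rewrite (pnatr_eq0 _ 20).
rewrite !inE !negb_or; apply/and3P; split.
- by rewrite -subr_eq0 addrK.
- apply: contraNneq c0 => h; apply/eqP.
  transitivity (20 * (Y + 2 / 3 - 2 / 3) - 8); first by rewrite addrK.
  by rewrite h; field.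
- apply: contraNneq Y1 => h; apply/eqP.
  by have -> : Y = 1; [apply: (addIr (2 / 3)); rewrite h addrC|rewrite subrr expr0n].
Qed.

End IcosahedralMonodromy.

(** * Matrices preserving the icosahedral form have no projective order four *)

Section NoElementOfOrderFour.
Variable R : realType.
Local Notation C := R[i].
Implicit Types (a b c k t x y : C) (M N : 'M[C]_2).

Lemma mul22E M N i j : (M *m N) i j = M i 0 * N 0 j + M i 1 * N 1 j.
Proof. by rewrite mxE ord2_sum. Qed.

Lemma scalar22P M : M 0 1 = 0 -> M 1 0 = 0 -> M 0 0 = M 1 1 -> M = (M 0 0)%:M.
Proof.
move=> h01 h10 h; apply/matrixP => i j; rewrite mxE.
by have [->|->] := ord2P i; have [->|->] := ord2P j; rewrite ?h01 ?h10 -?h ?mulr1n.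
Qed.

Lemma cayley_hamilton22 M :
  M *m M = (M 0 0 + M 1 1) *: M - (M 0 0 * M 1 1 - M 0 1 * M 1 0)%:M.
Proof.
apply/matrixP => i j; rewrite mul22E !mxE.
by have [->|->] := ord2P i; have [->|->] := ord2P j; rewrite ?mulr1n ?mulr0n; ring.
Qed.

(** The form has no multiple root. Once the factors y and x are removed, the partial derivatives are
    quadratic in X = x^5 and Y = y^5, and their difference is 10 (X^2 + Y^2). *)
Lemma ico_critical x y : ico1 x y = 0 -> ico2 x y = 0 -> x = 0 /\ y = 0.
Proof.
move=> h1 h2.
have e1 : y * (11 * (x ^+ 5) ^+ 2 + 66 * x ^+ 5 * y ^+ 5 - (y ^+ 5) ^+ 2) = 0.
  by rewrite -h1 /ico1; ring.
have e2 : x * ((x ^+ 5) ^+ 2 + 66 * x ^+ 5 * y ^+ 5 - 11 * (y ^+ 5) ^+ 2) = 0.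
  by rewrite -h2 /ico2; ring.
have [x0|x0] := eqVneq x 0.
  split=> //; move: h1; rewrite x0 /ico1 !expr0n !(mul0r, mulr0) !add0r => /eqP.
  by rewrite oppr_eq0 expf_eq0 => /andP[_ /eqP].
have [y0|y0] := eqVneq y 0.
  by move: h2; rewrite y0 /ico2 !expr0n !(mul0r, mulr0) subr0 addr0 => /eqP;
    rewrite expf_eq0 /= (negPf x0).
have x5 : x ^+ 5 != 0 by rewrite expf_neq0.
have y5 : y ^+ 5 != 0 by rewrite expf_neq0.
move/eqP: e1; rewrite mulf_eq0 (negPf y0) /= => /eqP e1.
move/eqP: e2; rewrite mulf_eq0 (negPf x0) /= => /eqP e2.
move: (x ^+ 5) (y ^+ 5) x5 y5 e1 e2 => X Y X0 Y0 e1 e2.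
exfalso; move: (Y0) => /eqP; apply.
have n (m : nat) : m.+1%:R != 0 :> C by rewrite pnatr_eq0.
have sq : X ^+ 2 = - Y ^+ 2.
  apply: (mulfI (n 9)); transitivity ((11 * X ^+ 2 + 66 * X * Y - Y ^+ 2)
    - (X ^+ 2 + 66 * X * Y - 11 * Y ^+ 2) + 10 * (- Y ^+ 2)); first by ring.
  by rewrite e1 e2 subr0 add0r.
have lin : 11 * X = 2 * Y.
  apply: (mulfI (n 5)); apply: (mulIf Y0).
  transitivity ((11 * X ^+ 2 + 66 * X * Y - Y ^+ 2) - 11 * X ^+ 2 + Y ^+ 2); first by ring.
  by rewrite e1 sq; ring.
suff /eqP : Y ^+ 2 = 0 by rewrite expf_eq0 => /andP[_ /eqP].
apply: (mulfI (n 124)); transitivity ((2 * Y) ^+ 2 - 121 * (- Y ^+ 2)); first by ring.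
by rewrite -lin -sq; ring.
Qed.

(* An eigenvector [p] of [M] would be a root of the icosahedral form, and the
   eigenvalue on the other eigenline forces it to be a multiple root. *)
Lemma ico_eigen_absurd M (a k p1 p2 q1 q2 : C) :
  preserves (@ico C) M -> a ^+ 4 = -1 -> k ^+ 2 = -1 ->
  (p1, p2) != 0 -> (q1, q2) != 0 ->
  rowl M p1 p2 = a * p1 -> rowr M p1 p2 = a * p2 ->
  rowl M q1 q2 = - k * a * q1 -> rowr M q1 q2 = - k * a * q2 -> False.
Proof.
move=> pM a4 k2 p0 q0 lp rp lq rq.
have n2 : (2 : C) != 0 by rewrite (pnatr_eq0 _ 2).
have a12 : a ^+ 12 = -1 by rewrite (exprM a 4 3) a4; ring.
have a0 : a != 0.
  apply/eqP => a0; move/eqP: a4; rewrite a0 expr0n /= eq_sym oppr_eq0.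
  by rewrite oner_eq0.
have k1 : k != 1.
  apply/eqP => k1; move/eqP: k2; rewrite k1 expr1n -subr_eq0 opprK.
  by rewrite -(natrD _ 1 1) (pnatr_eq0 _ 2).
have fp : ico p1 p2 = 0.
  have := pM p1 p2; rewrite lp rp ico_hom a12 mulN1r => /eqP.
  rewrite eq_sym -subr_eq0 opprK -mulr2n -mulr_natl mulf_eq0 (negPf n2) /=.
  by move=> /eqP.
(* Along p + t q, the matrix scales p by a and q by -k a; as a^12 = -1, this gives g(t) = -g(-k t).
   Differentiating at 0 yields g'(0) = k g'(0) with k != 1. *)
pose g t := ico (p1 + t * q1) (p2 + t * q2).
have gE t : g t = - g (- k * t).
  rewrite /g -pM.
  have -> : rowl M (p1 + t * q1) (p2 + t * q2) = a * (p1 + (- k * t) * q1).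
    transitivity (rowl M p1 p2 + t * rowl M q1 q2); first by rewrite /rowl; ring.
    by rewrite lp lq; ring.
  have -> : rowr M (p1 + t * q1) (p2 + t * q2) = a * (p2 + (- k * t) * q2).
    transitivity (rowr M p1 p2 + t * rowr M q1 q2); first by rewrite /rowr; ring.
    by rewrite rp rq; ring.
  by rewrite ico_hom a12 mulN1r.
pose D := ico1 p1 p2 * q1 + ico2 p1 p2 * q2.
have dg : has_derivative g 0 D.
  have l1 : has_derivative (fun t => p1 + t * q1) 0 q1.
    by hd_tac; [|exact: hdid]; ring.
  have l2 : has_derivative (fun t => p2 + t * q2) 0 q2.
    by hd_tac; [|exact: hdid]; ring.
  by have := hd_ico l1 l2; rewrite !mul0r !addr0.
have dg' : has_derivative (fun t => - g (- k * t)) 0 (k * D).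
  have dl : has_derivative (fun t => - k * t) (0 : C) (- k).
    by hd_tac; [|exact: hdid]; ring.
  have dg0 : has_derivative g (- k * 0) D by rewrite mulr0.
  apply: hd_ext (hdN (hd_comp dl dg0)); ring.
have D0 : D = 0.
  have gg : g = fun t => - g (- k * t) by apply/funext => t; exact: gE.
  have e : D = k * D by move: dg; rewrite gg => dg; exact: hd_unique dg dg'.
  have /eqP : (1 - k) * D = 0 by rewrite mulrBl mul1r -e subrr.
  by rewrite mulf_eq0 subr_eq0 eq_sym (negPf k1) /= => /eqP.
have E0 : p1 * ico1 p1 p2 + p2 * ico2 p1 p2 = 0 by rewrite ico_euler fp mulr0.
(* Eigenvectors for the distinct eigenvalues a and -k a are independent, so derivatives vanishing
   along both p (by Euler) and q make the gradient vanish. *)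
have pq : p1 * q2 - p2 * q1 != 0.
  apply/eqP => pq.
  have pq' : p1 * q2 = p2 * q1 by apply/eqP; rewrite -subr_eq0 pq.
  have nz : (1 + k) * a != 0.
    apply: mulf_neq0 => //; apply/eqP => kN.
    have kE : k = -1 by apply/eqP; rewrite -addr_eq0 addrC kN.
    move/eqP: k2; rewrite kE sqrrN expr1n -subr_eq0 opprK.
    by rewrite -(natrD _ 1 1) (pnatr_eq0 _ 2).
  have e11 : (1 + k) * a * (p1 * q1) = 0.
    transitivity (q1 * (a * p1) - p1 * (- k * a * q1)); first by ring.
    rewrite -lp -lq /rowl; transitivity (M 1 0 * (p2 * q1 - p1 * q2)); first by ring.
    by rewrite pq' subrr mulr0.
  have e22 : (1 + k) * a * (p2 * q2) = 0.
    transitivity (q2 * (a * p2) - p2 * (- k * a * q2)); first by ring.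
    rewrite -rp -rq /rowr; transitivity (M 0 1 * (p1 * q2 - p2 * q1)); first by ring.
    by rewrite pq' subrr mulr0.
  have /eqP := e11; rewrite mulf_eq0 (negPf nz) mulf_eq0 /= => /orP[] /eqP h1.
    have p20 : p2 != 0 by apply/eqP => h2; move/eqP: p0; apply; rewrite h1 h2.
    have /eqP := e22; rewrite mulf_eq0 (negPf nz) mulf_eq0 (negPf p20) /= => /eqP h2.
    move/eqP: pq'; rewrite h1 mul0r eq_sym mulf_eq0 (negPf p20) /= => /eqP h3.
    by move/eqP: q0; apply; rewrite h2 h3.
  have q20 : q2 != 0 by apply/eqP => h2; move/eqP: q0; apply; rewrite h1 h2.
  have /eqP := e22; rewrite mulf_eq0 (negPf nz) mulf_eq0 (negPf q20) orbF /= => /eqP h2.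
  move/eqP: pq'; rewrite h1 mulr0 mulf_eq0 (negPf q20) orbF => /eqP h3.
  by move/eqP: p0; apply; rewrite h2 h3.
have c1 : ico1 p1 p2 = 0.
  apply: (mulIf pq); rewrite mul0r.
  transitivity (q2 * (p1 * ico1 p1 p2 + p2 * ico2 p1 p2) - p2 * D); first by rewrite /D; ring.
  by rewrite E0 D0 !mulr0 subrr.
have c2 : ico2 p1 p2 = 0.
  apply: (mulIf pq); rewrite mul0r.
  transitivity (p1 * D - q1 * (p1 * ico1 p1 p2 + p2 * ico2 p1 p2)); first by rewrite /D; ring.
  by rewrite E0 D0 !mulr0 subrr.
have [p10 p20] := ico_critical c1 c2.
by move/eqP: p0; apply; rewrite p10 p20.
Qed.

(** By Cayley-Hamilton (M - b)(M - a) = 0, so each row of M - b is an eigenvector for a, and one row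
    is nonzero unless M = b. *)
Lemma eigen_rows M a b : a + b = M 0 0 + M 1 1 ->
  a * b = M 0 0 * M 1 1 - M 0 1 * M 1 0 -> M != b%:M ->
  exists p1 p2, [/\ (p1, p2) != 0, rowl M p1 p2 = a * p1 & rowr M p1 p2 = a * p2].
Proof.
move=> ab1 ab2 Mb.
have aE : a = M 0 0 + M 1 1 - b by rewrite -ab1 addrK.
have quad : (M 0 0 - b) * (M 1 1 - b) = M 0 1 * M 1 0.
  transitivity (a * b - (a + b) * b + b ^+ 2 + M 0 1 * M 1 0); last by ring.
  by rewrite ab1 ab2; ring.
have [r1|r1] := eqVneq (M 0 0 - b, M 0 1) 0; last first.
  exists (M 0 0 - b), (M 0 1); split=> //; rewrite /rowl /rowr aE.
    transitivity ((M 0 0 - b) * M 0 0 + (M 0 0 - b) * (M 1 1 - b)); last by ring.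
    by rewrite quad.
  by ring.
have [r2|r2] := eqVneq (M 1 0, M 1 1 - b) 0; last first.
  exists (M 1 0), (M 1 1 - b); split=> //; rewrite /rowl /rowr aE.
    by ring.
  transitivity ((M 0 0 - b) * (M 1 1 - b) + (M 1 1 - b) * M 1 1); last by ring.
  by rewrite quad [M 1 0 * _]mulrC.
case: r1 => /eqP; rewrite subr_eq0 => /eqP m00 m01.
case: r2 => m10 /eqP; rewrite subr_eq0 => /eqP m11.
by move/eqP: Mb; case; rewrite [M]scalar22P ?m00 ?m11.
Qed.

(** With trace t and determinant d, M^4 is t (t^2 - 2 d) M plus a scalar. So M is scalar, or t = 0
    and M^2 is scalar, or t^2 = 2 d. In the last case the eigenvalues are t (1 + i)/2 and t (1 -
    i)/2, with ratio a fourth root of unity and fourth power -d^2 = -1; this is refuted by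
    [ico_eigen_absurd]. *)
Lemma ico_no_order4 M c : preserves (@ico C) M -> \det M ^+ 2 = 1 ->
  (M *m M) *m (M *m M) = c%:M -> exists k, M *m M = k%:M.
Proof.
move=> pM; rewrite det22E; set d := _ - _ => d2 M4.
set t := M 0 0 + M 1 1.
have M2 : M *m M = t *: M - d%:M := cayley_hamilton22 M.
have [t0|t0] := eqVneq t 0.
  by exists (- d); rewrite M2 t0 scale0r sub0r raddfN.
have M4' : c%:M = (t * (t ^+ 2 - 2 * d)) *: M + (d ^+ 2 - t ^+ 2 * d)%:M.
  rewrite -M4 {1}M2 mulmxBl mul_scalar_mx -scalemxAl {1}M2 mulmxBr mul_mx_scalar -scalemxAr M2.
  by apply/matrixP => i j; rewrite !mxE; case: (i == j); rewrite ?mulr1n ?mulr0n; ring.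
have [s0|s0] := eqVneq (t * (t ^+ 2 - 2 * d)) 0; last first.
  have entry i j := congr1 (fun N : 'M[C]_2 => N i j) M4'.
  have offdiag (i j : 'I_2) : i != j -> M i j = 0.
    move=> /negPf ij; have /= := entry i j; rewrite !mxE ij !mulr0n addr0 => /esym/eqP.
    by rewrite mulf_eq0 (negPf s0) /= => /eqP.
  have diag : M 0 0 = M 1 1.
    have /= := entry 0 0; have /= := entry 1 1; rewrite !mxE !eqxx !mulr1n => -> /addIr.
    by move=> /(mulfI s0).
  have -> : M = (M 0 0)%:M by apply: scalar22P => //; exact: offdiag.
  by exists (M 0 0 * M 0 0); rewrite mul_scalar_mx scale_scalar_mx.
have t2 : t ^+ 2 = 2 * d.
  by move/eqP: s0; rewrite mulf_eq0 (negPf t0) /= subr_eq0 => /eqP.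
have [[k kE]|nonscalar] := pselect (exists k, M = k%:M).
  by exists (k * k); rewrite kE mul_scalar_mx scale_scalar_mx.
have nsc b : M != b%:M by apply/eqP => Mb; apply: nonscalar; exists b.
pose w : C := 'i%C; have w2 : w ^+ 2 = -1 := sqr_i R.
have n2 : (2 : C) != 0 by rewrite (pnatr_eq0 _ 2).
pose a := t * (1 + w) / 2; pose b := t * (1 - w) / 2.
have ab1 : a + b = t by rewrite /a /b; field.
have ab2 : a * b = d.
  apply: (mulfI n2); rewrite -t2 /a /b.
  transitivity (t ^+ 2 * (1 - w ^+ 2) / 2); first by field.
  by rewrite w2; field.
have bE : b = - w * a.
  transitivity (t * (- w - w ^+ 2) / 2); last by rewrite /a; field.
  by rewrite w2 opprK /b addrC.
have a4 : a ^+ 4 = -1.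
  transitivity ((t ^+ 2) ^+ 2 * (1 + 2 * w + w ^+ 2) ^+ 2 / 16); first by rewrite /a; field.
  rewrite t2 w2; transitivity (d ^+ 2 * w ^+ 2); first by field.
  by rewrite d2 w2 mul1r.
have [p1 [p2 [p0 lp rp]]] := eigen_rows ab1 ab2 (nsc b).
rewrite addrC in ab1; rewrite mulrC in ab2.
have [q1 [q2 [q0 lq rq]]] := eigen_rows ab1 ab2 (nsc a).
rewrite bE in lq rq.
by have := ico_eigen_absurd pM a4 w2 p0 q0 lp rp lq rq.
Qed.

End NoElementOfOrderFour.

(** * Finiteness of the icosahedral monodromy group *)

Section IcosahedralGroup.
Variable R : realType.
Local Notation C := R[i].

Lemma depressed_cubic_roots (p q : C) : 4 * p ^+ 3 + 27 * q ^+ 2 != 0 ->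
  exists e : 'I_3 -> C, [/\ injective e, \sum_i e i = 0 &
    forall x, lame_prod e x = x ^+ 3 + p * x + q].
Proof.
move=> disc.
pose g : {poly C} := 'X^3 + (p *: 'X^1 + q *: 1).
have sr : (size (p *: 'X^1 + q *: 1 : {poly C})%R <= 3)%N.
  apply: size_add_leq; apply: leq_trans (size_scale_leq _ _) _.
    by rewrite size_polyXn.
  by rewrite size_poly1.
have gm : g \is monic by apply: monic_Xn_add.
have [rs rsE] := closed_field_poly_normal g.
rewrite (eqP gm) scale1r in rsE.
have szrs : size rs = 3.
  have := size_prod_XsubC rs id; rewrite -rsE /g size_Xn_add //.
  by move=> /(congr1 predn) /=.
case: rs szrs rsE => [|a [|b [|c [|]]]] // _ gE.
have {}gE x : (x - a) * (x - b) * (x - c) = x ^+ 3 + p * x + q.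
  have := congr1 (fun h : {poly C} => h.[x]) gE.
  rewrite /= /g !big_cons big_nil mulr1 !hornerM !hornerXsubC.
  rewrite !hornerD !hornerZ !hornerXn -[1 : {poly C}]/(1%:P) hornerC expr1 mulr1 addrA.
  by move=> ->; rewrite mulrA.
pose e (i : 'I_3) : C := nth 0 [:: a; b; c] i.
have e2 : e (inord 2) = c by rewrite /e inordK.
(* The coefficients are read off by evaluating the factorization at 0, 1 and -1. *)
have sum0 : a + b + c = 0.
  have n2 : (2 : C) != 0 by rewrite (pnatr_eq0 _ 2).
  apply: (mulfI n2); rewrite mulr0.
  transitivity (2 * ((0 - a) * (0 - b) * (0 - c)) - (1 - a) * (1 - b) * (1 - c)
    - (- 1 - a) * (- 1 - b) * (- 1 - c)); first by ring.
  by rewrite !gE; ring.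
have cE : c = - (a + b) by apply/eqP; rewrite -addr_eq0 addrC sum0.
have pE : p = a * b + b * c + c * a.
  transitivity ((1 - a) * (1 - b) * (1 - c) - (0 - a) * (0 - b) * (0 - c) - 1).
    by rewrite !gE; ring.
  by rewrite cE; ring.
have qE : q = - (a * b * c).
  by transitivity ((0 - a) * (0 - b) * (0 - c)); [rewrite gE; ring|ring].
have discE : 4 * p ^+ 3 + 27 * q ^+ 2 = - ((a - b) * (b - c) * (c - a)) ^+ 2.
  by rewrite pE qE cE; ring.
rewrite discE oppr_eq0 expf_eq0 /= !mulf_eq0 !negb_or in disc.
have [/andP[ab bc] ca] := andP disc.
rewrite !subr_eq0 in ab bc ca.
exists e; split.
- move=> i j; case: i => [[|[|[|//]]] ?]; case: j => [[|[|[|//]]] ?];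
    rewrite /e /= => /eqP h; apply: val_inj => //=; exfalso; move: h.
  + by rewrite (negPf ab).
  + by rewrite eq_sym (negPf ca).
  + by rewrite eq_sym (negPf ab).
  + by rewrite (negPf bc).
  + by rewrite (negPf ca).
  + by rewrite eq_sym (negPf bc).
- by rewrite ord3_sum e2.
- by move=> x; rewrite /lame_prod e2 -gE.
Qed.

Lemma icosahedral_group : exists (B : C) (e : 'I_3 -> C) (G : set (set 'M[C]_2)),
  [/\ injective e, \sum_i e i = 0, is_projective_monodromy_group 6^-1 B e G,
    finite_set G &
    forall X, G X -> exists M, [/\ X = pgl_class M, M \in unitmx &
      forall c, (M *m M) *m (M *m M) = c%:M -> exists k, M *m M = k%:M]].
Proof.
(* These coefficients are those of the cubic factor of T^2, written in x = f + 2/3 and divided by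
   27. *)
have [|e [e_inj e_sum e_prod]] := @depressed_cubic_roots (- (80 / 27)) (160 / 81).
  have -> : 4 * (- (80 / 27)) ^+ 3 + 27 * (160 / 81) ^+ 2 = 256 * 100 / 27 ^+ 3 :> C.
    by field.
  have nz n : n.+1%:R != 0 :> C by rewrite pnatr_eq0.
  apply: mulf_neq0; first exact: mulf_neq0 (nz 255) (nz 99).
  by rewrite invr_eq0; exact: expf_neq0 (nz 26).
have cubic_e x : 27 * lame_prod e x =
  27 * (x - 2 / 3) ^+ 3 + 54 * (x - 2 / 3) ^+ 2 - 44 * (x - 2 / 3) + 8.
  by rewrite e_prod; field.
have [P [s [s0 on oP Pb]]] := ico_basepoint cubic_e.
have [U [V [UP VP near_on]]] := ico_branch cubic_e on oP Pb.
have [_ _ P1] := ico_badP Pb.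
have [sU sV w0 near_rel] := ico_system cubic_e near_on oP P1.
exists (ico_B R), e, [set pgl_class M | M in monodromy_group 6^-1 (ico_B R) e P (basis2 U V)].
have VP0 : V P != 0 by rewrite VP.
have [cU cdU] := solution_continuous sU; have [cV cdV] := solution_continuous sV.
have grp M : monodromy_group 6^-1 (ico_B R) e P (basis2 U V) M ->
    [/\ M \in unitmx, preserves (@ico C) M & \det M ^+ 2 = 1].
  move=> MG; have uM : M \in unitmx by case: MG.
  have inv : \forall x \near P, holds_at (@ico_rel R)
      (fun y => rowl M (U y) (V y)) (fun y => rowr M (U y) (V y)) x.
    exact: (monodromy_holds (@ico_rel_continuous R) (ico_rel_branch cubic_e) near_rel MG).
  split=> //.
    apply: (preserves_near (@horner_ico C) (@ico_hom C) cU cV VP0).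
      by move=> a b /(wronskian_independent sU sV w0) [].
    near=> x.
    have /ico_rel_curve[-> _] : holds_at (@ico_rel R)
      (fun y => rowl M (U y) (V y)) (fun y => rowr M (U y) (V y)) x by near: x.
    have /ico_rel_curve[-> _] : holds_at (@ico_rel R) U V x by near: x.
    by [].
  (* Continuation multiplies the Wronskian by [\det M], which [ico_rel_wronskian] compensates by a
     change of [20 * icoT]; the square of the latter depends on x alone. *)
  have r1 := nbhs_singleton inv; have r2 := nbhs_singleton near_rel.
  have /local_solutionP/nbhs_singleton[dU _] := sU.
  have /local_solutionP/nbhs_singleton[dV _] := sV.
  have dl := hd_deriv (hdD (hdM dU (hdcst P (M 0 0))) (hdM dV (hdcst P (M 1 0)))).
  have dr := hd_deriv (hdD (hdM dU (hdcst P (M 0 1))) (hdM dV (hdcst P (M 1 1)))).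
  rewrite !mulr0 !add0r in dl dr.
  have W1 := ico_rel_wronskian r1; have W2 := ico_rel_wronskian r2.
  rewrite /rowl /rowr dl dr in W1.
  have q1 := ico_curve_square cubic_e (ico_rel_curve r1).
  have q2 := ico_curve_square cubic_e (ico_rel_curve r2).
  rewrite /rowl /rowr in q1.
  have T0 := ico_curve_T cubic_e on oP P1.
  rewrite -{1}UP -{1}VP in T0.
  move: W1 W2 q1 q2 T0 w0; rewrite /wronskian det22E.
  set t1 := 20 * icoT _ _; set t2 := 20 * icoT _ _.
  move: (U P) (V P) (deriv U P) (deriv V P) => a b c d W1 W2 q1 q2 T0 w0.
  have WE : (M 0 0 * M 1 1 - M 0 1 * M 1 0) * t1 = t2.
    apply: (mulIf w0); rewrite [t2 * _]mulrC W2 -W1; ring.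
  have sq : t1 ^+ 2 = t2 ^+ 2 by rewrite q1 q2.
  have T2 : t2 ^+ 2 != 0 by rewrite expf_neq0.
  by apply: (mulIf T2); rewrite mul1r -{1}sq -exprMn WE.
split=> //.
- exists P, (basis2 U V); split=> //; exact: local_basis2.
- have [r [r0 fr]] : exists r : C, r != 0 /\ ico r 1 = 0.
    pose h : {poly C} := 'X^10 + (11 * 'X^5 - 1).
    have sh : size h != 1 by rewrite /h size_Xn_add //; size_tac.
    have /closed_rootP[r /rootP] := sh.
    rewrite /h hornerD hornerXn hornerD hornerN hornerM horner_nat hornerXn.
    rewrite -[1 : {poly C}]/(1%:P) hornerC => rE; exists r; split.
      apply/eqP => r0; move/eqP: rE; rewrite r0 !expr0n mulr0 !add0r oppr_eq0.
      by rewrite oner_eq0.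
    transitivity (r * (r ^+ 10 + (11 * r ^+ 5 - 1))); last by rewrite rE mulr0.
    by rewrite /ico !expr1n; ring.
  apply: (finite_pgl_classes (@horner_ico C) (@ico_hom C) r0 fr).
  + by rewrite /ico mulr0 mul0r.
  + by rewrite /ico !mul0r.
  + by rewrite -size_poly_eq0 size_ico_poly.
  + by move=> M /grp[].
- move=> _ [M /grp[uM pM dM] <-]; exists M; split=> // c.
  exact: ico_no_order4.
Unshelve. all: by end_near. Qed.

End IcosahedralGroup.

(** * The octahedral operator *)

Section OctahedralForms.
Variable T : comNzRingType.
Implicit Types x y : T.

(* Up to constant factors, [octW] is the Hessian and [octX] the Jacobian
   covariant of [oct]; digits are partial derivatives. *)

Definition oct x y := x * y * (x ^+ 4 - y ^+ 4).
Definition oct1 x y := 5 * (x ^+ 4 * y) - y ^+ 5.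
Definition oct2 x y := x ^+ 5 - 5 * (x * y ^+ 4).
Definition octW x y := x ^+ 8 + 14 * (x ^+ 4 * y ^+ 4) + y ^+ 8.
Definition octW1 x y := 8 * x ^+ 7 + 56 * (x ^+ 3 * y ^+ 4).
Definition octW2 x y := 8 * y ^+ 7 + 56 * (x ^+ 4 * y ^+ 3).
Definition octW11 x y := 56 * x ^+ 6 + 168 * (x ^+ 2 * y ^+ 4).
Definition octW12 x y := 224 * (x ^+ 3 * y ^+ 3).
Definition octW22 x y := 56 * y ^+ 6 + 168 * (x ^+ 4 * y ^+ 2).
Definition octX x y := x ^+ 12 - 33 * (x ^+ 8 * y ^+ 4) - 33 * (x ^+ 4 * y ^+ 8) + y ^+ 12.

Lemma oct_hom k x y : oct (k * x) (k * y) = k ^+ 6 * oct x y.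
Proof. rewrite /oct; ring. Qed.
Lemma octW_hom k x y : octW (k * x) (k * y) = k ^+ 8 * octW x y.
Proof. rewrite /octW; ring. Qed.
Lemma octX_hom k x y : octX (k * x) (k * y) = k ^+ 12 * octX x y.
Proof. rewrite /octX; ring. Qed.
Lemma octW_euler x y : x * octW1 x y + y * octW2 x y = 8 * octW x y.
Proof. rewrite /octW /octW1 /octW2; ring. Qed.
Lemma oct_jacobian x y : oct1 x y * octW2 x y - oct2 x y * octW1 x y = - 8 * octX x y.
Proof. rewrite /oct1 /oct2 /octW1 /octW2 /octX; ring. Qed.
Lemma oct_syzygy x y : octX x y ^+ 2 = octW x y ^+ 3 - 108 * oct x y ^+ 4.
Proof. rewrite /octX /octW /oct; ring. Qed.
(** Euler's relations reduce the left side to -x/7 times the Hessian of [octW], which is 9408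
    [oct ^+ 2]. *)
Lemma octW_hessian_x x y :
  octW12 x y * octW2 x y - octW22 x y * octW1 x y = - 1344 * x * oct x y ^+ 2.
Proof. rewrite /octW12 /octW2 /octW22 /octW1 /oct; ring. Qed.
Lemma octW_hessian_y x y :
  octW12 x y * octW1 x y - octW11 x y * octW2 x y = - 1344 * y * oct x y ^+ 2.
Proof. rewrite /octW12 /octW2 /octW11 /octW1 /oct; ring. Qed.
Lemma oct_wronskian x y :
  3 * oct x y * octW1 x y - 4 * octW x y * oct1 x y = 4 * y * octX x y.
Proof. rewrite /oct /octW1 /octW /oct1 /octX; ring. Qed.

End OctahedralForms.

Section OctahedralPolynomials.
Variable F : numFieldType.
Implicit Types (p q : {poly F}) (w y s x : F).

Lemma horner_oct p q w : (oct p q).[w] = oct p.[w] q.[w].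
Proof. by rewrite /oct !(horner_exp, horner_nat, hornerD, hornerN, hornerM). Qed.

Lemma horner_octW p q w : (octW p q).[w] = octW p.[w] q.[w].
Proof. by rewrite /octW !(horner_exp, horner_nat, hornerD, hornerN, hornerM). Qed.

Lemma octW_polyE : octW 'X 1 = 'X^8 + (14 * 'X^4 + 1) :> {poly F}.
Proof. by rewrite /octW !expr1n; ring. Qed.

Lemma oct_polyE : oct 'X 1 = 'X^5 + - 'X^1 :> {poly F}.
Proof. by rewrite /oct !expr1n; ring. Qed.

Lemma monic_octW_poly : (octW 'X 1) ^+ 3 \is @monic F.
Proof. by apply: monic_exp; rewrite octW_polyE; apply: monic_Xn_add; size_tac. Qed.

Lemma size_oct_poly : size (oct 'X 1 : {poly F}) = 6.
Proof. by rewrite oct_polyE size_Xn_add //; size_tac. Qed.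

Lemma size_oct_lt : (size ((oct 'X 1 : {poly F}) ^+ 4)%R < size ((octW 'X 1 : {poly F}) ^+ 3)%R)%N.
Proof.
have sW : size (octW 'X 1 : {poly F}) = 9 by rewrite octW_polyE size_Xn_add //; size_tac.
have W0 : (octW 'X 1 : {poly F}) != 0 by rewrite -size_poly_eq0 sW.
rewrite (@leq_ltn_trans (5 * 4).+1) //.
  by apply: leq_trans (size_poly_exp_leq _ _) _; rewrite size_oct_poly.
by have := size_exp (octW 'X 1 : {poly F}) 3; rewrite sW => /(congr1 succn);
  rewrite prednK ?lt0n ?size_poly_eq0 ?expf_neq0 // => ->.
Qed.

(** The quotient W^3 / f^4 eliminates [s], and s^4 = s^12 / s^8 recovers it up to a fourth root of
    unity. *)
Lemma oct_tower (t h x s : F) : x != 0 -> s != 0 -> t != 0 ->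
  (s ^+ 8 * h = 3 /\ 2 * (s ^+ 6 * t) ^+ 2 = x) <->
  (h ^+ 3 = 108 / x ^+ 2 * t ^+ 4 /\ s ^+ 4 = x / 6 * h / t ^+ 2).
Proof.
move=> x0 s0 t0; split=> -[h1 h2].
  have h0 : h != 0.
    apply/eqP => h0; move/eqP: h1; rewrite h0 mulr0 eq_sym.
    by rewrite (pnatr_eq0 _ 3).
  have hE : h = 3 / s ^+ 8 by rewrite -h1; field.
  by split; rewrite hE -h2; field; rewrite ?s0 ?t0.
split.
  transitivity ((s ^+ 4) ^+ 2 * h); first by ring.
  rewrite h2; transitivity (x ^+ 2 / 36 * h ^+ 3 / t ^+ 4); first by field.
  by rewrite h1; field; rewrite x0 t0.
transitivity (2 * (s ^+ 4) ^+ 3 * t ^+ 2); first by ring.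
rewrite h2; transitivity (x ^+ 3 / 108 * h ^+ 3 / t ^+ 4); first by field.
by rewrite h1; field; rewrite x0 t0.
Qed.

(** Since s^2 is a constant multiple of the cubic, the term produced by s' cancels the first-order
    term of the operator, leaving A / s^2. *)
Lemma oct_first_order_equation (A n s P P1 u x t2 : F) :
  s != 0 -> P != 0 -> s ^+ 2 = - (512 * 27) * P ->
  A = - 1344 * u * t2 -> 2 * t2 = x ->
  A / s / s - n * (- (512 * 27) * P1) / (2 * (- (512 * 27) * P) * s) + P1 / (2 * P) * (n / s) =
  (6^-1 * (6^-1 + 1) * x + 0) / (4 * P) * u.
Proof.
move=> s0 P0 sE AE xE.
transitivity (A / s ^+ 2); first by field; rewrite s0 P0.
by rewrite sE AE -xE; field.
Qed.

End OctahedralPolynomials.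

(** * The first-order system on the octahedral curve *)

Section OctahedralSystem.
Variable R : realType.
Local Notation C := R[i].
Implicit Types (x y a b c d w s : C) (U V : C -> C).

Definition oct_e (i : 'I_3) : C := nth 0 [:: 0; 1; -1] i.

Lemma oct_lame_prod x : lame_prod oct_e x = x ^+ 3 - x.
Proof. by rewrite /lame_prod /oct_e inordK //=; ring. Qed.

Lemma oct_ordinary_neq0 x : ordinary_point oct_e x -> x != 0.
Proof. by move=> /(_ 0) /eqP. Qed.

(* A square root of [- 512 * 27 * lame_prod oct_e x] on the curve. *)
Definition oct_root a b : C := - (32 * (oct a b * octX a b)).

Definition oct_rel (i : nat) x a b c d : C :=
  match i with
  | 0 => octW a b - 3
  | 1 => 2 * oct a b ^+ 2 - x
  | 2 => oct_root a b * c - octW2 a b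
  | _ => oct_root a b * d + octW1 a b
  end.

Definition on_oct_curve x a b := octW a b = 3 /\ 2 * oct a b ^+ 2 = x.

Lemma oct_rel_curve x a b c d : (forall i, oct_rel i x a b c d = 0) -> on_oct_curve x a b.
Proof.
move=> h; split; apply/eqP; rewrite -subr_eq0; apply/eqP; [exact: (h 0%N)|exact: (h 1%N)].
Qed.

(** The constants 3 and 2 of the curve are normalizations: the syzygy becomes X^2 = 27 (1 - x^2),
    which together with f^2 = x/2 yields the cubic x^3 - x. *)
Lemma oct_curve_square x a b : on_oct_curve x a b ->
  oct_root a b ^+ 2 = - (512 * 27) * lame_prod oct_e x.
Proof.
move=> [W3 xE].
transitivity (1024 * (oct a b ^+ 2 * octX a b ^+ 2)).
  by rewrite /oct_root; move: (oct a b) (octX a b) => t z; ring.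
rewrite oct_syzygy W3 oct_lame_prod -xE; move: (oct a b) => t; ring.
Qed.

Lemma oct_curve_root x a b : on_oct_curve x a b -> ordinary_point oct_e x ->
  oct_root a b != 0.
Proof.
move=> on ox; apply/eqP => s0.
have /eqP := oct_curve_square on; rewrite s0 expr0n /= eq_sym; apply/negP.
have nz n : n.+1%:R != 0 :> C by rewrite pnatr_eq0.
apply: mulf_neq0; last exact: lame_prod_neq0.
by rewrite oppr_eq0; exact: mulf_neq0 (nz 511) (nz 26).
Qed.

Section FormDerivatives.
Variables (U V : C -> C) (x a b : C).
Hypotheses (hU : has_derivative U x a) (hV : has_derivative V x b).

Lemma hd_oct : has_derivative (fun y => oct (U y) (V y)) x
  (oct1 (U x) (V x) * a + oct2 (U x) (V x) * b).
Proof. rewrite /oct; hd_tac; rewrite /oct1 /oct2; ring. Qed.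

Lemma hd_octW : has_derivative (fun y => octW (U y) (V y)) x
  (octW1 (U x) (V x) * a + octW2 (U x) (V x) * b).
Proof. rewrite /octW; hd_tac; rewrite /octW1 /octW2; ring. Qed.

Lemma hd_octW1 : has_derivative (fun y => octW1 (U y) (V y)) x
  (octW11 (U x) (V x) * a + octW12 (U x) (V x) * b).
Proof. rewrite /octW1; hd_tac; rewrite /octW11 /octW12; ring. Qed.

Lemma hd_octW2 : has_derivative (fun y => octW2 (U y) (V y)) x
  (octW12 (U x) (V x) * a + octW22 (U x) (V x) * b).
Proof. rewrite /octW2; hd_tac; rewrite /octW12 /octW22; ring. Qed.

Lemma holomorphic_oct_root : holomorphic_at (fun y => oct_root (U y) (V y)) x.
Proof. by rewrite /oct_root /oct /octX /holomorphic_at; eexists; repeat hd_step. Qed.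

End FormDerivatives.

Lemma oct_system x0 U V :
  (\forall y \near x0,
     [/\ holomorphic_at U y, holomorphic_at V y & on_oct_curve y (U y) (V y)]) ->
  ordinary_point oct_e x0 ->
  [/\ local_solution 6^-1 0 oct_e x0 U, local_solution 6^-1 0 oct_e x0 V,
      wronskian U V x0 != 0 &
      \forall y \near x0, holds_at oct_rel U V y].
Proof.
move=> near_on ox0.
have near_o := ordinary_near ox0.
have near_s : \forall y \near x0, oct_root (U y) (V y) != 0.
  near=> y; have [_ _ on] : [/\ holomorphic_at U y, holomorphic_at V y &
    on_oct_curve y (U y) (V y)] by near: y.
  by apply: (oct_curve_root on); near: y.
pose kU y := octW2 (U y) (V y) / oct_root (U y) (V y).
pose kV y := - octW1 (U y) (V y) / oct_root (U y) (V y).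
have near_hd : \forall y \near x0, has_derivative U y (kU y) /\ has_derivative V y (kV y).
  near=> y.
  have [[a hU] [b hV] _] : [/\ holomorphic_at U y, holomorphic_at V y &
    on_oct_curve y (U y) (V y)] by near: y.
  have on : \forall z \near y, [/\ holomorphic_at U z, holomorphic_at V z &
    on_oct_curve z (U z) (V z)] by near: y; exact: nbhs_interior.
  have s0 : oct_root (U y) (V y) != 0 by near: y.
  have lin1 : octW1 (U y) (V y) * a + octW2 (U y) (V y) * b = 0.
    apply: hd_unique (hd_octW hU hV) _; apply: (@hd_near _ (fun=> 3)).
      by apply: filterS on => z [_ _ [-> _]].
    exact: hdcst.
  have lin2 : 4 * oct (U y) (V y) * (oct1 (U y) (V y) * a + oct2 (U y) (V y) * b) = 1.
    have h1 : has_derivative (fun z => 2 * oct (U z) (V z) ^+ 2) y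
      (4 * oct (U y) (V y) * (oct1 (U y) (V y) * a + oct2 (U y) (V y) * b)).
      have := hd_oct hU hV; move: (oct1 _ _ * a + _) => D hD.
      by hd_tac; ring.
    apply: hd_unique h1 _; apply: (@hd_near _ (fun z => z)); last exact: hdid.
    by apply: filterS on => z [_ _ [_ ->]].
  (* The determinant of the linear system [lin1], [lin2] for the two derivatives. *)
  have rE : oct_root (U y) (V y) = 4 * oct (U y) (V y) *
      (oct1 (U y) (V y) * octW2 (U y) (V y) - oct2 (U y) (V y) * octW1 (U y) (V y)).
    by rewrite oct_jacobian /oct_root; ring.
  have aE : a = kU y.
    apply: (mulIf s0); rewrite /kU divfK // rE.
    move: (octW1 _ _) (octW2 _ _) (oct _ _) (oct1 _ _) (oct2 _ _) lin1 lin2 => w1 w2 t t1 t2 l1 l2.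
    transitivity (w2 * (4 * t * (t1 * a + t2 * b)) - 4 * t * t2 * (w1 * a + w2 * b)); first by ring.
    by rewrite l1 l2; ring.
  have bE : b = kV y.
    apply: (mulIf s0); rewrite /kV divfK // rE.
    move: (octW1 _ _) (octW2 _ _) (oct _ _) (oct1 _ _) (oct2 _ _) lin1 lin2 => w1 w2 t t1 t2 l1 l2.
    transitivity (4 * t * t1 * (w1 * a + w2 * b) - w1 * (4 * t * (t1 * a + t2 * b))); first by ring.
    by rewrite l1 l2; ring.
  by rewrite -aE -bE.
have near_rel : \forall y \near x0, holds_at oct_rel U V y.
  near=> y.
  have [hU hV] : has_derivative U y (kU y) /\ has_derivative V y (kV y) by near: y.
  have s0 : oct_root (U y) (V y) != 0 by near: y.
  have [_ _ [f1 f2]] : [/\ holomorphic_at U y, holomorphic_at V y &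
    on_oct_curve y (U y) (V y)] by near: y.
  case=> [|[|[|i]]] /=; rewrite ?(hd_deriv hU) ?(hd_deriv hV).
  - by rewrite f1 subrr.
  - by rewrite f2 subrr.
  - by rewrite /kU mulrC divfK // subrr.
  - by rewrite /kV mulrC divfK // addNr.
have near_G : \forall y \near x0, has_derivative
    (fun y => - (512 * 27) * lame_prod oct_e y) y (- (512 * 27) * lame_dprod oct_e y).
  near=> y; have := hd_lame_prod oct_e y.
  move: (lame_prod oct_e) (lame_dprod oct_e y) => P P1 hP.
  by hd_tac; move: (P y) => Py; ring.
split=> //.
- apply: (local_solution_first_order (s := fun y => oct_root (U y) (V y)) _
    (n := fun y => octW2 (U y) (V y)) _ _ near_G) => //.
  + by apply: filterS near_hd => y [].
  + by apply: filterS near_hd => y [hU hV]; exact: hd_octW2 hU hV.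
  + by apply: filterS near_hd => y [hU hV]; exact: holomorphic_oct_root hU hV.
  + by apply: filterS near_on => y [_ _ /oct_curve_square].
  + near=> y.
    have s0 : oct_root (U y) (V y) != 0 by near: y.
    have oy : ordinary_point oct_e y by near: y.
    have [_ _ on] : [/\ holomorphic_at U y, holomorphic_at V y &
      on_oct_curve y (U y) (V y)] by near: y.
    have [_ f2] := on.
    have key := octW_hessian_x (U y) (V y).
    rewrite lame_pE // lame_qE /kU /kV linear_quotient.
    exact: (oct_first_order_equation (octW2 (U y) (V y)) (lame_dprod oct_e y) s0
      (lame_prod_neq0 oy) (oct_curve_square on) key f2).
- apply: (local_solution_first_order (s := fun y => oct_root (U y) (V y)) _
    (n := fun y => - octW1 (U y) (V y)) _ _ near_G) => //.
  + by apply: filterS near_hd => y [].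
  + by apply: filterS near_hd => y [hU hV]; exact: hdN (hd_octW1 hU hV).
  + by apply: filterS near_hd => y [hU hV]; exact: holomorphic_oct_root hU hV.
  + by apply: filterS near_on => y [_ _ /oct_curve_square].
  + near=> y.
    have s0 : oct_root (U y) (V y) != 0 by near: y.
    have oy : ordinary_point oct_e y by near: y.
    have [_ _ on] : [/\ holomorphic_at U y, holomorphic_at V y &
      on_oct_curve y (U y) (V y)] by near: y.
    have [_ f2] := on.
    have key := octW_hessian_y (U y) (V y).
    rewrite lame_pE // lame_qE /kU /kV linear_quotient_opp.
    exact: (oct_first_order_equation (- octW1 (U y) (V y)) (lame_dprod oct_e y) s0
      (lame_prod_neq0 oy) (oct_curve_square on) key f2).
- have [hU hV] := nbhs_singleton near_hd.
  have s0 := nbhs_singleton near_s.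
  have [_ _ [f1 f2]] := nbhs_singleton near_on.
  rewrite /wronskian (hd_deriv hU) (hd_deriv hV).
  have -> : U x0 * kV x0 - V x0 * kU x0 = - (8 * 3) / oct_root (U x0) (V x0).
    transitivity (- (U x0 * octW1 (U x0) (V x0) + V x0 * octW2 (U x0) (V x0))
      / oct_root (U x0) (V x0)); last by rewrite octW_euler f1.
    rewrite /kU /kV; move: (oct_root _ _) (octW1 _ _) (octW2 _ _) => s w1 w2; ring.
  have nz n : n.+1%:R != 0 :> C by rewrite pnatr_eq0.
  apply: mulf_neq0; last by rewrite invr_eq0.
  by rewrite oppr_eq0; exact: mulf_neq0 (nz 7) (nz 2).
Unshelve. all: by end_near. Qed.

End OctahedralSystem.

(** * Branches and finite monodromy in the octahedral case *)

Section OctahedralBranch.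
Variable R : realType.
Local Notation C := R[i].
Local Notation oct_e := (@oct_e R).
Local Notation oct_rel := (@oct_rel R).
Implicit Types (x y a b c d w s : C) (U V : C -> C).

Lemma oct_branch x0 a1 a2 : on_oct_curve x0 a1 a2 -> ordinary_point oct_e x0 ->
  exists U V : C -> C,
  [/\ U x0 = a1, V x0 = a2, \forall y \near x0,
     [/\ holomorphic_at U y, holomorphic_at V y & on_oct_curve y (U y) (V y)] &
   \forall p \near (x0, (a1, a2)), on_oct_curve p.1 p.2.1 p.2.2 -> p.2 = (U p.1, V p.1)].
Proof.
move=> on ox; have x1 := oct_ordinary_neq0 ox.
have s0 := oct_curve_root on ox.
have a20 : a2 != 0.
  apply: contraNneq x1 => a20; have [_ <-] := on.
  by rewrite a20 /oct mulr0 mul0r expr0n mulr0.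
pose w0 := a1 / a2.
have a1E : a1 = a2 * w0 by rewrite mulrC divfK.
have a2E : a2 = a2 * 1 by rewrite mulr1.
have t0 : oct w0 1 != 0.
  apply: contraNneq s0 => h; by rewrite /oct_root a1E {2}a2E oct_hom h mulr0 mul0r mulr0 oppr0.
have z0 : octX w0 1 != 0.
  apply: contraNneq s0 => h; by rewrite /oct_root a1E {4}a2E octX_hom h !mulr0 oppr0.
have n3 : (3 : C) != 0 by rewrite (pnatr_eq0 _ 3).
have W0 : octW w0 1 != 0.
  apply: contraNneq n3 => h; have [<- _] := on.
  by rewrite a1E {2}a2E octW_hom h mulr0.
have evt w : (oct 'X 1 : {poly C}).[w] = oct w 1.
  by rewrite horner_oct hornerX -[1 : {poly C}]/(1%:P) hornerC.
have evW w : (octW 'X 1 : {poly C}).[w] = octW w 1.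
  by rewrite horner_octW hornerX -[1 : {poly C}]/(1%:P) hornerC.
have evB w : ((oct 'X 1 : {poly C}) ^+ 4).[w] = oct w 1 ^+ 4 by rewrite horner_exp evt.
have evD w : ((oct 'X 1 : {poly C}) ^+ 2).[w] = oct w 1 ^+ 2 by rewrite horner_exp evt.
have evA w : ((octW 'X 1 : {poly C}) ^+ 3).[w] = octW w 1 ^+ 3 by rewrite horner_exp evW.
have dA : ((octW 'X 1 : {poly C}) ^+ 3)^`().[w0] = 3 * octW w0 1 ^+ 2 * octW1 w0 1.
  have h1 := hd_horner ((octW 'X 1 : {poly C}) ^+ 3) w0.
  have h2 : has_derivative (fun w => octW w 1 ^+ 3) w0 (3 * octW w0 1 ^+ 2 * octW1 w0 1).
    have := hd_octW (hdid w0) (hdcst w0 1); rewrite mulr0 addr0 mulr1.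
    by move: (octW1 w0 1) => h' hh; hd_tac; ring.
  apply: hd_unique h1 _; apply: hd_near h2.
  by near=> w; rewrite evA.
have dB : ((oct 'X 1 : {poly C}) ^+ 4)^`().[w0] = 4 * oct w0 1 ^+ 3 * oct1 w0 1.
  have h1 := hd_horner ((oct 'X 1 : {poly C}) ^+ 4) w0.
  have h2 : has_derivative (fun w => oct w 1 ^+ 4) w0 (4 * oct w0 1 ^+ 3 * oct1 w0 1).
    have := hd_oct (hdid w0) (hdcst w0 1); rewrite mulr0 addr0 mulr1.
    by move: (oct1 w0 1) => h' hh; hd_tac; ring.
  apply: hd_unique h1 _; apply: hd_near h2.
  by near=> w; rewrite evB.
have near_x1 : \forall y \near x0, y != 0.
  near=> y; apply: oct_ordinary_neq0; near: y; exact: ordinary_near.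
have [||||||||U [V [U0 V0 near_on uniq]]] := @algebraic_branch R
  ((octW 'X 1) ^+ 3) ((oct 'X 1) ^+ 4) (octW 'X 1) ((oct 'X 1) ^+ 2)
  (fun y => 108 / y ^+ 2) (fun y => y / 6)
  (@on_oct_curve R) x0 a1 a2 (monic_octW_poly _) (size_oct_lt _) => //.
- by rewrite evB expf_neq0.
- rewrite evB evA dA dB.
  have -> : oct w0 1 ^+ 4 * (3 * octW w0 1 ^+ 2 * octW1 w0 1) -
    octW w0 1 ^+ 3 * (4 * oct w0 1 ^+ 3 * oct1 w0 1) =
    oct w0 1 ^+ 3 * octW w0 1 ^+ 2 * (3 * oct w0 1 * octW1 w0 1 - 4 * octW w0 1 * oct1 w0 1).
    by move: (oct w0 1) (octW w0 1) (oct1 w0 1) (octW1 w0 1) => f h f1 h1; ring.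
  rewrite oct_wronskian mulr1.
  have n4 : (4 : C) != 0 by rewrite (pnatr_eq0 _ 4).
  apply: mulf_neq0 (mulf_neq0 n4 z0).
  by apply: mulf_neq0; exact: expf_neq0.
- by rewrite evD expf_neq0.
- near=> y; have y0 : y != 0 by near: y.
  apply: holomorphicM; first by exists 0; exact: hdcst.
  apply: holomorphicV; first by rewrite expf_neq0.
  by eexists; do ! hd_step; exact: hdid.
- by near=> y; eexists; do ! hd_step; exact: hdid.
- near=> y => w s sn0; rewrite evD => fw.
  have y0 : y != 0 by near: y.
  have fw0 : oct w 1 != 0 by apply: contraNneq fw => ->; rewrite expr0n.
  rewrite /on_oct_curve [w * s]mulrC -{2 4}[s]mulr1 oct_hom octW_hom evA evB evW.
  exact: oct_tower.
by exists U, V; split.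
Unshelve. all: by end_near. Qed.

Lemma oct_rel_continuous i (f1 f2 f3 f4 : C -> C) x :
  {for x, continuous f1} -> {for x, continuous f2} ->
  {for x, continuous f3} -> {for x, continuous f4} ->
  {for x, continuous (fun y => oct_rel i y (f1 y) (f2 y) (f3 y) (f4 y))}.
Proof.
move=> c1 c2 c3 c4; case: i => [|[|[|i]]]; rewrite /oct_rel /oct_root /oct /octX.
- by rewrite /octW; repeat cnt_step.
- by repeat cnt_step.
- by rewrite /octW2; repeat cnt_step.
- by rewrite /octW1; repeat cnt_step.
Qed.

Lemma oct_rel_deriv x a b c d c' d' : oct_root a b != 0 ->
  (forall i, oct_rel i x a b c d = 0) -> (forall i, oct_rel i x a b c' d' = 0) ->
  c = c' /\ d = d'.
Proof.
move=> s0 r r'.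
have := r 2%N; have := r 3%N; have := r' 2%N; have := r' 3%N; rewrite /=.
move=> /eqP; rewrite addr_eq0 => /eqP r3 /eqP; rewrite subr_eq0 => /eqP r2.
move=> /eqP; rewrite addr_eq0 => /eqP h3 /eqP; rewrite subr_eq0 => /eqP h2.
by split; apply: (mulfI s0); [rewrite h2 r2|rewrite h3 r3].
Qed.

(** The list of bad points is empty: over an ordinary point W = 3, f^2 = x/2 and X^2 = 27 (1 - x^2)
    are all nonzero. *)
Lemma oct_rel_branch x a1 a2 d1 d2 :
  ordinary_point oct_e x -> x \notin [::] -> (forall i, oct_rel i x a1 a2 d1 d2 = 0) ->
  exists u v, [/\ local_solution 6^-1 0 oct_e x u /\ local_solution 6^-1 0 oct_e x v,
    u x = a1 /\ v x = a2, deriv u x = d1 /\ deriv v x = d2,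
    wronskian u v x != 0 & \forall y \near x, holds_at oct_rel u v y].
Proof.
move=> ox _ rel; have on := oct_rel_curve rel.
have [U [V [Ux Vx near_on _]]] := oct_branch on ox.
have [sU sV w0 near_rel] := oct_system near_on ox.
exists U, V; split=> //.
have h : forall i, oct_rel i x a1 a2 (deriv U x) (deriv V x) = 0.
  by have := nbhs_singleton near_rel; rewrite /holds_at Ux Vx.
exact: oct_rel_deriv (oct_curve_root on ox) h rel.
Qed.

(** The curve fixes only the square of [oct], whose sign may change under continuation. *)
Definition oct_sq (T : comNzRingType) (x y : T) : T := oct x y ^+ 2.

Lemma oct_finite (P : C) U V :
  local_solution 6^-1 0 oct_e P U -> local_solution 6^-1 0 oct_e P V ->
  wronskian U V P != 0 -> V P != 0 -> (\forall y \near P, holds_at oct_rel U V y) ->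
  finite_set [set pgl_class M | M in monodromy_group 6^-1 0 oct_e P (basis2 U V)].
Proof.
move=> sU sV w0 VP0 near_rel.
have [cU cdU] := solution_continuous sU; have [cV cdV] := solution_continuous sV.
have horner_sq (p q : {poly C}) w : (oct_sq p q).[w] = oct_sq p.[w] q.[w].
  by rewrite /oct_sq horner_exp horner_oct.
have sq_hom k a b : oct_sq (k * a) (k * b) = k ^+ 12 * oct_sq a b.
  by rewrite /oct_sq oct_hom exprMn -exprM.
have n1 : (1 : C) != 0 := oner_neq0 _.
apply: (finite_pgl_classes horner_sq sq_hom n1).
- by rewrite /oct_sq /oct !expr1n subrr mulr0 expr0n.
- by rewrite /oct_sq /oct mulr0 mul0r expr0n.
- by rewrite /oct_sq /oct !mul0r expr0n.
- by rewrite expf_neq0 // -size_poly_eq0 size_oct_poly.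
move=> M MG; have uM : M \in unitmx by case: MG.
have inv : \forall x \near P, holds_at oct_rel
    (fun y => rowl M (U y) (V y)) (fun y => rowr M (U y) (V y)) x.
  exact: (monodromy_holds oct_rel_continuous oct_rel_branch near_rel MG).
split=> //; apply: (preserves_near horner_sq sq_hom cU cV VP0).
  by move=> a b /(wronskian_independent sU sV w0) [].
have n2 : (2 : C) != 0 by rewrite (pnatr_eq0 _ 2).
near=> x.
have [_ e1] : on_oct_curve x (rowl M (U x) (V x)) (rowr M (U x) (V x)).
  suff : holds_at oct_rel (fun y => rowl M (U y) (V y)) (fun y => rowr M (U y) (V y)) x.
    exact: oct_rel_curve.
  by near: x.
have [_ e2] : on_oct_curve x (U x) (V x).
  suff : holds_at oct_rel U V x by exact: oct_rel_curve.
  by near: x.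
by apply: (mulfI n2); rewrite /oct_sq e1 e2.
Unshelve. all: by end_near. Qed.

End OctahedralBranch.

(** * Continuity of the principal eighth root *)

Section PrincipalRoot.
Variable R : realType.
Local Notation C := R[i].
Implicit Types (z w : C).

Lemma Re_sqrtc_ge0 z : 0 <= complex.Re (sqrtc z).
Proof. by case: z => a b /=; exact: sqrtr_ge0. Qed.

Lemma Re_sqrtc_gt0 z : 0 < complex.Re z -> 0 < complex.Re (sqrtc z).
Proof.
case: z => a b /= a0; rewrite sqrtr_gt0 divr_gt0 // ltr_wpDl // sqrtr_ge0.
Qed.

(** For square roots p of z and q of w one has (q - p)(q + p) = w - z, and |q + p| is at least Re p
    because Re q is nonnegative. *)
Lemma continuous_sqrtc z : 0 < complex.Re z -> {for z, continuous (@sqrtc R)}.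
Proof.
move=> z0; set p := sqrtc z; have p0 : 0 < complex.Re p by exact: Re_sqrtc_gt0.
move=> A /nbhs_complexP[d d0 pA]; apply/nbhs_complexP.
exists (d * complex.Re p); first exact: mulr_gt0.
move=> w wz; apply: pA; set q := sqrtc w.
have sumE : (q - p) * (q + p) = w - z by rewrite -subr_sqr !sqr_sqrtc.
have pn : (complex.Re p)%:C <= `|q + p|.
  apply: le_trans (normc_ge_Re _); rewrite lecR raddfD /=.
  by apply: le_trans (ler_norm _); rewrite lerDr Re_sqrtc_ge0.
have pC0 : 0 < (complex.Re p)%:C by rewrite ltcR.
rewrite -(ltr_pM2r pC0); apply: le_lt_trans (_ : `|q - p| * `|q + p| < _).
  by rewrite ler_wpM2l.
by rewrite -normrM sumE -rmorphM.
Qed.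

Definition root8 z : C := sqrtc (sqrtc (sqrtc z)).

Lemma root8E z : root8 z ^+ 8 = z.
Proof. by rewrite /root8 (exprM _ 2 4) sqr_sqrtc (exprM _ 2 2) !sqr_sqrtc. Qed.

Lemma continuous_root8 z : 0 < complex.Re z -> {for z, continuous root8}.
Proof.
move=> z0; have z1 := Re_sqrtc_gt0 z0; have z2 := Re_sqrtc_gt0 z1.
have c1 := continuous_sqrtc z0; have c2 := continuous_sqrtc z1.
exact: (cvg_comp _ _ (cvg_comp _ _ c1 c2) (continuous_sqrtc z2)).
Qed.

Lemma Re_inv_gt0 z : 0 < complex.Re z -> 0 < complex.Re z^-1.
Proof.
case: z => a b /= a0; rewrite divr_gt0 // ltr_wpDr ?sqr_ge0 // exprn_gt0 //.
Qed.

End PrincipalRoot.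

Section UnitCircle.
Variable R : realType.
Local Notation C := R[i].
Implicit Types (t : R).

Definition cis t : C := cos t +i* sin t.

Lemma cisD s t : cis (s + t) = cis s * cis t.
Proof. by rewrite /cis cosD sinD; simpc; congr (_ +i* _); rewrite addrC. Qed.

Lemma cis0 : cis 0 = 1.
Proof. by rewrite /cis cos0 sin0. Qed.

Lemma cisX n t : cis t ^+ n = cis (n%:R * t).
Proof.
elim: n => [|n IHn]; first by rewrite mul0r cis0 expr0.
by rewrite exprS IHn -cisD -nat1r mulrDl mul1r.
Qed.

Lemma norm_cis t : `|cis t| = 1.
Proof. by rewrite normc_def /= cos2Dsin2 sqrtr1. Qed.

Lemma cis_neq0 t : cis t != 0.
Proof. by rewrite -normr_eq0 norm_cis oner_neq0. Qed.

Lemma continuous_cis : continuous cis.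
Proof. by move=> t; apply: continuousC; [exact: continuous_cos|exact: continuous_sin]. Qed.

Lemma cis_pi : cis pi = -1.
Proof. by rewrite /cis cospi sinpi; apply/eqP; rewrite eq_complex /= oppr0 !eqxx. Qed.

End UnitCircle.

(** * Continuation along a lifted path on the octahedral curve *)

Section OctahedralMonodromy.
Variable R : realType.
Local Notation C := R[i].
Local Notation oct_e := (@oct_e R).
Local Notation oct_rel := (@oct_rel R).
Implicit Types (x y z a b c d m : C) (U V : C -> C).

Definition oct_branch_near x U V := \forall y \near x,
  [/\ holomorphic_at U y, holomorphic_at V y & on_oct_curve y (U y) (V y)].

(** For z^8 = 1, diag(z, 1/z) is a symmetry of the curve: it multiplies [oct] and [octX] by the sign
    z^4 and fixes [octW], hence also [oct_root]. *)
Lemma oct_rel_twist i x a b c d z : z ^+ 8 = 1 -> (forall i, oct_rel i x a b c d = 0) ->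
  oct_rel i x (z * a) (z^-1 * b) (z * c) (z^-1 * d) = 0.
Proof.
move=> z8 r; have z0 : z != 0.
  by apply/eqP => z0; move: z8; rewrite z0 expr0n => /eqP; rewrite eq_sym oner_eq0.
have zV8 : z^-1 ^+ 8 = 1 by rewrite exprVn z8 invr1.
have zV : z^-1 = z ^+ 7 by apply: (mulfI z0); rewrite mulfV // -exprS z8.
have [W3 xE] := oct_rel_curve r.
have E2 := r 2%N; have E3 := r 3%N; rewrite /= in E2 E3.
have zV4 : z^-1 ^+ 4 = z ^+ 4.
  by rewrite zV -exprM (exprD z 24 4) (exprM z 8 3) z8 expr1n mul1r.
have zz : z * z^-1 = 1 by rewrite mulfV.
have octE : oct (z * a) (z^-1 * b) = z ^+ 4 * oct a b.
  rewrite /oct !exprMn zV4.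
  transitivity ((z * z^-1) * z ^+ 4 * (a * b * (a ^+ 4 - b ^+ 4))); last by rewrite zz mul1r.
  by move: (z^-1) => w; ring.
have WE : octW (z * a) (z^-1 * b) = octW a b.
  rewrite /octW !exprMn zV4 z8 zV8 !mul1r; congr (_ + _ * _ + _).
  transitivity (z ^+ 8 * (a ^+ 4 * b ^+ 4)); first by ring.
  by rewrite z8 mul1r.
have XE : octX (z * a) (z^-1 * b) = z ^+ 4 * octX a b.
  rewrite /octX !exprMn (exprD z 8 4) (exprD z^-1 8 4) z8 zV8 zV4; ring.
have sE : oct_root (z * a) (z^-1 * b) = oct_root a b.
  rewrite /oct_root octE XE; congr (- (_ * _)).
  transitivity (z ^+ 8 * (oct a b * octX a b)); first by ring.
  by rewrite z8 mul1r.
have z44 : z ^+ 4 * z ^+ 4 = 1 by rewrite -exprD.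
have W1E : octW1 (z * a) (z^-1 * b) = z^-1 * octW1 a b.
  have zV1 : z^-1 * z ^+ 4 = z ^+ 3 by rewrite exprS mulKf.
  rewrite /octW1 !exprMn zV4 -zV -zV1.
  transitivity (z^-1 * (8 * a ^+ 7) + z^-1 * (z ^+ 4 * z ^+ 4) * (56 * (a ^+ 3 * b ^+ 4))).
    by move: (z^-1) => w; ring.
  by rewrite z44; move: (z^-1) => w; ring.
have W2E : octW2 (z * a) (z^-1 * b) = z * octW2 a b.
  have zV7 : z^-1 ^+ 7 = z by rewrite zV -exprM -{2}[z]expr1 (exprD z 48 1) (exprM z 8 6) z8 expr1n mul1r.
  have zV3 : z^-1 ^+ 3 = z * z ^+ 4 by rewrite -exprS zV -exprM (exprD z 16 5) (exprM z 8 2) z8 expr1n mul1r.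
  rewrite /octW2 !exprMn zV7 zV3.
  transitivity (z * (8 * b ^+ 7) + z * (z ^+ 4 * z ^+ 4) * (56 * (a ^+ 4 * b ^+ 3))); first by ring.
  by rewrite z44; ring.
case: i => [|[|[|i]]]; rewrite /oct_rel ?sE ?WE ?W1E ?W2E ?octE.
- exact: (r 0%N).
- by rewrite exprMn -exprM z8 mul1r; exact: (r 1%N).
- by rewrite mulrCA -mulrBr E2 mulr0.
- by rewrite mulrCA -mulrDr E3 mulr0.
Qed.

(** The system determines the derivatives from the values, so agreement at one point propagates. The
    case z = 1 glues neighbouring branches; other z compare the two ends of a lifted loop. *)
Lemma oct_branch_unique x U V U' V' z : z ^+ 8 = 1 -> ordinary_point oct_e x ->
  oct_branch_near x U V -> oct_branch_near x U' V' ->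
  U' x = z * U x -> V' x = z^-1 * V x ->
  (\forall y \near x, U' y = z * U y) /\ (\forall y \near x, V' y = z^-1 * V y).
Proof.
move=> z8 ox on on' Ux Vx.
have [sU sV w0 near_rel] := oct_system on ox.
have [sU' sV' _ near_rel'] := oct_system on' ox.
have rel := nbhs_singleton near_rel; have rel' := nbhs_singleton near_rel'.
have s0 : oct_root (U' x) (V' x) != 0 by exact: oct_curve_root (oct_rel_curve rel') ox.
have relz i : oct_rel i x (U' x) (V' x) (z * deriv U x) (z^-1 * deriv V x) = 0.
  by rewrite Ux Vx; exact: oct_rel_twist.
have [dU dV] := oct_rel_deriv s0 rel' relz.
have /local_solutionP/nbhs_singleton[hU _] := sU.
have /local_solutionP/nbhs_singleton[hV _] := sV.
have dzU := hd_deriv (hdD (hdM (hdcst x z) hU) (hdM (hdcst x 0) hV)).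
have dzV := hd_deriv (hdD (hdM (hdcst x 0) hU) (hdM (hdcst x z^-1) hV)).
rewrite !(mulr0, mul0r, addr0, add0r) in dzU dzV.
have FU := solution_eq sU sV w0 sU' (local_solution_lin z 0 sU sV).
have FV := solution_eq sU sV w0 sV' (local_solution_lin 0 z^-1 sU sV).
rewrite dzU Ux mul0r addr0 in FU; rewrite dzV Vx mul0r add0r in FV.
split.
  by apply: filterS (FU erefl dU) => y ->; rewrite mul0r addr0.
by apply: filterS (FV erefl dV) => y ->; rewrite mul0r add0r.
Qed.

(** The last clause turns continuous motion on the curve into continuation of germs: nearby points
    of the curve are values of the chosen branch. *)
Definition is_oct_branch (p : C * (C * C)) (q : (C -> C) * (C -> C)) :=
  [/\ q.1 p.1 = p.2.1, q.2 p.1 = p.2.2, oct_branch_near p.1 q.1 q.2 &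
   \forall r \near p, on_oct_curve r.1 r.2.1 r.2.2 -> r.2 = (q.1 r.1, q.2 r.1)].

Lemma oct_branch_choice : exists br : C * (C * C) -> (C -> C) * (C -> C),
  forall p, on_oct_curve p.1 p.2.1 p.2.2 -> ordinary_point oct_e p.1 -> is_oct_branch p (br p).
Proof.
pose Q (p : C * (C * C)) (q : (C -> C) * (C -> C)) :=
  on_oct_curve p.1 p.2.1 p.2.2 -> ordinary_point oct_e p.1 -> is_oct_branch p q.
suff /choice[br brP] : forall p, exists q, Q p q by exists br.
move=> -[x [a b]] /=.
have [on|n] := pselect (on_oct_curve x a b); last by exists (id, id).
have [ox|n] := pselect (ordinary_point oct_e x); last by exists (id, id).
by have [U [V h]] := oct_branch on ox; exists (U, V).
Qed.

Definition diag2 z : 'M[C]_2 := \matrix_(i, j) if i == j then (if i == 0 then z else z^-1) else 0.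

(** The germs at time t are the branch chosen at (X t, A t, B t). They need not depend on t in any
    coherent way beyond passing through the path; uniqueness of branches supplies the rest. *)
Lemma oct_path_monodromy (br : C * (C * C) -> (C -> C) * (C -> C)) (X A B : R -> C) z :
  (forall p, on_oct_curve p.1 p.2.1 p.2.2 -> ordinary_point oct_e p.1 -> is_oct_branch p (br p)) ->
  continuous X -> continuous A -> continuous B ->
  (forall t, on_oct_curve (X t) (A t) (B t)) -> (forall t, ordinary_point oct_e (X t)) ->
  z ^+ 8 = 1 -> X 1 = X 0 -> A 1 = z * A 0 -> B 1 = z^-1 * B 0 ->
  monodromy_group 6^-1 0 oct_e (X 0)
    (basis2 (br (X 0, (A 0, B 0))).1 (br (X 0, (A 0, B 0))).2) (diag2 z).
Proof.
move=> brP cX cA cB on oX z8 X1 A1 B1.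
have z0 : z != 0.
  by apply/eqP => z0; move: z8; rewrite z0 expr0n => /eqP; rewrite eq_sym oner_eq0.
have d00 : diag2 z 0 0 = z by rewrite mxE.
have d01 : diag2 z 0 1 = 0 by rewrite mxE.
have d10 : diag2 z 1 0 = 0 by rewrite mxE.
have d11 : diag2 z 1 1 = z^-1 by rewrite mxE.
pose p t := (X t, (A t, B t)).
have pP t : is_oct_branch (p t) (br (p t)) by apply: brP => /=.
have cp t : {for t, continuous p}.
  exact: cvg_pair (cX t) (cvg_pair (cA t) (cB t)).
have sol t : local_solution 6^-1 0 oct_e (X t) (br (p t)).1 /\
             local_solution 6^-1 0 oct_e (X t) (br (p t)).2.
  by have [_ _ n _] := pP t; have [sU sV _ _] := oct_system n (oX t).
have one8 : (1 : C) ^+ 8 = 1 by rewrite expr1n.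
have step t : \forall s \near t,
    (\forall x \near X s, (br (p s)).1 x = (br (p t)).1 x) /\
    (\forall x \near X s, (br (p s)).2 x = (br (p t)).2 x).
  have [_ _ n q] := pP t.
  have q1 : \forall s \near t, on_oct_curve (X s) (A s) (B s) ->
      (A s, B s) = ((br (p t)).1 (X s), (br (p t)).2 (X s)).
    exact: cp t _ q.
  have n1 : \forall s \near t, oct_branch_near (X s) (br (p t)).1 (br (p t)).2.
    have n' : \forall x \near X t, oct_branch_near x (br (p t)).1 (br (p t)).2.
      by move: n; rewrite /oct_branch_near /=; exact: nbhs_interior.
    exact: cX t _ n'.
  near=> s.
  have [U0 V0 ns _] := pP s.
  have ns' : oct_branch_near (X s) (br (p t)).1 (br (p t)).2 by near: s.
  have [eA eB] : (A s, B s) = ((br (p t)).1 (X s), (br (p t)).2 (X s)).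
    by move: (on s); near: s.
  have [] := oct_branch_unique one8 (oX s) ns' ns _ _.
  - by rewrite mul1r -eA.
  - by rewrite invr1 mul1r -eB.
  move=> h1 h2; split.
    by apply: filterS h1 => x ->; rewrite mul1r.
  by apply: filterS h2 => x ->; rewrite invr1 mul1r.
split.
  by rewrite unitmxE unitfE det22E d00 d01 d10 d11 mulfV // mul0r subr0 oner_neq0.
exists X; split.
  split; [exact: continuous_subspaceT cX|exact: erefl|exact: X1|].
  by move=> t _; exact: oX.
exists (fun j t => basis2 (br (p t)).1 (br (p t)).2 j).
have [U0 V0 n0 _] := pP 0; have [U1 V1 n1 _] := pP 1; rewrite /= in U0 V0 U1 V1 n0 n1.
rewrite X1 in U1 V1 n1.
have [||e1 e2] := oct_branch_unique z8 (oX 0) n0 n1.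
- by rewrite U1 U0.
- by rewrite V1 V0.
move=> j; split.
- move=> t t01; have [s1 s2] := sol t.
  have [->|->] := ord2P j; split=> //.
    by apply: filterS (step t) => s [h _] _.
  by apply: filterS (step t) => s [_ h] _.
- by near=> x.
have [->|->] := ord2P j; rewrite /basis2 /=.
  by apply: filterS e1 => x ->; rewrite ord2_sum /= d00 d10 mulr0 addr0 mulrC.
by apply: filterS e2 => x ->; rewrite ord2_sum /= d01 d11 mulr0 add0r mulrC.
Unshelve. all: by end_near. Qed.

End OctahedralMonodromy.

(** * An explicit path on the octahedral curve *)

Section OctahedralPath.
Variable R : realType.
Local Notation C := R[i].
Local Notation oct_e := (@oct_e R).
Implicit Types (t th : R) (v y w : C).

Lemma cisN th : cis (- th) = (cis th)^-1.
Proof. by apply: (mulfI (cis_neq0 th)); rewrite -cisD subrr cis0 mulfV // cis_neq0. Qed.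

(* The curve is parametrized by [y |-> path_scale (y ^ 8) * (y, 1 / y)], and the
   loop by the circle [|y ^ 8| = 2], on which the arguments of [root8] stay in
   the right half-plane. *)
Definition path_scale v : C := root8 3 * root8 (v + 14 + v^-1)^-1.
Definition path_point v : C := 2 * (path_scale v ^+ 12 * (v - 2 + v^-1)).

Lemma path_scale8 v : path_scale v ^+ 8 = 3 / (v + 14 + v^-1).
Proof. by rewrite exprMn !root8E. Qed.

Lemma path_scale_neq0 v : v + 14 + v^-1 != 0 -> path_scale v != 0.
Proof.
move=> W0; have : path_scale v ^+ 8 != 0.
  rewrite path_scale8; apply: mulf_neq0; first by rewrite (pnatr_eq0 _ 3).
  by rewrite invr_eq0.
by apply: contraNneq => ->; rewrite expr0n.
Qed.

Lemma path_on_curve y : y != 0 -> y ^+ 8 + 14 + (y ^+ 8)^-1 != 0 ->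
  on_oct_curve (path_point (y ^+ 8)) (path_scale (y ^+ 8) * y) (path_scale (y ^+ 8) * y^-1).
Proof.
move=> y0 W0; rewrite /on_oct_curve octW_hom oct_hom path_scale8 /path_point; split.
  have -> : octW y y^-1 = y ^+ 8 + 14 + (y ^+ 8)^-1.
    by rewrite /octW; move: y0 W0 => y0 _; field.
  by rewrite divfK.
congr (_ * _); rewrite exprMn -exprM; congr (_ * _).
by move: y0 {W0} => y0; rewrite /oct; field.
Qed.

(** The conditions on v = y^8 say that W, f and X do not vanish at (y, 1/y): f is (v - 1)/y^4, and X
    is (v + 1)/y^4 times v - 34 + 1/v. *)
Lemma path_ordinary y : y != 0 -> y ^+ 8 + 14 + (y ^+ 8)^-1 != 0 ->
  y ^+ 8 != 1 -> y ^+ 8 != -1 -> y ^+ 8 - 34 + (y ^+ 8)^-1 != 0 ->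
  ordinary_point oct_e (path_point (y ^+ 8)).
Proof.
move=> y0 W0 v1 vN1 v34; have on := path_on_curve y0 W0.
have nz n : n.+1%:R != 0 :> C by rewrite pnatr_eq0.
have m0 := path_scale_neq0 W0.
have y4 : y ^+ 4 != 0 by rewrite expf_neq0.
have y8 : y ^+ 8 = y ^+ 4 * y ^+ 4 by rewrite -exprD.
have t0 : oct y y^-1 != 0.
  have -> : oct y y^-1 = (y ^+ 8 - 1) / y ^+ 4 by move: y0 {W0 on m0 v34}; rewrite /oct => y0; field.
  by rewrite mulf_neq0 ?subr_eq0 ?invr_eq0.
have x0 : octX y y^-1 != 0.
  have -> : octX y y^-1 = (y ^+ 8 + 1) / y ^+ 4 * (y ^+ 8 - 34 + (y ^+ 8)^-1).
    by move: y0 {W0 on m0 v34}; rewrite /octX => y0; field.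
  by apply: mulf_neq0 v34; rewrite mulf_neq0 ?invr_eq0 // addr_eq0.
have s0 : oct_root (path_scale (y ^+ 8) * y) (path_scale (y ^+ 8) * y^-1) != 0.
  rewrite /oct_root oppr_eq0; apply: mulf_neq0 (nz 31) _; rewrite oct_hom octX_hom.
  by apply: mulf_neq0; apply: mulf_neq0 => //; rewrite expf_neq0.
apply: lame_prod_ordinary; apply: contraNneq s0 => p0.
by rewrite -sqrf_eq0 (oct_curve_square on) p0 mulr0.
Qed.

(** On |v| = 2 the real part of v + 1/v lies between -5/2 and 5/2, so v + 14 + 1/v stays in the
    right half-plane and v - 34 + 1/v in the left one. *)
Lemma Re_2cis th (k : C) : complex.Re (2 * cis th + k + (2 * cis th)^-1) =
  5 / 2 * cos th + complex.Re k.
Proof.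
rewrite invfM -cisN -[2](rmorph_nat (real_complex R) 2) -fmorphV /cis cosN sinN.
by simpc => /=; case: k => a b /=; field.
Qed.

Lemma Re_neq0 (z : C) : complex.Re z != 0 -> z != 0.
Proof. by apply: contraNneq => ->. Qed.

Lemma norm_2cis th : `|2 * cis th| = 2 :> C.
Proof. by rewrite normrM norm_cis mulr1 normr_nat. Qed.

Lemma ReN_nat n : complex.Re (n%:R : C) = n%:R.
Proof. by rewrite -(rmorph_nat (real_complex R) n). Qed.

Lemma Re_2cis_gt0 th : 0 < complex.Re (2 * cis th + 14 + (2 * cis th)^-1).
Proof. by rewrite Re_2cis ReN_nat; have := cos_geN1 th; lra. Qed.

Lemma cnt_root8 (f : C -> C) v : {for v, continuous f} -> 0 < complex.Re (f v) ->
  {for v, continuous (fun w => root8 (f w))}.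
Proof. by move=> cf f0; exact: (cvg_comp _ _ cf (continuous_root8 f0)). Qed.

Lemma continuous_path_scale v : v != 0 -> 0 < complex.Re (v + 14 + v^-1) ->
  {for v, continuous path_scale}.
Proof.
move=> v0 W0; apply: (@cntM C C v (fun=> root8 3) (fun w => root8 (w + 14 + w^-1)^-1)); first exact: cntc.
have Wn : v + 14 + v^-1 != 0 by apply: Re_neq0; rewrite gt_eqF.
have cW : {for v, continuous (fun v : C => v + 14 + v^-1)}.
  apply: (@cntD C C v (fun v => v + 14)); last exact: (@cntV C C v (fun v => v) v0 cvg_id).
  by apply: (@cntD C C v (fun v => v)); [exact: cvg_id|exact: cntc].
have cV : {for v, continuous (fun v : C => (v + 14 + v^-1)^-1)} by apply: cntV.
by apply: (@cnt_root8 (fun v => (v + 14 + v^-1)^-1) v cV); exact: Re_inv_gt0.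
Qed.

Lemma continuous_path_point v : v != 0 -> 0 < complex.Re (v + 14 + v^-1) ->
  {for v, continuous path_point}.
Proof.
move=> v0 W0; have cm := continuous_path_scale v0 W0.
apply: (@cntM C C v (fun=> 2) (fun v => path_scale v ^+ 12 * (v - 2 + v^-1))); first exact: cntc.
apply: (@cntM C C v (fun v => path_scale v ^+ 12) (fun v => v - 2 + v^-1)); first exact: cntX.
apply: (@cntD C C v (fun v => v - 2)); last exact: (@cntV C C v (fun v => v) v0 cvg_id).
by apply: (@cntD C C v (fun v => v)); [exact: cvg_id|exact: cntc].
Qed.

End OctahedralPath.

(** * An element of order four in the finite octahedral monodromy group *)

Section OctahedralGroup.
Variable R : realType.
Local Notation C := R[i].
Local Notation oct_e := (@oct_e R).
Implicit Types (t th : R) (v y w : C).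

Lemma oct_e_inj : injective oct_e.
Proof.
have n1 : (1 : C) != 0 := oner_neq0 _.
have n2 : (1 : C) != -1 by rewrite eq_sym -subr_eq0 -opprD oppr_eq0 (pnatr_eq0 _ 2).
have nN : (-1 : C) != 0 by rewrite oppr_eq0.
have u : uniq [:: 0; 1; -1 : C].
  by rewrite /= !inE negb_or [0 == 1]eq_sym [0 == -1]eq_sym n1 nN n2.
by move=> i j /eqP; rewrite /oct_e nth_uniq // => /eqP/val_inj.
Qed.

Lemma oct_e_sum : \sum_i oct_e i = 0.
Proof. by rewrite ord3_sum /oct_e inordK //= add0r subrr. Qed.

Lemma ReN_natN n : complex.Re (- n%:R : C) = - n%:R.
Proof. by rewrite -ReN_nat; case: (n%:R : C). Qed.

(** Each power of w gets its own loop, so closure of the monodromy group under products is not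
    invoked. *)
Lemma octahedral_group : exists (G : set (set 'M[C]_2)) (w : C),
  [/\ is_projective_monodromy_group 6^-1 0 oct_e G, finite_set G, w ^+ 4 = -1 &
      forall k : nat, G (pgl_class (diag2 (w ^+ k)))].
Proof.
have [br brP] := oct_branch_choice R.
pose rho : C := root8 2.
have rho8 : rho ^+ 8 = 2 by exact: root8E.
have rho0 : rho != 0.
  apply/eqP => r0; move/eqP: rho8; rewrite r0 expr0n eq_sym.
  by rewrite (pnatr_eq0 _ 2).
(* While y turns by k pi/4, y^8 makes k full turns. The point x returns, and (a, b) is multiplied by
   w^k and w^-k. *)
pose th (k : nat) t := k%:R * (pi / 4) * t : R.
pose y k t := rho * cis (th k t).
have y8 k t : y k t ^+ 8 = 2 * cis (8 * th k t) by rewrite exprMn rho8 cisX.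
have y0 k t : y k t != 0 by rewrite mulf_neq0 ?cis_neq0.
have W0 k t : 0 < complex.Re (y k t ^+ 8 + 14 + (y k t ^+ 8)^-1).
  by rewrite y8 Re_2cis_gt0.
have Wn k t : y k t ^+ 8 + 14 + (y k t ^+ 8)^-1 != 0.
  by apply: Re_neq0; rewrite gt_eqF.
have one2 : (1 : C) != 2 by rewrite (eqr_nat C 1 2).
pose X k t := path_point (y k t ^+ 8).
pose A k t := path_scale (y k t ^+ 8) * y k t.
pose B k t := path_scale (y k t ^+ 8) * (y k t)^-1.
have on k t : on_oct_curve (X k t) (A k t) (B k t) by exact: path_on_curve.
have oX k t : ordinary_point oct_e (X k t).
  apply: (path_ordinary (y0 k t) (Wn k t)).
  - by apply: contraNneq one2 => v1; rewrite -(norm_2cis (8 * th k t)) -y8 v1 normr1.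
  - by apply: contraNneq one2 => v1; rewrite -(norm_2cis (8 * th k t)) -y8 v1 normrN1.
  - apply: Re_neq0; rewrite y8 Re_2cis ReN_natN.
    by have := cos_le1 (8 * th k t); move=> h; rewrite lt_eqF //; lra.
have cth k t : {for t, continuous (th k)}.
  by apply: (@cntM R R t (fun=> k%:R * (pi / 4)) id); [exact: cntc|exact: cvg_id].
have cy k t : {for t, continuous (y k)}.
  apply: (@cntM C R t (fun=> rho) (fun s => cis (th k s))); first exact: cntc.
  exact: (cvg_comp _ _ (cth k t) (@continuous_cis R _)).
have cy8 k t : {for t, continuous (fun s => y k s ^+ 8)} by exact: cntX.
have y80 k t : y k t ^+ 8 != 0 by rewrite expf_neq0.
have cm k t : {for t, continuous (fun s => path_scale (y k s ^+ 8))}.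
  exact: (cvg_comp _ _ (cy8 k t) (continuous_path_scale (y80 k t) (W0 k t))).
have cX k : continuous (X k).
  by move=> t; exact: (cvg_comp _ _ (cy8 k t) (continuous_path_point (y80 k t) (W0 k t))).
have cA k : continuous (A k).
  by move=> t; apply: (@cntM C R t (fun s => path_scale (y k s ^+ 8)) (y k));
    [exact: cm|exact: cy].
have cB k : continuous (B k).
  move=> t; apply: (@cntM C R t (fun s => path_scale (y k s ^+ 8)) (fun s => (y k s)^-1)).
    exact: cm.
  by apply: (@cntV C R t (y k)); [exact: y0|exact: cy].
pose w : C := cis (pi / 4).
have w4 : w ^+ 4 = -1.
  by rewrite cisX -[RHS]cis_pi; congr cis; field.
have w8 : w ^+ 8 = 1 by rewrite (exprM w 4 2) w4 sqrrN expr1n.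
have z8 k : (w ^+ k) ^+ 8 = 1 by rewrite -exprM mulnC exprM w8 expr1n.
have ys k : y k 0 = rho by rewrite /y /th mulr0 cis0 mulr1.
have ye k : y k 1 = w ^+ k * rho by rewrite /y /th mulr1 /w cisX mulrC.
have ye8 k : y k 1 ^+ 8 = rho ^+ 8 by rewrite ye exprMn z8 mul1r.
pose m := path_scale (rho ^+ 8).
pose P := path_point (rho ^+ 8).
pose U := (br (P, (m * rho, m * rho^-1))).1.
pose V := (br (P, (m * rho, m * rho^-1))).2.
have X0 k : X k 0 = P by rewrite /X ys.
have A0 k : A k 0 = m * rho by rewrite /A ys.
have B0 k : B k 0 = m * rho^-1 by rewrite /B ys.
have onP : on_oct_curve P (m * rho) (m * rho^-1).
  by rewrite -(X0 0) -(A0 0) -(B0 0); exact: on.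
have oP : ordinary_point oct_e P by rewrite -(X0 0); exact: oX.
have [UP VP nP _] := brP (P, (m * rho, m * rho^-1)) onP oP.
rewrite [_.1]/= [_.2]/= -/U -/V in UP VP nP.
have [sU sV w0 near_rel] := oct_system nP oP.
have mn0 : m != 0.
  by apply: path_scale_neq0; have := Wn 0 0; rewrite ys.
exists [set pgl_class M | M in monodromy_group 6^-1 0 oct_e P (basis2 U V)], w.
split.
- exists P, (basis2 U V); split; [exact: oP|exact: local_basis2 sU sV w0|exact: erefl].
- apply: oct_finite sU sV w0 _ near_rel.
  by rewrite VP; apply: mulf_neq0 mn0 _; rewrite invr_eq0.
- exact: w4.
move=> k; exists (diag2 (w ^+ k)); last exact: erefl.
have := oct_path_monodromy brP (cX k) (cA k) (cB k) (on k) (oX k) (z8 k).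
rewrite X0 A0 B0; apply.
- by rewrite /X ye8.
- by rewrite /A ye8 ye mulrCA.
- by rewrite /B ye8 ye invfM mulrCA.
Qed.

End OctahedralGroup.

(** * Projective groups *)

Section ProjectiveClasses.
Variable R : realType.
Local Notation C := R[i].
Implicit Types (M N : 'M[C]_2) (z w k c : C) (G H : set (set 'M[C]_2)).

Lemma pgl_mul_class M N : pgl_mul (pgl_class M) (pgl_class N) = pgl_class (M *m N).
Proof.
apply/seteqP; split.
  move=> _ [_ [a /eqP a0 <-] [_ [b /eqP b0 <-] <-]].
  exists (a * b); first by apply/eqP; exact: mulf_neq0.
  by rewrite -scalemxAl -scalemxAr scalerA.
move=> _ [a /eqP a0 <-]; exists (a *: M); first by exists a => //; exact/eqP.
exists N; first by exists 1; [apply/eqP; exact: oner_neq0|rewrite scale1r].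
by rewrite scalemxAl.
Qed.

Lemma diag2M z w : diag2 z *m diag2 w = diag2 (z * w).
Proof.
apply/matrixP => i j; rewrite mul22E !mxE.
have [->|->] := ord2P i; have [->|->] := ord2P j; rewrite /= ?(mul0r, mulr0, addr0, add0r) //.
by rewrite invfM.
Qed.

Lemma diag2_opp z : diag2 (- z) = (-1) *: diag2 z.
Proof.
apply/matrixP => i j; rewrite !mxE.
by have [->|->] := ord2P i; have [->|->] := ord2P j; rewrite /= ?mulr0 ?mulN1r ?invrN.
Qed.

Lemma scalar_mx_neq0 M c : M \in unitmx -> M = c%:M -> c != 0.
Proof.
move=> uM ME; apply/eqP => c0.
by move: uM; rewrite ME c0 unitmxE det_scalar expr0n unitr0.
Qed.

Lemma pgl_class_scalar c : c != 0 -> pgl_class (c%:M) = pgl_class 1%:M :> set 'M[C]_2.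
Proof. by move=> c0; rewrite -(scalemx1 2 c); exact: pgl_class_scale. Qed.

(** The image of the class of diag(w, 1/w) has a fourth power equal to the identity, hence a square
    equal to it. Injectivity would make diag(w^2, w^-2) scalar, so w^4 = 1. *)
Lemma pgl_not_isomorphic G H w : w ^+ 4 = -1 ->
  (forall k : nat, G (pgl_class (diag2 (w ^+ k)))) ->
  (forall X, H X -> exists M, [/\ X = pgl_class M, M \in unitmx &
     forall c, (M *m M) *m (M *m M) = c%:M -> exists k, M *m M = k%:M]) ->
  ~ pgl_isomorphic G H.
Proof.
move=> w4 GX HP [f [[fH finj _] fM]].
pose X n := pgl_class (diag2 (w ^+ n)).
have XD m n : pgl_mul (X m) (X n) = X (m + n)%N by rewrite pgl_mul_class diag2M -exprD.
have fX m n : f (X (m + n)%N) = pgl_mul (f (X m)) (f (X n)).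
  by rewrite -XD fM //; exact: GX.
have [N [f1 uN ord4]] := HP _ (fH _ (GX 1)).
have [E [f0 uE _]] := HP _ (fH _ (GX 0)).
rewrite -/(X 1) in f1; rewrite -/(X 0) in f0.
have f2 : f (X 2) = pgl_class (N *m N) by rewrite (fX 1 1) f1 pgl_mul_class.
have f4 : f (X 4) = pgl_class ((N *m N) *m (N *m N)) by rewrite (fX 2 2) f2 pgl_mul_class.
have X40 : X 4 = X 0.
  rewrite /X w4 diag2_opp pgl_class_scale ?oppr_eq0 ?oner_neq0 //.
(* The image of the identity class is idempotent, and an invertible matrix whose class is idempotent
   is scalar. *)
have [c Ec] : exists c, E = c%:M.
  have : pgl_class E = pgl_class (E *m E) by rewrite -pgl_mul_class -f0 -fX.
  move=> /esym/pgl_class_eq[c _ EE]; exists c.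
  by rewrite -[LHS](mulKmx uE) EE -scalemxAr mulVmx // scalemx1.
have c0 := scalar_mx_neq0 uE Ec.
have [k kE] : exists k, N *m N = k%:M.
  have : pgl_class ((N *m N) *m (N *m N)) = pgl_class E by rewrite -f4 X40.
  move=> /pgl_class_eq[k _]; rewrite Ec scale_scalar_mx; exact: ord4.
have k0 : k != 0 by apply: scalar_mx_neq0 kE; rewrite unitmx_mul uN.
have /pgl_class_eq[a _ /matrixP aE] : X 2 = X 0.
  apply: finj; rewrite ?inE; [exact: GX|exact: GX|].
  by rewrite f2 f0 kE Ec !pgl_class_scalar.
have := aE 0 0; have := aE 1 1; rewrite !mxE /= expr0 invr1 mulr1 => <- w2.
have w0 : w ^+ 2 != 0.
  by apply/eqP => w0; move/eqP: w4; rewrite (exprD w 2 2) w0 mul0r eq_sym oppr_eq0 oner_eq0.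
have : w ^+ 4 = 1 by rewrite (exprD w 2 2) {2}w2 mulfV.
rewrite w4 => /eqP; rewrite eq_sym -subr_eq0 opprK -(natrD _ 1 1).
by rewrite (pnatr_eq0 _ 2).
Qed.

End ProjectiveClasses.

Theorem corollary3p6 (R : realType) :
  exists (l B1 B2 : R[i]) (e1 e2 : 'I_3 -> R[i])
         (G1 G2 : set (set 'M[R[i]]_2)),
    [/\ forall n : int, 2 * l <> n%:~R,
        injective e1 /\ \sum_i e1 i = 0,
        injective e2 /\ \sum_i e2 i = 0,
        is_projective_monodromy_group l B1 e1 G1 /\
        is_projective_monodromy_group l B2 e2 G2 &
        [/\ finite_set G1, finite_set G2 & ~ pgl_isomorphic G1 G2]].
Proof.
have [G1 [w [m1 fin1 w4 GX]]] := octahedral_group R.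
have [B2 [e2 [G2 [inj2 sum2 m2 fin2 HP]]]] := icosahedral_group R.
exists 6^-1, 0, B2, (@oct_e R), e2, G1, G2; split.
- move=> n h; have n6 : (6 : R[i]) != 0 by rewrite (pnatr_eq0 _ 6).
  have : (n * 6)%:~R = 2%:~R :> R[i].
    by rewrite intrM -h mulfVK //; exact: n6.
  by move=> /intr_inj nE; have := dvdz_mull n (dvdzz 6); rewrite nE.
- by split; [exact: oct_e_inj|exact: oct_e_sum].
- by split.
- by split.
- by split=> //; exact: pgl_not_isomorphic w4 GX HP.
Qed.
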